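(* Let $n>2$ and $m\ge 1$ be integers, let $F_n$ be the free group with fixed basis $\mathbf a=(a_1,\dots,a_n)$, and fix a proper nonempty subset $S\subset\{1,\dots,n\}$. For $t\ge 1$ put $p_t := a_1^{t+1}a_2^{t+1}\cdots a_{n-1}^{t+1}a_1^{t+1}a_2^{t+1}a_1^{t+1}$. Let $\psi$ be the map from $\mathbb Z^m$ to the vertex set of the edge splitting graph $\mathcal{ES}_n^1$ that sends $(k_1,\dots,k_m)$ to the vertex represented by $(\mathbf x,S)$, where $\mathbf x=(a_1,\dots,a_{n-1},\,a_n p_1^{k_1}p_2^{k_2}\cdots p_m^{k_m})$. Then $\psi$ is a quasi-isometric embedding of $\mathbb Z^m$ (with the $\ell^1$ metric) into $\mathcal{ES}_n^1$, i.e. it yields an $m$-dimensional quasiflat. In particular, for $n>2$ the space $\mathcal{ES}_n^1$ (and hence the edge splitting complex $\mathcal{ES}_n$) contains a quasi-isometrically embedded copy of $\mathbb R^m$ for every $m\ge1$.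
   Context: Edge splitting graph $\mathcal{ES}_n^1$: vertices are conjugacy classes $[A*B]$ of free factorizations $F_n=A*B$ into two nontrivial free factors (the pair $\{A,B\}$ is unordered, and both factors are conjugated simultaneously by one element of $F_n$). Two distinct vertices are joined by an edge if there are representatives $A_1*B_1$ and $A_2*B_2$ of the two classes having a common refinement which is a free factorization of $F_n$ into three nontrivial factors. The graph carries the path metric with edges of length 1. A pair $(\mathbf x,S)$, where $\mathbf x=(x_1,\dots,x_n)$ is an ordered basis of $F_n$ and $S$ is a proper nonempty subset of $\{1,\dots,n\}$, represents the vertex $[\langle x_j: j\in S\rangle * \langle x_j: j\notin S\rangle]$. The edge splitting complex $\mathcal{ES}_n$ (equivalently, the separating sphere complex) is the simplicial complex with 1-skeleton $\mathcal{ES}_n^1$ whose simplices are the finite sets of pairwise adjacent vertices; it is viewed as a metric space with edges of length 1 and is quasi-isometric to its 1-skeleton. A map $f:X\to Y$ of metric spaces is a quasi-isometric embedding if there are constants $L\ge1$, $C\ge0$ with $\frac1L d(x,x')-C\le d(f(x),f(x'))\le L\,d(x,x')+C$ for all $x,x'\in X$. *)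

(* Defs.v *)
From HB Require Import structures.
From mathcomp Require Import all_boot all_order all_algebra.
From mathcomp Require Import all_classical reals ereal.

Set Implicit Arguments.
Unset Strict Implicit.
Unset Printing Implicit Defensive.

Import Order.TTheory GRing.Theory Num.Theory.
Local Open Scope classical_set_scope.
Local Open Scope ring_scope.

Definition subgroup (F : groupType) (A : set F) : Prop :=
  A 1%g /\ forall x y : F, A x -> A y -> A (x * y^-1)%g.

Definition generated (F : groupType) (X : set F) : set F :=
  smallest (@subgroup F) X.

Definition expgz (F : groupType) (x : F) (k : int) : F :=
  match k with Posz j => (x ^+ j)%g | Negz j => (x ^- j.+1)%g end.

(* The letter (i, true) stands for x_i and (i, false) for its inverse. *)
Definition word_eval (F : groupType) (n : nat) (x : n.-tuple F)
    (w : seq ('I_n * bool)) : F :=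
  (\prod_(l <- w) (if l.2 then tnth x l.1 else (tnth x l.1)^-1))%g.

Definition reduced_word (n : nat) (w : seq ('I_n * bool)) : Prop :=
  sorted (fun l l' => ~~ ((l.1 == l'.1) && (l.2 != l'.2))) w.

Definition free_basis (F : groupType) (n : nat) (x : n.-tuple F) : Prop :=
  forall g : F, exists! w, reduced_word w /\ word_eval x w = g.

(* F is the internal free product of the A i: every element is the value of a
   unique alternating word of nontrivial syllables. *)
Definition free_product (F : groupType) (I : eqType) (A : I -> set F) : Prop :=
  (forall i, subgroup (A i)) /\
  forall g : F, exists! w : seq (I * F),
    [/\ forall l, l \in w -> A l.1 l.2 /\ l.2 <> 1%g,
        sorted (fun l l' => l.1 != l'.1) w
      & (\prod_(l <- w) l.2)%g = g].

Definition free_factorization (F : groupType) (k : nat) (A : 'I_k -> set F) :=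
  free_product A /\ forall i, A i <> [set 1%g].

(* An unordered factorization A * B is the set {A, B} of its factors. *)
Definition splitting (F : groupType) (P : set (set F)) : Prop :=
  exists2 A : 'I_2 -> set F, free_factorization A & P = range A.

Definition conj_factors (F : groupType) (P : set (set F)) (g : F) :
    set (set F) :=
  [set [set (x ^ g)%g | x in A] | A in P].

Definition conj_class (F : groupType) (P : set (set F)) : set (set (set F)) :=
  range (conj_factors P).

Definition ES_vertex (F : groupType) : Type :=
  set_type [set u | exists2 P : set (set F), splitting P & u = conj_class P].

HB.instance Definition _ (F : groupType) := Choice.on (ES_vertex F).

(* {A, B} is obtained from the factorization X by multiplying together the
   factors indexed by T on one side and the remaining ones on the other. *)
Definition refines (F : groupType) (k : nat) (X : 'I_k -> set F)
    (P : set (set F)) : Prop :=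
  exists T : {set 'I_k},
    P = [set generated (\bigcup_(i in [set i | i \in T]) X i);
             generated (\bigcup_(i in [set i | i \notin T]) X i)].

Definition ES_adj (F : groupType) (u v : ES_vertex F) : Prop :=
  u <> v /\
  exists P Q : set (set F), [/\ val u P, val v Q &
    exists X : 'I_3 -> set F,
      [/\ free_factorization X, refines X P & refines X Q]].

Definition represents (F : groupType) (n : nat) (x : n.-tuple F)
    (S : {set 'I_n}) (v : ES_vertex F) : Prop :=
  free_basis x /\
  val v = conj_class [set generated [set tnth x j | j in [set j | j \in S]];
                          generated [set tnth x j | j in [set j | j \notin S]]].

(* The value is +oo when u and v lie in different components. *)
Definition graph_dist (R : realType) (V : Type) (adj : V -> V -> Prop)
    (u v : V) : \bar R :=
  ereal_inf [set (k%:R)%:E | k in [set k : nat | exists w : nat -> V,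
    [/\ w 0%N = u, w k = v & forall i, (i < k)%N -> adj (w i) (w i.+1)]]].

Definition flag_complex (V : Type) (adj : V -> V -> Prop) : set (set V) :=
  [set s | [/\ finite_set s, s !=set0
    & forall u v, s u -> s v -> u <> v -> adj u v]].

Definition one_skeleton (V : Type) (K : set (set V)) : set (set V) :=
  [set s | K s /\ (s #<= `I_2)%card].

(* Points of the geometric realization, in barycentric coordinates. *)
Record realization (R : realType) (V : choiceType) (K : set (set V)) : Type :=
  RealizationPoint {
    bary : V -> R;
    bary_ge0 : forall v, 0 <= bary v;
    bary_face : K [set v | bary v != 0];
    bary_sum : \sum_(v \in [set: V]) bary v = 1 }.

(* The factor 1/2 makes each simplex a regular Euclidean simplex with edges of
   length 1, instead of sqrt 2. *)
Definition simplex_dist (R : realType) (V : choiceType) (K : set (set V))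
    (p q : realization R K) : R :=
  Num.sqrt (2^-1 * \sum_(v \in [set: V]) (bary p v - bary q v) ^+ 2).

Definition same_face (R : realType) (V : choiceType) (K : set (set V))
    (p q : realization R K) : Prop :=
  exists2 s, K s & [set v | bary p v != 0] `|` [set v | bary q v != 0] `<=` s.

(* The length metric: infimum of the lengths of piecewise linear paths, each
   piece being a straight segment in one simplex. *)
Definition realization_dist (R : realType) (V : choiceType) (K : set (set V))
    (p q : realization R K) : \bar R :=
  ereal_inf [set l | exists k (z : nat -> realization R K),
    [/\ z 0%N = p, z k = q,
        forall i, (i < k)%N -> same_face (z i) (z i.+1)
      & l = (\sum_(i < k) simplex_dist (z i) (z i.+1))%:E]].

Definition quasi_isometric_embedding (R : realType) (X Y : Type)
    (dX : X -> X -> \bar R) (dY : Y -> Y -> \bar R) (f : X -> Y) : Prop :=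
  exists L C : R, [/\ 1 <= L, 0 <= C & forall x x' : X,
    ((L^-1)%:E * dX x x' - C%:E <= dY (f x) (f x'))%E /\
    (dY (f x) (f x') <= L%:E * dX x x' + C%:E)%E].

Definition l1_dist (R : realType) (m : nat) (k l : 'rV[int]_m) : \bar R :=
  ((\sum_(i < m) `|k 0 i - l 0 i|)%:~R)%:E.

Definition euclidean_dist (R : realType) (m : nat) (x y : 'rV[R]_m) : \bar R :=
  (Num.sqrt (\sum_(i < m) (x 0 i - y 0 i) ^+ 2))%:E.

(* Indices start at 0: nth 1 a i is the basis element a_(i+1). *)
Definition pword (F : groupType) (n : nat) (a : n.-tuple F) (t : nat) : F :=
  (\prod_(i <- iota 0 n.-1 ++ [:: 0; 1; 0]%N) (nth 1 a i) ^+ t.+1)%g.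

Definition twisted_basis (F : groupType) (n m : nat) (a : n.-tuple F)
    (k : 'rV[int]_m) : n.-tuple F :=
  [tuple if i == n.-1 :> nat
         then (tnth a i * \prod_(j < m) expgz (pword a j.+1) (k 0 j))%g
         else tnth a i
  | i < n].

(* Main.v *)
(* Let B be generated by a_1, ..., a_(n-1) and t = a_n. The vertex represented by
   (a_1, ..., a_(n-1), t w) with w in B is within bounded distance of the splitting
   <t w> * B, so that only w matters.

   Upper bound: multiplying a twisting word by a power of a basis element moves the
   vertex by a bounded amount, whatever the exponent and wherever the power is
   inserted, because all the splittings given by subsets of one basis are within
   distance 2. Hence changing one k_i by 1 costs a constant.

   Lower bound: to a splitting A * C one attaches a set of elements beta of B, which
   record how its translates relate B to the coset t B. If B is conjugate into a factor,
   beta is chosen so that a conjugate of t beta starts and ends outside this factor;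
   otherwise beta is such that the almost invariant sets cut out in B by the
   two ends of the edge t differ by few elements after translation by beta.
   Two splittings with a common refinement share such a beta, and a single splitting
   determines the value on beta of the Brooks quasimorphism counting p_s up to a constant:
   since the Whitehead graph of p_s has no cut vertex, each occurrence of p_s in g
   separates an element of an almost invariant set from its translate by g, and the
   compatible elements translate it to within a bounded number of elements. On the
   twisting word of k the quasimorphism is k_s up to a constant, because p_s does not
   occur in the powers of the other p_t.

   In the complex, cliques have bounded size: a nontrivial free factor admits a
   nontrivial homomorphism to Z/2, so that the annihilators of the two factors in
   Hom(F, Z/2) distinguish adjacent vertices. A truncated distance function of the graph
   then extends affinely to a Lipschitz function on the realization. *)
Require Import Defs.
From HB Require Import structures.
From mathcomp Require Import all_boot all_order all_algebra.
From mathcomp Require Import all_classical reals ereal.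
From mathcomp Require Import zify ring lra.

Set Implicit Arguments.
Unset Strict Implicit.
Unset Printing Implicit Defensive.

Import Order.TTheory GRing.Theory Num.Theory.
Local Open Scope classical_set_scope.
Local Open Scope nat_scope.
Local Open Scope group_scope.

(** * Reduced words *)

(** The trees dual to the splittings are never built: for a free product, [hin J] tells in which
    branch at [1] an element lies, and its translates are the half-spaces. The cosets of $B$ are the
    vertices of a second tree, that of $F$ as an HNN extension of $B$ with stable letter $t$ and
    trivial edge groups. The obstacle is uniformity. Almost invariance gives finite sets whose size
    depends on the splitting, while the cost of an edge of a path must not. The remedy is a coset of
    $B$ that is a leaf among the cosets cut by the half-space: all its neighbours but at most one
    lie almost entirely on one side, and the discrepancies are counted by uniqueness of cut points
    on geodesics, which gives the absolute constants 6 and 12. A constant depending on the splitting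
    survives only as an additive term in the count of occurrences; taking powers of the element
    removes it. The common beta of two splittings is found in the tree of the refinement: a base
    point is moved until it sees almost all of $B$ and $tB$ on the right side of nearly every
    relevant edge, and beta selects the point of its $B$-orbit nearest to its image under
    $t^{-1}$. *)

Ltac gsimp := rewrite ?(invgM, invgK, mulgA, mulgK, mulgVK, mulgV, mulVg, mul1g, mulg1, invg1).

Section Words.
Variable n : nat.
Implicit Types (l : 'I_n * bool) (u v w : seq ('I_n * bool)).

Definition linv l : 'I_n * bool := (l.1, ~~ l.2).

Lemma linvK : involutive linv.
Proof. by case=> i b; rewrite /linv /= negbK. Qed.

Lemma linv_neq l : linv l != l.
Proof. by case: l => i b; rewrite /linv xpair_eqE /=; case: b; rewrite andbF. Qed.

Definition winv w := rev (map linv w).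

Lemma winvK : involutive winv.
Proof. by move=> w; rewrite /winv map_rev revK mapK //; exact: linvK. Qed.

Lemma winv_cat u v : winv (u ++ v) = winv v ++ winv u.
Proof. by rewrite /winv map_cat rev_cat. Qed.

Lemma size_winv w : size (winv w) = size w.
Proof. by rewrite size_rev size_map. Qed.

Definition red w := sorted (fun l l' => l' != linv l) w.
Arguments red : simpl never.

Lemma reducedE w : reduced_word w = red w.
Proof.
rewrite /reduced_word; congr is_true.
apply: eq_sorted => -[i b] [j c] /=.
by rewrite /linv xpair_eqE /= (eq_sym j) ; case: b c => [] [].
Qed.

Lemma red_cons l w : red (l :: w) = (ohead w != Some (linv l)) && red w.
Proof. by case: w => [|l' w]. Qed.

Lemma red_cat u v : red (u ++ v) = [&& red u, red v &
  (if u is l :: u' then ohead v != Some (linv (last l u')) else true)].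
Proof.
elim: u => [|l u IH]; first by rewrite /= andbT.
rewrite cat_cons !(red_cons l) IH; case: u {IH} => [|l' u] /=; first by rewrite andbT andbC.
by rewrite -!andbA.
Qed.

Lemma red_catl u v : red (u ++ v) -> red u.
Proof. by rewrite red_cat => /andP[]. Qed.

Lemma red_catr u v : red (u ++ v) -> red v.
Proof. by rewrite red_cat => /and3P[]. Qed.

Lemma red_winv w : red (winv w) = red w.
Proof.
suff h u : red u -> red (winv u) by apply/idP/idP => /h //; rewrite winvK.
rewrite /red /winv rev_sorted sorted_map.
apply: sub_sorted => x y /= /eqP h; apply/eqP => e; apply: h.
by rewrite e linvK.
Qed.

Definition wred1 l w :=
  if w is l' :: w' then if l' == linv l then w' else l :: w else [:: l].
Definition wred w := foldr wred1 [::] w.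

Lemma wred1_red l w : red w -> red (wred1 l w).
Proof.
case: w => [|l' w] // h; rewrite /wred1; case: eqP => [_|/eqP e].
  by move: h; rewrite red_cons => /andP[].
by rewrite red_cons h andbT.
Qed.

Lemma wred_red w : red (wred w).
Proof. by elim: w => [|l w IH] //=; exact: wred1_red. Qed.

Lemma wred_id w : red w -> wred w = w.
Proof.
elim: w => [|l w IH] //; rewrite red_cons => /andP[h1 /IH h2]; rewrite /= h2.
by case: w h1 {IH h2} => [|l' w] //= /eqP h; case: eqP => // e; case: h; rewrite e.
Qed.

Lemma mem_wred w : {subset wred w <= w}.
Proof.
elim: w => [|l w IH] //= x; rewrite inE.
have: x \in wred1 l (wred w) -> (x == l) || (x \in wred w).
  case: (wred w) => [|l' w'] /=; first by rewrite inE => ->.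
  by case: eqP => _; rewrite !inE // => ->; rewrite !orbT.
by move=> h /h /orP[->|/IH ->] //; rewrite orbT.
Qed.

(** [c] is the longest piece that cancels. *)
Lemma red_cancel u v : red u -> red v ->
  exists u' c v', [/\ u = u' ++ c, v = winv c ++ v' & red (u' ++ v')].
Proof.
elim/last_ind: u v => [|u l IH] v hu hv; first by exists [::], [::], v.
case: v hv => [|l' v] hv; first by exists (rcons u l), [::], [::]; rewrite !cats0.
case: (eqVneq l' (linv l)) => [e|ne]; last first.
  exists (rcons u l), [::], (l' :: v); split; rewrite ?cats0 //.
  rewrite red_cat hu hv /=.
  by case: u {IH} hu => [|l0 u] _ /=; rewrite ?last_rcons; apply: contraNneq ne => -[->].
have hu' : red u by move: hu; rewrite -cats1 => /red_catl.
have hv' : red v by move: hv; rewrite red_cons => /andP[].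
have [u' [c [v' [e1 e2 h]]]] := IH v hu' hv'.
exists u', (rcons c l), v'; split => //; first by rewrite e1 rcons_cat.
by rewrite e e2 /winv map_rcons rev_rcons.
Qed.

Section Eval.
Variables (F : groupType) (y : n.-tuple F).

Definition letter l : F := if l.2 then tnth y l.1 else (tnth y l.1)^-1.

Lemma letter_linv l : letter (linv l) = (letter l)^-1.
Proof. by rewrite /letter /=; case: l.2; rewrite /= ?invgK. Qed.

Lemma word_eval_nil : word_eval y [::] = 1.
Proof. by rewrite /word_eval big_nil. Qed.

Lemma word_eval_cons l w : word_eval y (l :: w) = letter l * word_eval y w.
Proof. by rewrite /word_eval big_cons. Qed.

Lemma word_eval_cat u v : word_eval y (u ++ v) = word_eval y u * word_eval y v.
Proof. by rewrite /word_eval big_cat. Qed.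

Lemma word_eval1 l : word_eval y [:: l] = letter l.
Proof. by rewrite word_eval_cons word_eval_nil mulg1. Qed.

Lemma word_eval_winv w : word_eval y (winv w) = (word_eval y w)^-1.
Proof.
elim: w => [|l w IH]; first by rewrite word_eval_nil invg1.
rewrite -cat1s winv_cat !word_eval_cat IH invgM; congr (_ * _).
by rewrite /winv /= !word_eval1 letter_linv.
Qed.

Lemma word_eval_wred w : word_eval y (wred w) = word_eval y w.
Proof.
elim: w => [|l w IH] //=; rewrite word_eval_cons -IH.
case: (wred w) => [|l' w'] /=; first by rewrite word_eval1 word_eval_nil mulg1.
case: eqP => [->|_]; last by rewrite word_eval_cons.
by rewrite word_eval_cons letter_linv mulVKg.
Qed.

End Eval.
End Words.
Arguments red {n} w : simpl never.

Section FreeBasis.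
Variables (F : groupType) (n : nat) (a : n.-tuple F).
Hypothesis ha : free_basis a.

Definition rw (g : F) : seq ('I_n * bool) := projT1 (cid (ha g)).

Lemma rw_red g : red (rw g).
Proof. by rewrite -reducedE /rw; case: cid => w [[]]. Qed.

Lemma rwK g : word_eval a (rw g) = g.
Proof. by rewrite /rw; case: cid => w [[]]. Qed.

Lemma rw_eval w : red w -> rw (word_eval a w) = w.
Proof.
rewrite -reducedE => hw; rewrite /rw; case: cid => w' [_ h] /=; exact: h.
Qed.

Lemma rw_word w : rw (word_eval a w) = wred w.
Proof. by rewrite -(word_eval_wred a) rw_eval //; exact: wred_red. Qed.

Lemma rw_inj : injective rw.
Proof. by move=> g h e; rewrite -(rwK g) e rwK. Qed.

Lemma rw1 : rw 1 = [::].
Proof. by rewrite -(word_eval_nil a) rw_eval. Qed.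

Lemma rwM g h : rw (g * h) = wred (rw g ++ rw h).
Proof. by rewrite -{1}(rwK g) -{1}(rwK h) -word_eval_cat rw_word. Qed.

Lemma rwM_red g h : red (rw g ++ rw h) -> rw (g * h) = rw g ++ rw h.
Proof. by move=> hh; rewrite rwM wred_id. Qed.

Lemma rwV g : rw g^-1 = winv (rw g).
Proof.
by rewrite -{1}(rwK g) -word_eval_winv rw_eval //; rewrite red_winv rw_red.
Qed.

Lemma rw_letter l : rw (letter a l) = [:: l].
Proof. by rewrite -word_eval1 rw_eval. Qed.

Lemma rwM_cancel g h : exists u c v,
  [/\ rw g = u ++ c, rw h = winv c ++ v, rw (g * h) = u ++ v & red (u ++ v)].
Proof.
have [u [c [v [e1 e2 hr]]]] := red_cancel (rw_red g) (rw_red h).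
exists u, c, v; split => //.
rewrite -(rwK g) -(rwK h) e1 e2 -word_eval_cat -[RHS]rw_eval //; congr rw.
by rewrite !word_eval_cat word_eval_winv; gsimp.
Qed.

Section Hom.
Variables (G : groupType) (y : n.-tuple G).
Definition bhom (g : F) : G := word_eval y (rw g).

Lemma bhomM : {morph bhom : g h / g * h}.
Proof. by move=> g h; rewrite /bhom rwM word_eval_wred word_eval_cat. Qed.

Lemma bhom_basis i : bhom (tnth a i) = tnth y i.
Proof. by rewrite /bhom (rw_letter (i, true)) word_eval1. Qed.
End Hom.

Definition bspan (S : pred 'I_n) : set F := [set g | all (fun l => S l.1) (rw g)].

Lemma bspan1 S : bspan S 1.
Proof. by rewrite /bspan /= rw1. Qed.

Lemma bspanM S g h : bspan S g -> bspan S h -> bspan S (g * h).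
Proof.
rewrite /bspan /= rwM => hg hh; apply/allP => l /mem_wred.
by rewrite mem_cat => /orP[/(allP hg)|/(allP hh)].
Qed.

Lemma bspanV S g : bspan S g -> bspan S g^-1.
Proof. by rewrite /bspan /= rwV /winv all_rev all_map. Qed.

Lemma bspanVE S g : bspan S g^-1 <-> bspan S g.
Proof. by split=> /bspanV; rewrite ?invgK. Qed.

Lemma bspanMl S g h : bspan S g -> bspan S (g * h) <-> bspan S h.
Proof.
by move=> hg; split=> [/(bspanM (bspanV hg))|/(bspanM hg)]; rewrite ?mulKg.
Qed.

Lemma bspanMr S g h : bspan S h -> bspan S (g * h) <-> bspan S g.
Proof.
move=> hh; split=> [hgh|hg]; last exact: bspanM.
by have := bspanM hgh (bspanV hh); rewrite mulgK.
Qed.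

Lemma bspan_basis (S : pred 'I_n) i : bspan S (tnth a i) <-> S i.
Proof. by rewrite /bspan /= (rw_letter (i, true)) /= andbT. Qed.

Lemma bspan_letter (S : pred 'I_n) l : bspan S (letter a l) <-> S l.1.
Proof. by rewrite /bspan /= rw_letter /= andbT. Qed.

Lemma bspan_eval (S : pred 'I_n) w : all (fun l => S l.1) w -> bspan S (word_eval a w).
Proof.
elim: w => [|l w IH] /= => [_|/andP[h1 h2]]; first by rewrite word_eval_nil; exact: bspan1.
by rewrite word_eval_cons; apply: bspanM; [apply/bspan_letter|exact: IH].
Qed.

Lemma bspan_subgroup S : subgroup (bspan S).
Proof. by split=> [|x y hx hy]; [exact: bspan1|apply/bspanM => //; exact: bspanV]. Qed.

End FreeBasis.

Section Subgroup.
Variable F : groupType.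
Implicit Types (A : set F) (X : set F).

Lemma subgroup1 A : subgroup A -> A 1. Proof. by case. Qed.
Lemma subgroupV A x : subgroup A -> A x -> A x^-1.
Proof. by move=> [h1 h] hx; rewrite -[x^-1]mul1g; exact: h. Qed.
Lemma subgroupM A x y : subgroup A -> A x -> A y -> A (x * y).
Proof. by move=> hA hx hy; rewrite -[y]invgK; apply: (proj2 hA) => //; exact: subgroupV. Qed.

Lemma generated_subgroup X : subgroup (generated X).
Proof.
split=> [A [[]]//|x y hx hy A /[dup] hh [hA _]].
by apply: (proj2 hA); [exact: hx hh|exact: hy hh].
Qed.

Lemma sub_generated X : X `<=` generated X.
Proof. by move=> x hx A [_]; exact. Qed.

Lemma generated_min X A : subgroup A -> X `<=` A -> generated X `<=` A.
Proof. by move=> hA hX x hx; by apply: hx; split. Qed.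

End Subgroup.

Lemma generated_bspan (F : groupType) n (a : n.-tuple F) (ha : free_basis a) (S : pred 'I_n) :
  generated [set tnth a j | j in [set j | S j]] = bspan ha S.
Proof.
apply/seteqP; split.
  apply: generated_min; first exact: bspan_subgroup.
  by move=> _ [j hj <-]; apply/bspan_basis.
move=> g; rewrite /bspan /= -{2}(rwK ha g).
have hs := generated_subgroup [set tnth a j | j in [set j | S j]].
elim: (rw ha g) => [|l w IH] /= => [_|/andP[h1 h2]].
  by rewrite word_eval_nil; exact: subgroup1 hs.
rewrite word_eval_cons; apply: (subgroupM hs); last exact: IH.
have hl : generated [set tnth a j | j in [set j | S j]] (tnth a l.1).
  by apply: sub_generated; exists l.1.
by rewrite /letter; case: l.2 => //; exact: (subgroupV hs).
Qed.

(** * Normal forms in free products *)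

Section FreeProduct.
Variables (F : groupType) (I : eqType) (X : I -> set F).
Hypothesis hX : free_product X.
Implicit Types (w u v : seq (I * F)) (g h k : F) (J : pred I).

Let hXs i : subgroup (X i) := proj1 hX i.

Definition alternating w : Prop :=
  (forall l, l \in w -> X l.1 l.2 /\ l.2 <> 1) /\ sorted (fun l l' => l.1 != l'.1) w.
Definition pval w : F := \prod_(l <- w) l.2.
Definition hidx w := ohead (map fst w).

Lemma pval_nil : pval [::] = 1. Proof. by rewrite /pval big_nil. Qed.
Lemma pval_cons l w : pval (l :: w) = l.2 * pval w.
Proof. by rewrite /pval big_cons. Qed.
Lemma pval_cat u v : pval (u ++ v) = pval u * pval v.
Proof. by rewrite /pval big_cat. Qed.

Lemma alternating_nil : alternating [::]. Proof. by []. Qed.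

Lemma alternating_cons l w : alternating (l :: w) <->
  [/\ X l.1 l.2, l.2 <> 1, hidx w != Some l.1 & alternating w].
Proof.
split=> [[hm hs]|[h1 h2 h3 [hm hs]]].
  have [h1 h2] := hm l (mem_head _ _); split => //.
    by case: w hs {hm} => [|l' w] //= /andP[/eqP h _]; apply/eqP => -[e]; apply: h.
  by split=> [l' hl'|]; [apply: hm; rewrite inE hl' orbT|exact: path_sorted hs].
split=> [l'|]; first by rewrite inE => /orP[/eqP ->//|]; exact: hm.
case: w h3 hs {hm} => [|l' w] //= h3 ->; rewrite andbT.
by apply: contraNneq h3 => ->.
Qed.

Lemma alternating_cat u v : alternating u -> alternating v ->
  hidx (rev u) != hidx v -> alternating (u ++ v).
Proof.
elim: u => [|l u IH] //= /alternating_cons[h1 h2 h3 h4] hv hne.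
apply/alternating_cons; split => //.
  case: u h3 hne {IH h4} => [|l' u] //= _; rewrite eq_sym.
  by rewrite /rev /=.
case: u IH h3 h4 hne => [|l' u] //= IH h3 h4 hne.
apply: IH => //; move: hne; rewrite rev_cons /hidx map_rcons.
by case: (rev (l' :: u)) (size_rev (l' :: u)).
Qed.

Lemma alternating_catl u v : alternating (u ++ v) -> alternating u.
Proof.
elim: u => [|l u IH] // /alternating_cons[h1 h2 h3 /IH h4].
by apply/alternating_cons; split=> //; case: u h3 {IH h4}.
Qed.

Lemma alternating_catr u v : alternating (u ++ v) -> alternating v.
Proof. by elim: u => [|l u IH] // /alternating_cons[_ _ _ /IH]. Qed.

Definition nf g : seq (I * F) := projT1 (cid (proj2 hX g)).

Lemma nf_alt g : alternating (nf g).
Proof. by rewrite /nf; case: cid => w [[]]. Qed.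

Lemma nfK g : pval (nf g) = g.
Proof. by rewrite /nf; case: cid => w [[]]. Qed.

Lemma nf_pval w : alternating w -> nf (pval w) = w.
Proof. by move=> [h1 h2]; rewrite /nf; case: cid => w' [_] /= h; apply: h. Qed.

Lemma nf_inj : injective nf.
Proof. by move=> g h e; rewrite -(nfK g) e nfK. Qed.

Definition len g := size (nf g).
Definition hd g := hidx (nf g).

Lemma nf1 : nf 1 = [::].
Proof. by rewrite -pval_nil nf_pval. Qed.

Lemma len_eq0 g : (len g == 0)%N = (g == 1).
Proof.
apply/idP/eqP => [|->]; last by rewrite /len nf1.
by rewrite /len size_eq0 => /eqP e; rewrite -(nfK g) e pval_nil.
Qed.

Lemma hd1 : hd 1 = None. Proof. by rewrite /hd nf1. Qed.

Lemma hd_None g : (hd g == None) = (g == 1).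
Proof.
rewrite -len_eq0 /hd /len.
by case: (nf g).
Qed.

Definition wflip w := rev (map (fun l => (l.1, l.2^-1)) w).

Lemma nfV g : nf g^-1 = wflip (nf g).
Proof.
have alt w : alternating w -> alternating (wflip w) /\ pval (wflip w) = (pval w)^-1.
  move=> [h1 h2]; split; last first.
    elim: w {h1 h2} => [|l w IH]; first by rewrite /wflip /= pval_nil invg1.
    rewrite /wflip /= rev_cons -cats1 pval_cat -/(wflip w) IH.
    by rewrite !pval_cons pval_nil mulg1 invgM.
  split=> [l|].
    rewrite /wflip mem_rev => /mapP[l' /h1 [ha hb] ->] /=; split.
      exact: (subgroupV (@hXs _)).
    by move/eqP; rewrite invg_eq1 => /eqP.
  rewrite /wflip rev_sorted sorted_map; apply: sub_sorted h2 => x y /=.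
  by rewrite eq_sym.
have [h1 h2] := alt _ (nf_alt g).
by rewrite -{1}(nfK g) -h2 nf_pval.
Qed.

Lemma lenV g : len g^-1 = len g.
Proof. by rewrite /len nfV /wflip size_rev size_map. Qed.

Lemma hidx_rev_nf g : hidx (rev (nf g)) = hd g^-1.
Proof. by rewrite /hd nfV /wflip /hidx -map_rev -map_comp. Qed.

Lemma nfM g h : hd g^-1 != hd h -> nf (g * h) = nf g ++ nf h.
Proof.
move=> hne; rewrite -{1}(nfK g) -{1}(nfK h) -pval_cat nf_pval //.
by apply: alternating_cat; rewrite ?hidx_rev_nf //; exact: nf_alt.
Qed.

Lemma lenM g h : hd g^-1 != hd h -> len (g * h) = len g + len h.
Proof. by move=> hne; rewrite /len nfM // size_cat. Qed.

Lemma hdM g h : hd g^-1 != hd h -> g != 1 -> hd (g * h) = hd g.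
Proof.
move=> hne; rewrite /hd nfM //; rewrite -len_eq0 /len.
by case: (nf g).
Qed.

Lemma nf_syl i s : X i s -> s <> 1 -> nf s = [:: (i, s)].
Proof.
move=> h1 h2; have -> : s = pval [:: (i, s)] by rewrite pval_cons pval_nil mulg1.
rewrite nf_pval ?pval_cons ?pval_nil ?mulg1 //.
by apply/alternating_cons; split.
Qed.

Lemma hd_syl i s : X i s -> s <> 1 -> hd s = Some i.
Proof. by move=> h1 h2; rewrite /hd (nf_syl h1). Qed.

Definition pmul1 (l : I * F) w :=
  if w is l' :: w' then
    if l'.1 == l.1 then (if l.2 * l'.2 == 1 then w' else (l.1, l.2 * l'.2) :: w')
    else l :: w
  else [:: l].

Lemma nf_pmul1 i s g : X i s -> s <> 1 -> nf (s * g) = pmul1 (i, s) (nf g).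
Proof.
move=> h1 h2; rewrite -{1}(nfK g); move: (nf_alt g).
case: (nf g) => [|[i' s'] w] => hw.
  by rewrite pval_nil mulg1 (nf_syl h1).
rewrite /pmul1 /=; move/alternating_cons: hw => [/= h3 h4 h5 h6].
case: eqP => [e|ne]; last first.
  rewrite -(pval_cons (i, s)) nf_pval //.
  apply/alternating_cons; split => //=; first by apply/eqP => -[].
  by apply/alternating_cons; split.
rewrite e in h3 h5; rewrite pval_cons mulgA /=.
case: eqP => [->|ne]; first by rewrite mul1g nf_pval.
rewrite -(pval_cons (i, s * s')) nf_pval //.
by apply/alternating_cons; split => //; exact: (subgroupM (hXs i)).
Qed.

Lemma syl_ind (P : F -> Prop) : P 1 ->
  (forall i s g, X i s -> s <> 1 -> P g -> P (s * g)) -> forall g, P g.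
Proof.
move=> P1 PM g; rewrite -(nfK g); move: (nf_alt g).
elim: (nf g) => [|l w IH]; first by rewrite pval_nil.
move=> /alternating_cons[h1 h2 _ /IH h]; rewrite pval_cons.
exact: PM h1 h2 h.
Qed.

Lemma len_pmul1 i s g : X i s -> len (s * g) <= (len g).+1.
Proof.
move=> h1; have [->|/eqP h2] := eqVneq s 1; first by rewrite mul1g leqW.
rewrite /len (nf_pmul1 _ h1 h2); case: (nf g) => [|l w] //=.
by case: eqP => //= _; case: eqP => //= _; rewrite ?leqW.
Qed.

Lemma len_leM g h : len (g * h) <= len g + len h.
Proof.
rewrite -{1}(nfK g) /len; move: (nf_alt g).
elim: (nf g) => [|l w IH]; first by rewrite pval_nil mul1g.
move=> /alternating_cons[h1 h2 _ /IH hh]; rewrite pval_cons -mulgA.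
by apply: leq_trans (len_pmul1 _ h1) _.
Qed.

Section ProductHom.
Variables (G : groupType) (f : I -> F -> G).
Hypothesis fM : forall i s t, X i s -> X i t -> f i (s * t) = f i s * f i t.

(** The homomorphism that the universal property of the free product attaches to the family [f];
    each [f i] only has to be multiplicative on [X i]. *)
Definition phom g : G := \prod_(l <- nf g) f l.1 l.2.

Let f1 i : f i 1 = 1.
Proof.
have h := subgroup1 (hXs i).
by have := fM h h; rewrite mulg1 => /(congr1 (fun x => (f i 1)^-1 * x)); rewrite mulKg mulVg.
Qed.

Lemma phom_pmul1 i s g : X i s -> phom (s * g) = f i s * phom g.
Proof.
move=> h1; have [->|/eqP h2] := eqVneq s 1; first by rewrite f1 !mul1g.
rewrite /phom (nf_pmul1 _ h1 h2); move: (nf_alt g).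
case: (nf g) => [|[i' s'] w] => [_|/alternating_cons[/= h3 _ _ _]].
  by rewrite big_seq1 big_nil mulg1.
rewrite /pmul1 /=; case: eqP => [e|ne]; last by rewrite big_cons.
rewrite e in h3 *; rewrite [in RHS]big_cons /= mulgA -fM //.
by case: eqP => [->|_]; rewrite ?f1 ?mul1g // big_cons.
Qed.

Lemma phomM : {morph phom : g h / g * h}.
Proof.
move=> g h; elim/syl_ind: g => [|i s g h1 h2 IH].
  by rewrite /phom nf1 big_nil !mul1g.
by rewrite -mulgA (@phom_pmul1 i s _ h1) (@phom_pmul1 i s _ h1) IH mulgA.
Qed.

Lemma phom_syl i s : X i s -> phom s = f i s.
Proof.
by move=> h; rewrite -[s in LHS]mulg1 (@phom_pmul1 i) // /phom nf1 big_nil mulg1.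
Qed.

Lemma phom1 : phom 1 = 1. Proof. by rewrite /phom nf1 big_nil. Qed.

Lemma phomV g : phom g^-1 = (phom g)^-1.
Proof.
by have := phomM g g^-1; rewrite mulgV phom1 => /esym /mulg1_eq ->.
Qed.
End ProductHom.

Definition fspan J : set F := [set g | all (fun l => J l.1) (nf g)].

Lemma fspan_subgroup J : subgroup (fspan J).
Proof.
have h1 : fspan J 1 by rewrite /fspan /= nf1.
have hM g h : fspan J g -> fspan J h -> fspan J (g * h).
  rewrite {1}/fspan /= => hg hh; rewrite -(nfK g).
  move: (nf_alt g) hg; elim: (nf g) => [|l w IH]; first by rewrite pval_nil mul1g.
  move=> /alternating_cons[h2 h3 _ /IH h4] /= /andP[h5 /h4].
  rewrite pval_cons -mulgA /fspan /= (nf_pmul1 _ h2 h3).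
  case: (nf _) => [|l' w'] /=; first by rewrite h5.
  by move=> /andP[h6 h7]; case: eqP => _; [case: eqP => _|]; rewrite /= ?h5 ?h6 ?h7.
split=> // g h hg hh; apply: hM => //.
by rewrite /fspan /= nfV /wflip all_rev all_map.
Qed.

Lemma generated_fspan J :
  generated (\bigcup_(i in [set i | J i]) X i) = fspan J.
Proof.
apply/seteqP; split.
  apply: generated_min; first exact: fspan_subgroup.
  move=> s [i /= hi hs]; have [->|/eqP h2] := eqVneq s 1.
    exact: subgroup1 (fspan_subgroup J).
  by rewrite /fspan /= (nf_syl hs h2) /= hi.
move=> g; rewrite /fspan /= -{2}(nfK g).
have hs := generated_subgroup (\bigcup_(i in [set i | J i]) X i).
move: (nf_alt g); elim: (nf g) => [|l w IH].
  by move=> _ _; rewrite pval_nil; exact: subgroup1 hs.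
move=> /alternating_cons[h1 _ _ /IH h2] /= /andP[h3 /h2 h4].
rewrite pval_cons; apply: (subgroupM hs) => //.
by apply: sub_generated; exists l.1.
Qed.

Lemma fspan_hd J g : fspan J g -> g != 1 -> exists2 i, J i & hd g = Some i.
Proof.
rewrite -len_eq0 /fspan /hd /len /=; case: (nf g) => [|l w] //= /andP[h _] _.
by exists l.1.
Qed.

(** A half-space of the tree of the free product cut at [1]: the branches at [1] with index in [J].
    Its translate [hin J (k^-1 * g)] is cut at [k], and takes the value [false] at [g = k]. *)
Definition hin J g := oapp J false (hd g).

Lemma hinM J g h : hd g^-1 != hd h -> g != 1 -> hin J (g * h) = hin J g.
Proof. by move=> h1 h2; rewrite /hin hdM. Qed.

Lemma fspan_hin J g : fspan J g -> hin J g = (g != 1).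
Proof.
move=> hg; have [->|ne] := eqVneq g 1; first by rewrite /hin hd1.
by have [i hi e] := fspan_hd hg ne; rewrite /hin e /= hi.
Qed.

Definition dist g h : nat := len (g^-1 * h)%g.

Lemma distC g h : dist g h = dist h g.
Proof. by rewrite /dist -lenV; gsimp. Qed.

Lemma dist_triangle k g h : dist g h <= dist g k + dist k h.
Proof.
rewrite /dist (_ : g^-1 * h = (g^-1 * k) * (k^-1 * h)); first exact: len_leM.
by gsimp.
Qed.

Lemma dist_eq0 g h : (dist g h == 0)%N = (g == h).
Proof. by rewrite /dist len_eq0 mulg_eq1 eqg_inv. Qed.

Lemma distM k g h : dist (k * g) (k * h) = dist g h.
Proof. by rewrite /dist invgM -mulgA mulKg. Qed.

(** Different values of [hin] force different first syllables, so nothing cancels at [k]: a point at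
    which [g] and [h] are separated lies on the geodesic between them. *)
Lemma sep_nf J k g h : hin J (k^-1 * g) != hin J (k^-1 * h) ->
  nf (g^-1 * h) = nf (g^-1 * k) ++ nf (k^-1 * h).
Proof.
move=> hne; rewrite -nfM; first by congr nf; gsimp.
by gsimp; apply: contraNneq hne; rewrite /hin => ->.
Qed.

Lemma sep_dist J k g h : hin J (k^-1 * g) != hin J (k^-1 * h) ->
  dist g h = dist g k + dist k h.
Proof. by move=> /sep_nf e; rewrite /dist /len e size_cat. Qed.

(** Such a [k] is [g] times a prefix of the normal form of [g^-1 * h]. *)
Lemma sep_finite J g h : finite_set [set k | hin J (k^-1 * g) != hin J (k^-1 * h)].
Proof.
pose s := [seq g * pval (take j (nf (g^-1 * h))) | j <- iota 0 (len (g^-1 * h)).+1].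
apply: (@sub_finite_set _ _ [set` s]); last by apply/finite_seqP; exists s.
move=> k /= /sep_nf e; apply/mapP; exists (len (g^-1 * k)).
  by rewrite mem_iota add0n ltnS /len e size_cat leq_addr.
by rewrite e take_size_cat // nfK; gsimp.
Qed.

(** Translating by [g^-1], the condition says that [g^-1] is a cut point between [1] and [h]. *)
Lemma hin_almost_invariant J h : finite_set [set g | hin J g != hin J (g * h)].
Proof.
have := finite_image (fun k : F => k^-1) (sep_finite J 1 h).
apply: sub_finite_set => g /= hg; exists g^-1; last by gsimp.
by rewrite /=; gsimp.
Qed.

(** Otherwise the path from [x] to [q] through [k] would be shorter than the geodesic by
    [2 * dist k c]. *)
Lemma dist_geo x c q k : dist x q = dist x c + dist c q ->
  dist x c = dist x k + dist k c -> dist c q = dist c k + dist k q -> k = c.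
Proof.
move=> e1 e2 e3; apply/eqP; rewrite -dist_eq0.
have := dist_triangle k x q; have := distC c k; lia.
Qed.

End FreeProduct.

(** * Almost invariant sets and geodesics *)

Section Almost.
Variable T : choiceType.
Implicit Types (Q S : set T) (P : pred T).

Definition almost_all Q P := finite_set [set q | Q q /\ ~~ P q].

Lemma almost_allI Q P P' :
  almost_all Q P -> almost_all Q P' -> almost_all Q (predI P P').
Proof.
move=> h h'; rewrite /almost_all.
apply: (@sub_finite_set _ _ ([set q | Q q /\ ~~ P q] `|` [set q | Q q /\ ~~ P' q])).
  by move=> q /= [hq]; rewrite negb_and => /orP[]; [left|right].
by rewrite finite_setU.
Qed.

Lemma almost_all_sub Q P P' : (forall q, Q q -> P q -> P' q) ->
  almost_all Q P -> almost_all Q P'.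
Proof.
move=> h; apply: sub_finite_set => q /= [hq hn]; split => //.
by apply: contraNN hn; exact: h.
Qed.

Lemma almost_all_ex Q P : infinite_set Q -> almost_all Q P -> exists2 q, Q q & P q.
Proof.
move=> hQ hP; apply: contrapT => hne; apply: hQ; apply: sub_finite_set hP.
by move=> q hq /=; split=> //; apply/negP => hp; apply: hne; exists q.
Qed.

Lemma infinite_almost_all Q P P' : infinite_set [set q | Q q /\ P q] ->
  almost_all Q P' -> exists q, [/\ Q q, P q & P' q].
Proof.
move=> hQ hP.
have [|q [h1 h2] h3] := @almost_all_ex [set q | Q q /\ P q] P' hQ.
  by apply: sub_finite_set hP => q /= [[]].
by exists q.
Qed.

Lemma seq_argmax (U : eqType) (f : U -> nat) (s : seq U) : s != [::] ->
  exists2 x, x \in s & forall y, y \in s -> f y <= f x.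
Proof.
elim: s => [|x s IH] // _; have [->|/IH[y hy hm]] := eqVneq s [::].
  by exists x; rewrite ?mem_head // => y; rewrite inE => /eqP ->.
have [hxy|hxy] := leqP (f x) (f y).
  exists y; first by rewrite inE hy orbT.
  by move=> u; rewrite inE => /orP[/eqP ->|/hm].
exists x; rewrite ?mem_head // => u; rewrite inE => /orP[/eqP ->//|/hm h].
exact: leq_trans h (ltnW hxy).
Qed.

Definition atmost N S := exists2 l : seq T, size l <= N & S `<=` [set` l].

Lemma atmostU M N S S' : atmost M S -> atmost N S' -> atmost (M + N) (S `|` S').
Proof.
move=> [l hl hS] [l' hl' hS']; exists (l ++ l'); first by rewrite size_cat leq_add.
by move=> q /= [/hS|/hS'] /=; rewrite mem_cat => ->; rewrite ?orbT.
Qed.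

Lemma atmost_sub N S S' : S' `<=` S -> atmost N S -> atmost N S'.
Proof. by move=> h [l hl hS]; exists l => //; exact: subset_trans hS. Qed.

Lemma atmost1 S : (forall x y, S x -> S y -> x = y) -> atmost 1 S.
Proof.
move=> h; have [[x hx]|hne] := pselect (exists x, S x).
  by exists [:: x] => // y hy /=; rewrite inE; apply/eqP/h.
by exists [::] => // y hy; case: hne; exists y.
Qed.

Lemma atmost_image (U : choiceType) (f : T -> U) N (S : set T) (S' : set U) :
  (forall u, S' u -> exists2 x, S x & f x = u) -> atmost N S ->
  exists2 l : seq U, size l <= N & S' `<=` [set` l].
Proof.
move=> h [l hl hS]; exists (map f l); first by rewrite size_map.
by move=> u /h[x /hS hx <-] /=; apply: map_f.
Qed.

End Almost.

Section Moves.
Variables (F : groupType) (I : eqType) (X : I -> set F).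
Hypothesis hX : free_product X.
Implicit Types (J : pred I) (x k : F) (Q R : set F) (E : F -> pred I -> Prop).

Local Notation hin := (hin hX).
Local Notation dist := (dist hX).

(* A pair [(k, J)] encodes an edge of the tree of the free product.  [wrong E Q x]
   lists the base points of the edges in [E] that separate [x] from almost all of [Q]. *)
Definition wrong E Q x : set F := [set k | exists2 J, E k J &
  almost_all Q (fun q => hin J (k^-1 * q) != hin J (k^-1 * x))].

(** If some edge is wrong, the new point is the base point [c] of a wrong edge farthest from [x].
    Another edge wrong for [c] would be wrong for [x] too and farther away, or its base point would
    lie on both halves of a geodesic through [c]. The second clause allows successive corrections:
    an edge with almost all of [R] on the side of [x] remains right, unless it is based at the new
    point. *)
Lemma move_point E Q x : infinite_set Q -> finite_set (wrong E Q x) ->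
  exists x', wrong E Q x' `<=` [set x'] /\
    forall R, (forall k J b, E k J -> infinite_set [set r | R r /\ hin J (k^-1 * r) == b]) ->
    forall k J, almost_all R (fun r => hin J (k^-1 * r) == hin J (k^-1 * x)) ->
      k = x' \/ hin J (k^-1 * x') = hin J (k^-1 * x).
Proof.
move=> hQ /finite_seqP[s hs].
have [s0|sn0] := eqVneq s [::].
  by exists x; split=> [k|R _ k J _]; [rewrite hs s0|right].
have [c hc hmax] := seq_argmax (dist x) sn0.
have [Jc hEc hQc] : wrong E Q x c by rewrite hs.
(* Here [q] lies beyond [c], and [k] separates [c] from both [x] and [q], hence is on both halves of
   the geodesic. *)
have keyP k J q : hin Jc (c^-1 * q) != hin Jc (c^-1 * x) ->
    hin J (k^-1 * q) == hin J (k^-1 * x) -> hin J (k^-1 * c) != hin J (k^-1 * x) -> k = c.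
  rewrite eq_sym => /sep_dist e1 /eqP h2 h3.
  have e2 : dist x c = dist x k + dist k c by apply: (@sep_dist _ _ _ _ J); rewrite eq_sym.
  have e3 : dist c q = dist c k + dist k q by apply: (@sep_dist _ _ _ _ J); rewrite h2.
  exact: dist_geo e1 e2 e3.
exists c; split.
  move=> k [J hE hk]; rewrite /=.
  have [//|/eqP kc] := pselect (k = c); exfalso.
  have [e|ne] := eqVneq (hin J (k^-1 * x)) (hin J (k^-1 * c)).
    have hkw : wrong E Q x k by exists J => //; apply: almost_all_sub hk => q _; rewrite e.
    have hkd : dist x k <= dist x c by apply: hmax; move: hkw; rewrite hs.
    have [q _ /andP[h1 h2]] := almost_all_ex hQ (almost_allI hk hQc).
    have e1 : dist x q = dist x k + dist k q.
      by apply: (@sep_dist _ _ _ _ J); rewrite e eq_sym.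
    have e2 : dist x q = dist x c + dist c q.
      by apply: (@sep_dist _ _ _ _ Jc); rewrite eq_sym.
    have e3 : dist c q = dist c k + dist k q.
      by apply: (@sep_dist _ _ _ _ J); rewrite eq_sym.
    have hck : dist c k = 0%N by lia.
    by move/eqP: hck; rewrite dist_eq0 eq_sym (negPf kc).
  have [q _ /andP[h1 h2]] := almost_all_ex hQ (almost_allI hk hQc).
  move/eqP: kc; apply; apply: (keyP k J q) => //; last by rewrite eq_sym.
  by move: h1 ne; case: (hin J _); case: (hin J _); case: (hin J _).
move=> R hR k J hk.
have [->|ne] := eqVneq (hin J (k^-1 * c)) (hin J (k^-1 * x)); [by right|left].
have [r [_ /eqP h1 h2]] := infinite_almost_all (hR _ _ (~~ hin Jc (c^-1 * x)) hEc) hk.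
by apply: (keyP k J r) => //; rewrite h1; case: hin.
Qed.

Lemma orbit_minimizer (B : set F) x y : B 1 -> exists2 b, B b &
  forall b', B b' -> dist (b * x) y <= dist (b' * x) y.
Proof.
move=> h1; pose P m := `[< exists2 b, B b & dist (b * x) y = m >].
have hP : exists m, P m by exists (dist (1 * x) y); apply/asboolP; exists 1.
have [m /asboolP[b hb e] hmin] := ex_minnP hP.
exists b => // b' hb'; rewrite e; apply: hmin; apply/asboolP.
by exists b'.
Qed.

(* If a geodesic from [b x] to [y] met [b1 g] and [b2 g], translating a piece of it
   would give a shorter path from another point of the orbit [B x]. *)
Lemma orbit_sep_once (B : set F) x y b g J b1 b2 : subgroup B -> B b ->
  (forall b', B b' -> dist (b * x) y <= dist (b' * x) y) ->
  B b1 -> B b2 ->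
  hin J ((b1 * g)^-1 * (b * x)) != hin J ((b1 * g)^-1 * y) ->
  hin J ((b2 * g)^-1 * (b * x)) != hin J ((b2 * g)^-1 * y) -> b1 = b2.
Proof.
move=> hB hb hmin h1 h2 s1 s2.
have e1 := sep_dist s1; have e2 := sep_dist s2.
have le c c' : B c -> B c' -> dist (b * x) y <= dist (b * x) (c * g) + dist (c' * g) y.
  move=> hc hc'; have hcc : B (c' * c^-1 * b).
    by apply: (subgroupM hB) => //; apply: (subgroupM hB) => //; exact: (subgroupV hB).
  apply: leq_trans (hmin _ hcc) _.
  apply: leq_trans (dist_triangle hX (c' * g) _ _) _; rewrite leq_add2r.
  rewrite -(distM hX (c' * c^-1) (b * x)).
  by rewrite leq_eqVlt; apply/orP; left; apply/eqP; congr (dist _ _); gsimp.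
have l1 := le _ _ h1 h2; have l2 := le _ _ h2 h1.
have ed : dist (b * x) (b1 * g) = dist (b * x) (b2 * g) by lia.
have := sep_nf s1; rewrite (sep_nf s2) => /eqP.
rewrite eqseq_cat; last by move: ed; rewrite /dist /len.
by move=> /andP[/eqP /nf_inj /mulgI /mulIg].
Qed.

End Moves.

(** * The subgroup generated by all but one basis element *)

Lemma cat_pivot_inj (T : eqType) (x y : T) (p : pred T) (u u' v v' : seq T) :
  all (predC p) u -> all (predC p) u' -> p x -> p y ->
  u ++ x :: v = u' ++ y :: v' -> [/\ u = u', x = y & v = v'].
Proof.
elim: u u' => [|c u IH] [|c' u'] //=.
- by move=> _ _ _ _ [-> ->].
- by move=> _ /andP[h _] hx _ [e _]; rewrite -e hx in h.
- by move=> /andP[h _] _ _ hy [e _]; rewrite e hy in h.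
move=> /andP[_ hu] /andP[_ hu'] hx hy [-> e].
by have [-> -> ->] := IH _ hu hu' hx hy e.
Qed.

Section Corank1.
Variables (F : groupType) (n : nat) (a : n.-tuple F).
Hypothesis ha : free_basis a.
Variable z : 'I_n.

Local Notation rw := (rw ha).

Definition zfree : pred ('I_n * bool) := fun l => l.1 != z.
Definition bfac : set F := bspan ha (predC1 z).
Local Notation B := bfac.
Definition tl (s : bool) : F := letter a (z, s).

Lemma bfac_subgroup : subgroup B. Proof. exact: bspan_subgroup. Qed.
Let hB := bfac_subgroup.

Lemma bfacE g : B g <-> all zfree (rw g). Proof. by []. Qed.

Lemma bfacMl b g : B b -> B (b * g) <-> B g.
Proof. exact: bspanMl. Qed.
Lemma bfacMr b g : B b -> B (g * b) <-> B g.
Proof. exact: bspanMr. Qed.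

Lemma bfac_basis i : i != z -> B (tnth a i).
Proof. by move=> hi; apply/bspan_basis. Qed.

Lemma tlV s : tl (~~ s) = (tl s)^-1.
Proof. by rewrite /tl -letter_linv. Qed.

Lemma rw_btl b s c : B b -> B c -> rw (b * tl s * c) = rw b ++ (z, s) :: rw c.
Proof.
move=> hb hc; rewrite -[RHS](rw_eval ha); last first.
  rewrite red_cat red_cons !rw_red /=.
  have -> : ohead (rw c) != Some (linv (z, s)).
    move: hc; rewrite bfacE; case: (rw c) => [|l w] //= /andP[h _].
    by apply: contraNneq h => -[->].
  move: hb; rewrite bfacE; case: (rw b) => [|l w] //= h.
  have : zfree (last l w) by move/allP: (h : all zfree (l :: w)); apply; rewrite mem_last.
  by apply: contraTneq => -[e _]; rewrite /zfree -e eqxx.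
by rewrite word_eval_cat word_eval_cons !rwK mulgA.
Qed.

(** In the tree of cosets of [B], distinct [b] lead to distinct neighbours [b * tl s * B]. *)
Lemma btl_inj s b c b' c' : B b -> B c -> B b' -> B c' ->
  b * tl s * c = b' * tl s * c' -> b = b' /\ c = c'.
Proof.
move=> hb hc hb' hc' /(congr1 rw); rewrite !rw_btl // => e.
have [||||/rw_inj -> _ /rw_inj ->//] := cat_pivot_inj (p := predC zfree) _ _ _ _ e.
- by apply: sub_all hb => l; rewrite /= negbK.
- by apply: sub_all hb' => l; rewrite /= negbK.
- by rewrite /= /zfree eqxx.
- by rewrite /= /zfree eqxx.
Qed.

(** The distance from [B] to the coset [g * B] in the tree of cosets. *)
Definition zcount g := count (predC zfree) (rw g).

Lemma zcountB b : B b -> zcount b = 0.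
Proof.
move=> hb; apply/eqP; rewrite /zcount -leqn0 leqNgt -has_count.
by apply/hasPn => l hl /=; rewrite negbK; apply: (allP hb).
Qed.

Lemma rw_tlM k s b : red (rcons (rw k) (z, s)) -> B b ->
  rw (k * tl s * b) = rw k ++ (z, s) :: rw b.
Proof.
move=> hk hb; rewrite -[RHS](rw_eval ha).
  by rewrite word_eval_cat word_eval_cons !rwK mulgA.
have := rw_red ha (1 * tl s * b); rewrite rw_btl ?bfacE ?rw1 // => hs.
move: hk; rewrite -cats1 red_cat => /and3P[h1 _ h2].
by rewrite red_cat h1 hs.
Qed.

Lemma zsplit g : B g \/ exists k s b,
  [/\ B b, g = k * tl s * b & red (rcons (rw k) (z, s))].
Proof.
have [h|h] := boolP (all zfree (rw g)); [by left|right].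
have : exists u s v, rw g = u ++ (z, s) :: v /\ all zfree v.
  move: h; elim: (rw g) => [|l w IH] //=; rewrite negb_and.
  have [hw|hw] := boolP (all zfree w).
    move=> hl; exists [::], l.2, w; split => //; congr cons.
    by move: hl; rewrite orbF /zfree negbK => /eqP <-; case: l.
  have [u [s [v [-> hv]]]] := IH hw.
  by exists (l :: u), s, v.
move=> [u [s [v [e hv]]]]; have hr := rw_red ha g; rewrite e in hr.
have hr' : red (rcons u (z, s)) by move: hr; rewrite -cat_rcons => /red_catl.
have e1 : rw (word_eval a u) = u by apply: rw_eval; exact: red_catl hr.
have e2 : rw (word_eval a v) = v.
  by apply: rw_eval; move: (red_catr hr); rewrite red_cons => /andP[].
exists (word_eval a u), s, (word_eval a v); rewrite e1; split => //.
- by rewrite bfacE e2.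
- by rewrite -(rwK ha g) e word_eval_cat word_eval_cons mulgA.
Qed.

Lemma zcount_tl k s b : red (rcons (rw k) (z, s)) -> B b ->
  zcount (k * tl s * b) = (zcount k).+1.
Proof.
move=> hk hb; rewrite /zcount rw_tlM // count_cat /= /zfree eqxx /= addnA addn1.
by rewrite -[count _ (rw b)]/(zcount b) zcountB // addn0.
Qed.

Lemma zcount_mulr g b : B b -> zcount (g * b) = zcount g.
Proof.
move=> hb; have [hg|[k [s [c [hc -> hr]]]]] := zsplit g.
  by rewrite !zcountB // bfacMr.
by rewrite -mulgA !zcount_tl //; exact: (subgroupM hB).
Qed.

(** The only neighbour of [k * B] that is not farther from [B] is the one on the way back, obtained
    by undoing the last $t^{\pm1}$ of [k]. For [k] in [B] there is none, and the exception is
    arbitrary. *)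
Lemma zcount_adjacent k : exists b0 s0, forall b s, B b -> (b, s) <> (b0, s0) ->
  zcount (k * b * tl s) = (zcount k).+1.
Proof.
have [hk|[k' [s1 [c [hc -> hr]]]]] := zsplit k.
  exists 1, true => b s hb _; have hkb : B (k * b) by exact: (subgroupM hB).
  rewrite -(mulg1 (_ * tl s)) /zcount rw_btl //; last exact: subgroup1 hB.
  rewrite count_cat rw1 /= /zfree eqxx /= addn1.
  by rewrite -[count _ _]/(zcount _) -[count _ (rw k)]/(zcount _) !zcountB.
exists c^-1, (~~ s1) => b s hb hne; have hcb : B (c * b) by exact: (subgroupM hB).
rewrite (zcount_mulr _ hc) -(zcount_mulr (k' * tl s1) hcb) mulgA.
rewrite -(mulg1 (_ * tl s)) zcount_tl //; last exact: subgroup1 hB.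
rewrite -(mulgA _ c b) rw_tlM // rcons_cat rcons_cons.
rewrite red_cat; move: hr; rewrite -cats1 red_cat => /and3P[-> _ ->] /=; rewrite andbT.
have h1 := rw_red ha (1 * tl s1 * (c * b)).
rewrite rw_btl ?rw1 /= in h1 => //; last exact: subgroup1 hB.
have h2 := rw_red ha (c * b * tl s * 1).
rewrite rw_btl ?rw1 /= in h2 => //; last exact: subgroup1 hB.
rewrite red_cons -cats1 h2 andbT; move: h1.
case e : (rw (c * b)) => [|l w]; last by rewrite red_cons => /andP[].
move=> _; apply/eqP => -[es]; apply: hne; congr pair; last exact: es.
by apply/esym/mulg1_eq; apply: (rw_inj (ha := ha)); rewrite e rw1.
Qed.

Lemma bfac_infinite : (1 < n)%N -> infinite_set B.
Proof.
move=> hn; have [i hi] : exists i : 'I_n, i != z.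
  have [e|ne] := eqVneq (nat_of_ord z) 0%N.
    by exists (Ordinal hn); apply/eqP => /(congr1 val) /=; rewrite e.
  exists (Ordinal (ltnW hn)); apply: contra_neq ne => /(congr1 val) /= ->.
  by [].
have hX k : rw (tnth a i ^+ k) = nseq k (i, true).
  elim: k => [|k IH]; first by rewrite rw1.
  have hr : red (nseq k.+1 (i, true)).
    elim: k {IH} => [|k IH] //; rewrite -[nseq k.+2 _]/((i, true) :: nseq k.+1 _).
    by rewrite red_cons IH andbT /= /linv; apply/eqP => -[].
  rewrite expgS -[tnth a i]/(letter a (i, true)) rwM_red rw_letter IH //.
apply: contra_not (infinite_nat) => hf.
have := finite_preimage (f := fun k => tnth a i ^+ k) (B := B) _ hf.
have -> : (fun k => tnth a i ^+ k) @^-1` B = setT.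
  apply/seteqP; split=> // k _; rewrite /= bfacE hX all_nseq /zfree /= hi.
  by rewrite orbT.
by apply => x y _ _ /(congr1 rw); rewrite !hX => /(congr1 size); rewrite !size_nseq.
Qed.

(** Connectedness of the Cayley graph of [B], by induction on the reduced word of [b]. *)
Lemma coset_connected (h : F -> bool) k :
  (forall b i, B b -> i != z -> h (k * b) = h (k * b * tnth a i)) ->
  forall b, B b -> h (k * b) = h k.
Proof.
move=> hh b; rewrite bfacE -{2}(rwK ha b).
elim/last_ind: (rw b) => [|w l IH]; first by rewrite word_eval_nil mulg1.
rewrite all_rcons => /andP[hl hw]; rewrite -cats1 word_eval_cat word_eval1 mulgA -IH //.
have hb : B (word_eval a w) by exact: bspan_eval.
rewrite /letter; case: l.2; first by rewrite -hh.
rewrite [RHS](_ : _ = h (k * (word_eval a w * (tnth a l.1)^-1) * tnth a l.1)).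
  rewrite -hh ?mulgA //; apply: (subgroupM hB) => //.
  by apply: (subgroupV hB); exact: bfac_basis.
by gsimp.
Qed.

End Corank1.

(** * Compatible twisting elements *)

Lemma finite_rel (T U : choiceType) (A : set U) (S : set T) (R : T -> U -> Prop) :
  finite_set A -> (forall b, S b -> exists2 u, A u & R b u) ->
  (forall b b' u, S b -> S b' -> R b u -> R b' u -> b = b') -> finite_set S.
Proof.
move=> hA hex hfun.
have [[b0 _]|hne] := pselect (exists b, S b); last first.
  by apply: (@sub_finite_set _ _ set0) => // b hb; case: hne; exists b.
apply: sub_finite_set (finite_image (fun u => xget b0 [set b | S b /\ R b u]) hA).
move=> b hb; have [u hu hr] := hex b hb; exists u => //.
have /(xgetPex b0) [h1 h2] : exists b, S b /\ R b u by exists b.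
exact: hfun h1 hb h2 hr.
Qed.

Section Crossing.
Variables (F : groupType) (n : nat) (a : n.-tuple F).
Hypothesis ha : free_basis a.
Hypothesis hn : (1 < n)%N.
Variable z : 'I_n.
Local Notation B := (bfac ha z).
Local Notation tl := (tl a z).
Let hB := bfac_subgroup ha z.
Let hBinf : infinite_set B := bfac_infinite hn.
Let hB1 : B 1 := subgroup1 hB.

Lemma almost_B_mull (P : pred F) b : B b ->
  almost_all B P -> almost_all B (fun c => P (b * c)).
Proof.
move=> hb hP; apply: sub_finite_set (finite_image (fun c => b^-1 * c) hP).
move=> c /= [hc h]; exists (b * c); last by gsimp.
by split => //; exact: (subgroupM hB).
Qed.

Section HalfSpace.
Variable H : pred F.
Hypothesis hH : forall h, finite_set [set g | H g != H (g * h)].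
Implicit Types (k b x : F).

Definition crosses k : Prop :=
  infinite_set [set b | B b /\ H (k * b)] /\ infinite_set [set b | B b /\ ~~ H (k * b)].

Definition tail k : bool := `[< almost_all B (fun b => H (k * b)) >].

Lemma tail_spec k : ~ crosses k -> almost_all B (fun b => H (k * b) == tail k).
Proof.
move=> hk; rewrite /tail; case: asboolP => h.
  by apply: almost_all_sub h => b _ ->.
have hf : finite_set [set b | B b /\ H (k * b)].
  by apply: contrapT => hi; apply: hk; split.
by apply: sub_finite_set hf => b /= [hb]; case: (H _).
Qed.

Lemma tail_eq k v : almost_all B (fun b => H (k * b) == v) -> tail k = v.
Proof.
case: v => h; rewrite /tail.
  by apply/asboolP; apply: almost_all_sub h => b _ /eqP.
apply/asboolP => h'.
by have [b _ /andP[/eqP ->]] := almost_all_ex hBinf (almost_allI h h').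
Qed.

Lemma almost_B_mulr g k v : almost_all B (fun b => H (k * b * g) == v) ->
  almost_all B (fun b => H (k * b) == v).
Proof.
move=> h.
have hf : finite_set [set b | H (k * b) != H (k * b * g)].
  apply: sub_finite_set (finite_image (fun u => k^-1 * u) (hH g)).
  by move=> b hb; exists (k * b) => //; gsimp.
have h' : almost_all B (fun b => H (k * b) == H (k * b * g)).
  by apply: sub_finite_set hf => b [].
by apply: almost_all_sub (almost_allI h h') => b _ /andP[/eqP <- /eqP ->].
Qed.

Lemma crosses_mulr k b : B b -> crosses (k * b) -> crosses k.
Proof.
move=> hb [h1 h2]; split.
  apply: contra_not h1 => h.
  apply: sub_finite_set (finite_image (fun c => b^-1 * c) h) => c /= [hc hh].
  exists (b * c); last by gsimp.
  by split; [exact: (subgroupM hB)|rewrite mulgA].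
apply: contra_not h2 => h.
apply: sub_finite_set (finite_image (fun c => b^-1 * c) h) => c /= [hc hh].
exists (b * c); last by gsimp.
by split; [exact: (subgroupM hB)|rewrite mulgA].
Qed.

Lemma crosses_mull k b : B b -> crosses k -> crosses (k * b).
Proof.
by move=> hb h; apply: (@crosses_mulr _ b^-1); rewrite ?mulgK //; exact: (subgroupV hB).
Qed.

Lemma crosses_val k g v : crosses k -> infinite_set [set b | B b /\ H (k * b * g) == v].
Proof.
move=> [h1 h2] hf.
have h : almost_all B (fun b => H (k * b) == ~~ v).
  apply: (@almost_B_mulr g); apply: sub_finite_set hf => b /= [hb].
  by case: H; case: v.
case: v h {hf} => h; [apply: h1|apply: h2].
  by apply: sub_finite_set h => b /= [hb ->].
by apply: sub_finite_set h => b /= [hb]; case: H.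
Qed.

(** The coboundary of [H] in the Cayley graph of $F$, each edge being given by its origin. *)
Definition frontier : set F := \bigcup_(i in [set: 'I_n]) [set g | H g != H (g * tnth a i)].

Lemma frontier_finite : finite_set frontier.
Proof. by apply: bigcup_finite => [|i _]; [exact: finite_finset|exact: hH]. Qed.

Lemma coset_frontier k b b' : B b -> B b' -> H (k * b) != H (k * b') ->
  exists2 c, B c & frontier (k * c).
Proof.
move=> hb hb' hne; apply: contrapT => hno.
have hc : forall b i, B b -> i != z -> H (k * b) = H (k * b * tnth a i).
  move=> c i hc _; apply/eqP; apply: contrapT => /negP h.
  by apply: hno; exists c => //; exists i.
by move/eqP: hne; rewrite (coset_connected hc hb) (coset_connected hc hb').
Qed.

Lemma crosses_frontier k : crosses k -> exists2 c, B c & frontier (k * c).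
Proof.
move=> [h1 h2].
have hall : almost_all B xpredT by apply: (@sub_finite_set _ _ set0) => // b [].
have [b [hb hb1 _]] := infinite_almost_all h1 hall.
have [b' [hb' hb1' _]] := infinite_almost_all h2 hall.
by apply: (coset_frontier hb hb'); rewrite hb1 (negPf hb1').
Qed.

(** The coset [k * B] is a leaf of the set of crossed cosets: at most one of its neighbours is
    crossed too. *)
Definition good k : Prop := crosses k /\
  exists b0 s0, forall b s, B b -> (b, s) <> (b0, s0) -> ~ crosses (k * b * tl s).

(** A crossed coset meets the finite frontier, so its distance from [B] is bounded. At maximal
    distance, every neighbour that is farther away is uncrossed, and this leaves out at most one. *)
Lemma good_exists k0 : crosses k0 -> exists k, good k.
Proof.
move=> h0.
have /finite_seqP[l hl] := frontier_finite.
pose M := \max_(g <- l) zcount ha z g.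
have hM k : crosses k -> zcount ha z k <= M.
  move=> /crosses_frontier[c hc hf]; rewrite -(zcount_mulr k hc).
  by apply: leq_bigmax_seq => //; rewrite hl in hf.
pose P m := `[< exists2 k, crosses k & zcount ha z k = m >].
have hex : exists m, P m by exists (zcount ha z k0); apply/asboolP; exists k0.
have hub m : P m -> m <= M by move=> /asboolP[k hk <-]; exact: hM.
have [m /asboolP[k hk e] hmax] := ex_maxnP hex hub.
exists k; split => //; have [b0 [s0 h]] := zcount_adjacent ha z k.
exists b0, s0 => b s hb hne hcr; have := h b s hb hne; rewrite e => e1.
have : m.+1 <= m by apply: hmax; apply/asboolP; exists (k * b * tl s).
by rewrite ltnn.
Qed.

(** An uncrossed coset whose tail differs from the value of [H] at its representative contains an
    element of the frontier, and distinct [b] give disjoint cosets. *)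
Lemma tail_end_finite k s : finite_set [set b | [/\ B b, ~ crosses (k * b * tl s)
  & tail (k * b * tl s) != H (k * b * tl s)]].
Proof.
apply: (finite_rel (R := fun b u => exists2 c, B c & u = k * b * tl s * c) frontier_finite).
  move=> b [h1 h2 h3]; have [c hc /eqP e] := almost_all_ex hBinf (tail_spec h2).
  have [c' hc' hf] : exists2 c', B c' & frontier (k * b * tl s * c').
    by apply: (coset_frontier hc hB1); rewrite e mulg1.
  by exists (k * b * tl s * c') => //; exists c'.
move=> b b' u [hb _ _] [hb' _ _] [c hc ->] [c' hc' e].
have e' : b * tl s * c = b' * tl s * c' by apply: (mulgI k); rewrite !mulgA.
by have [] := btl_inj hb hc hb' hc' e'.
Qed.

Lemma tail_finite k s : finite_set
  [set b | [/\ B b, ~ crosses (k * b * tl s) & tail (k * b * tl s) != H (k * b)]].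
Proof.
have hf := tail_end_finite k s.
pose S := [set b | H (k * b) != H (k * b * tl s)].
apply: (@sub_finite_set _ _ (S `|` [set b | [/\ B b, ~ crosses (k * b * tl s)
  & tail (k * b * tl s) != H (k * b * tl s)]])).
  move=> b /= [h1 h2 h3].
  have [e|ne] := eqVneq (H (k * b)) (H (k * b * tl s)); [right|by left].
  by rewrite -e.
rewrite finite_setU; split => //.
apply: sub_finite_set (finite_image (fun u => k^-1 * u) (hH (tl s))).
by move=> b hb; exists (k * b) => //; gsimp.
Qed.

(** The side of [H] that contains almost all of the neighbour through [t], when this neighbour is
    not crossed. For a good [k] it differs from [H (k * b)] for finitely many [b] only. *)
Definition Pplus k b := tail (k * b * tl true).
Definition Pminus k b := tail (k * b * tl false).

(** The bound 6 adds up the exceptions in [compatI]: one crossed neighbour at each end, 2 and 1 for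
    replacing the tails by values of [H], and 1 for comparing these values. *)
Definition compat k beta : Prop :=
  atmost 6 [set b | B b /\ Pminus k b != Pplus k (b * beta)].

Lemma good_atmost1 k s : good k -> atmost 1 [set b | B b /\ crosses (k * b * tl s)].
Proof.
move=> [_ [b0 [s0 h]]]; apply: atmost1 => b b' [hb hc] [hb' hc'].
have e c : B c -> crosses (k * c * tl s) -> c = b0.
  by move=> h1 h2; apply: contrapT => ne; apply: (h c s h1) h2 => -[].
by rewrite (e b) // (e b').
Qed.

(** The point [x] stands for the tails: outside the exceptional sets, [Pminus k b],
    [H (k * b * tl false * x)], [H (k * b * beta * x)] and [Pplus k (b * beta)] are equal in
    turn. *)
Lemma compatI k x beta : good k -> B beta ->
  atmost 2 [set b | [/\ B b, ~ crosses (k * b * tl true) & Pplus k b != H (k * b * x)]] ->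
  atmost 1 [set b | [/\ B b, ~ crosses (k * b * tl false)
                     & Pminus k b != H (k * b * tl false * x)]] ->
  atmost 1 [set b | B b /\ H (k * b * beta * x) != H (k * b * tl false * x)] ->
  compat k beta.
Proof.
move=> hg hbeta h2 h1 h0.
have shift N (S : set F) : atmost N S -> atmost N [set b | S (b * beta)].
  apply: (atmost_image (f := fun c => c * beta^-1)) => b hb.
  by exists (b * beta) => //; gsimp.
apply: (atmost_sub _ (atmostU (atmostU (atmostU (atmostU (good_atmost1 false hg) h1) h0)
  (shift _ _ (good_atmost1 true hg))) (shift _ _ h2))).
move=> b /= [hb hne].
have [h|hc] := pselect (crosses (k * b * tl false)); first by left; left; left; left.
have [e|h] := eqVneq (Pminus k b) (H (k * b * tl false * x)); last by left; left; left; right.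
have [e'|h] := eqVneq (H (k * b * beta * x)) (H (k * b * tl false * x)); last first.
  by left; left; right.
have hbb : B (b * beta) by exact: (subgroupM hB).
have [h|hc'] := pselect (crosses (k * (b * beta) * tl true)); first by left; right.
by right; split => //; rewrite mulgA e' -e eq_sym.
Qed.

(** Both sides are compared with [Pminus], whence 6 + 6. *)
Lemma compat2 k beta beta' : B beta -> compat k beta -> compat k beta' ->
  atmost 12 [set b | B b /\ Pplus k b != Pplus k (b * (beta^-1 * beta'))].
Proof.
move=> hb h h'.
apply: (atmost_image (f := fun c => c * beta)) (atmostU h h') => u /= [hu hne].
exists (u * beta^-1); last by gsimp.
have hub : B (u * beta^-1) by apply: (subgroupM hB) => //; exact: (subgroupV hB).
have [e|ne] := eqVneq (Pminus k (u * beta^-1)) (Pplus k u).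
  by right; split => //; rewrite e -mulgA.
by left; split => //; rewrite mulgVK.
Qed.

Lemma Pplus_finite k : good k -> finite_set [set b | B b /\ Pplus k b != H (k * b)].
Proof.
move=> hg; have [l _ hl] := good_atmost1 true hg.
apply: (@sub_finite_set _ _ ([set` l] `|`
  [set b | [/\ B b, ~ crosses (k * b * tl true) & tail (k * b * tl true) != H (k * b)]])).
  move=> b [hb hne]; have [h|h] := pselect (crosses (k * b * tl true)); last by right.
  by left; apply: hl.
rewrite finite_setU; split; last exact: tail_finite.
by apply/finite_seqP; exists l.
Qed.

Lemma Pplus_infinite k v : good k -> infinite_set [set b | B b /\ Pplus k b == v].
Proof.
move=> hg hf; apply: (@crosses_val k 1 v (proj1 hg)).
have hf' := Pplus_finite hg.
have : finite_set ([set b | B b /\ Pplus k b == v] `|` [set b | B b /\ Pplus k b != H (k * b)]).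
  by rewrite finite_setU.
apply: sub_finite_set => b /= [hb]; rewrite mulg1 => /eqP <-.
have [e|ne] := eqVneq (Pplus k b) (H (k * b)); [left|by right].
by split => //; apply/eqP.
Qed.

Lemma Pplus_almost_invariant k i : good k -> i != z ->
  finite_set [set b | B b /\ Pplus k b != Pplus k (b * tnth a i)].
Proof.
move=> hg hi; have hf := Pplus_finite hg.
have hBi := bfac_basis ha hi.
pose S := [set b | H (k * b) != H (k * b * tnth a i)].
apply: (@sub_finite_set _ _ ([set b | B b /\ Pplus k b != H (k * b)] `|` S `|`
  (fun c => c * (tnth a i)^-1) @` [set b | B b /\ Pplus k b != H (k * b)])).
  move=> b /= [hb hne].
  have [e|ne] := eqVneq (Pplus k b) (H (k * b)); last by left; left.
  have [e1|ne] := eqVneq (H (k * b)) (H (k * b * tnth a i)); last by left; right.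
  right; exists (b * tnth a i); last by gsimp.
  by split; [exact: (subgroupM hB)|rewrite mulgA -e1 -e eq_sym].
rewrite !finite_setU; split; last exact: finite_image.
split => //; apply: sub_finite_set (finite_image (fun u => k^-1 * u) (hH (tnth a i))).
by move=> b hb; exists (k * b) => //; gsimp.
Qed.

End HalfSpace.
End Crossing.

Section CommonCompat.
Variables (F : groupType) (n : nat) (a : n.-tuple F).
Hypothesis ha : free_basis a.
Hypothesis hn : (1 < n)%N.
Variable z : 'I_n.
Local Notation B := (bfac ha z).
Local Notation t := (tl a z true).
Local Notation t' := (tl a z false).
Let hB := bfac_subgroup ha z.
Let hBinf : infinite_set B := bfac_infinite hn.
Let hB1 : B 1 := subgroup1 hB.

Variables (I : eqType) (X : I -> set F).
Hypothesis hX : free_product X.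
Local Notation hin := (hin hX).

Let tV : t' = t^-1. Proof. exact: (tlV a z true). Qed.

Let almost_tB (P : pred F) :
  almost_all [set t * b | b in B] P <-> almost_all B (fun b => P (t * b)).
Proof.
split=> h.
  apply: sub_finite_set (finite_image (fun u => t^-1 * u) h) => b /= [hb hP].
  by exists (t * b); [split=> //; exists b|gsimp].
apply: sub_finite_set (finite_image (fun u => t * u) h) => _ /= [[b hb <-] hP].
by exists b.
Qed.

(** An edge of [E1] is wrong for [x] when [Pplus] disagrees with [H] at the translate of [x], an
    edge of [E2] when [Pminus] does. The base point [1] is corrected to [x1], with at most one wrong
    edge base in [E1], and then to [x2], with at most one in [E2] and two in [E1]. The last
    exception comes from a shortest path from the orbit of [x2] under [B] to [t^-1 * x2], which
    crosses at most one of the relevant translates of an edge. *)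
Lemma common_compat (J : bool -> pred I) (K : bool -> F) :
  (forall i, good ha z (hin (J i)) (K i)) ->
  exists2 beta, B beta & forall i, compat ha z (hin (J i)) (K i) beta.
Proof.
move=> hg.
have hH i := hin_almost_invariant hX (J i).
pose Q := [set t * b | b in B].
have hQ : infinite_set Q.
  move=> h; apply: hBinf; have := finite_image (fun u => t^-1 * u) h.
  apply: sub_finite_set => b hb; exists (t * b); [by exists b|by gsimp].
pose E1 k J' := exists i b, [/\ B b, ~ crosses ha z (hin (J i)) (K i * b * t),
  k = (K i * b)^-1 & J' = J i].
pose E2 k J' := exists i b, [/\ B b, ~ crosses ha z (hin (J i)) (K i * b * t'),
  k = (K i * b * t')^-1 & J' = J i].
have wrong1 x k : wrong hX E1 Q x k <-> exists i b, [/\ B b,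
    ~ crosses ha z (hin (J i)) (K i * b * t), k = (K i * b)^-1
    & Pplus ha z (hin (J i)) (K i) b != hin (J i) (K i * b * x)].
  split=> [[_ [i [b [hb hc -> ->]]] /almost_tB h]|[i [b [hb hc -> h]]]].
    exists i, b; split => //; rewrite /Pplus (tail_eq hn (v := ~~ hin (J i) (K i * b * x))).
      by case: hin.
    apply: almost_all_sub h => q _; rewrite invgK !mulgA.
    by case: hin; case: hin.
  exists (J i); first by exists i, b.
  apply/almost_tB; apply: almost_all_sub (tail_spec hc) => q _ /eqP e.
  by rewrite invgK !mulgA e.
have wrong2 x k : wrong hX E2 B x k <-> exists i b, [/\ B b,
    ~ crosses ha z (hin (J i)) (K i * b * t'), k = (K i * b * t')^-1
    & Pminus ha z (hin (J i)) (K i) b != hin (J i) (K i * b * t' * x)].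
  split=> [[_ [i [b [hb hc -> ->]]] h]|[i [b [hb hc -> h]]]].
    exists i, b; split => //.
    rewrite /Pminus (tail_eq hn (v := ~~ hin (J i) (K i * b * t' * x))).
      by case: hin.
    by apply: almost_all_sub h => q _; rewrite invgK; case: hin; case: hin.
  exists (J i); first by exists i, b.
  by apply: almost_all_sub (tail_spec hc) => q _ /eqP e; rewrite invgK e.
have fin1 : finite_set (wrong hX E1 Q 1).
  apply: (@sub_finite_set _ _ (\bigcup_(i in [set: bool]) ((fun b => (K i * b)^-1) @`
    [set b | [/\ B b, ~ crosses ha z (hin (J i)) (K i * b * t)
               & tail ha z (hin (J i)) (K i * b * t) != hin (J i) (K i * b)]]))).
    move=> k /wrong1[i [b [hb hc -> h]]]; exists i => //; exists b => //.
    by split => //; rewrite mulg1 in h.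
  apply: bigcup_finite => [|i _]; first exact: finite_finset.
  exact/finite_image/tail_finite.
have [x1 [m1 s1]] := move_point hQ fin1.
(* The cosets [K i * b * B] are crossed, so that every edge of [E1] has infinitely many elements of
   [B] on each side. *)
have {}s1 := s1 B _; have {}s1 : forall k J',
    almost_all B (fun r => hin J' (k^-1 * r) == hin J' (k^-1 * 1)) ->
    k = x1 \/ hin J' (k^-1 * x1) = hin J' (k^-1 * 1).
  apply: s1 => k' J2 v [i2 [b2 [hb2 _ -> ->]]] hf.
  apply: (@crosses_val _ _ _ ha z (hin (J i2)) (hH i2) (K i2 * b2) 1 v).
    exact: crosses_mull hb2 (proj1 (hg i2)).
  by move: hf; rewrite invgK; apply: sub_finite_set => r /=; rewrite mulg1.
(* For the base point [1] only finitely many edges of [E2] are wrong; the passage to [x1] adds at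
   most those based at [x1]. *)
have fin2 : finite_set (wrong hX E2 B x1).
  apply: (@sub_finite_set _ _ ([set x1] `|` \bigcup_(i in [set: bool])
    ((fun b => (K i * b * t')^-1) @`
    [set b | [/\ B b, ~ crosses ha z (hin (J i)) (K i * b * t')
               & tail ha z (hin (J i)) (K i * b * t') != hin (J i) (K i * b * t')]]))).
    move=> k /wrong2[i [b [hb hc ek h]]].
    have [e|ne] := eqVneq (tail ha z (hin (J i)) (K i * b * t')) (hin (J i) (K i * b * t')).
      left; have [|//|e2] := s1 k (J i).
        apply: almost_all_sub (tail_spec hc) => q _ /eqP eq.
        by rewrite ek invgK eq e mulg1.
      by move: h; rewrite /Pminus e -[_ * _ * t']invgK -ek e2 mulg1 eqxx.
    by right; exists i => //; exists b.
  rewrite finite_setU; split; first exact: finite_set1.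
  apply: bigcup_finite => [|i _]; first exact: finite_finset.
  exact/finite_image/tail_end_finite.
have [x2 [m2 s2]] := move_point hBinf fin2.
have {}s2 := s2 Q _; have {}s2 : forall k J',
    almost_all Q (fun r => hin J' (k^-1 * r) == hin J' (k^-1 * x1)) ->
    k = x2 \/ hin J' (k^-1 * x2) = hin J' (k^-1 * x1).
  apply: s2 => k' J2 v [i2 [b2 [hb2 _ -> ->]]] hf.
  apply: (@crosses_val _ _ _ ha z (hin (J i2)) (hH i2) (K i2 * b2) 1 v).
    exact: crosses_mull hb2 (proj1 (hg i2)).
  apply: sub_finite_set (finite_image (fun u => t^-1 * u) hf) => r /=.
  rewrite mulg1 => -[hr hr2]; exists (t * r); last by gsimp.
  by split; [exists r|rewrite tV; gsimp].
have [beta hbeta hmin] := orbit_minimizer hX x2 (t' * x2) hB1.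
exists beta => // i; apply: (compatI (x := x2)) => //.
(* The two exceptions are an edge based at [x1], still wrong after the first move, and one based at
   [x2], spoiled by the second. *)
- exists [:: (K i)^-1 * x1^-1; (K i)^-1 * x2^-1] => // b [hb hc h] /=; rewrite !inE.
  have hw : wrong hX E1 Q x2 ((K i * b)^-1) by apply/wrong1; exists i, b.
  have [e|ne] := eqVneq (Pplus ha z (hin (J i)) (K i) b) (hin (J i) (K i * b * x1)).
    have [|e2|e2] := s2 ((K i * b)^-1) (J i).
    - apply/almost_tB; apply: almost_all_sub (tail_spec hc) => q _ /eqP eq.
      by rewrite invgK mulgA eq -/(Pplus ha z (hin (J i)) (K i) b) e.
    - by apply/orP; right; rewrite -e2; gsimp.
    by move: h; rewrite e -[K i * b]invgK e2 eqxx.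
  have : wrong hX E1 Q x1 ((K i * b)^-1) by apply/wrong1; exists i, b.
  by move=> /m1 /= <-; apply/orP; left; gsimp.
- apply: atmost1 => b b' [hb hc h] [hb' hc' h'].
  have /m2 /= e : wrong hX E2 B x2 ((K i * b * t')^-1) by apply/wrong2; exists i, b.
  have /m2 /= : wrong hX E2 B x2 ((K i * b' * t')^-1) by apply/wrong2; exists i, b'.
  by rewrite -e => /invg_inj /mulIg /mulgI.
apply: atmost1 => b b' [hb h] [hb' h']; apply: invg_inj.
apply: (orbit_sep_once (g := (K i)^-1) (J := J i) hB hbeta hmin); try exact: (subgroupV hB).
  by gsimp.
by gsimp.
Qed.

End CommonCompat.

(** * The elliptic case *)

(** A syllable for [A i] starts with an [X]-syllable of index in [J i], and consecutive syllables
    for [A] do not cancel in [X], the sets [J i] being disjoint. Hence the half-spaces of two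
    splittings with a common refinement live in one tree. *)
Lemma coarsen_hd (F : groupType) (I I' : eqType) (X : I -> set F) (A : I' -> set F)
    (hX : free_product X) (hA : free_product A) (J : I' -> pred I) :
  (forall i, A i = fspan hX (J i)) -> (forall i i' l, J i l -> J i' l -> i = i') ->
  forall i g, hin hX (J i) g = (hd hA g == Some i).
Proof.
move=> hAJ hJ i g; rewrite -(nfK hA g); move: (nf_alt hA g) i.
elim: (nf hA g) => [|[i' s] w IH] hw i; first by rewrite pval_nil /hin !hd1.
rewrite /hd nf_pval //=; move/alternating_cons: hw => [/= h1 h2 h3 h4].
have {}IH := IH h4; rewrite pval_cons /=.
have hs : fspan hX (J i') s by rewrite -hAJ.
have ns : s != 1 by apply/eqP.
have [l hl el] := fspan_hd hs ns.
have hne : hd hX s^-1 != hd hX (pval w).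
  have hsV : fspan hX (J i') s^-1 by exact: (subgroupV (fspan_subgroup _ _)).
  have nsV : s^-1 != 1 by rewrite invg_eq1.
  have [l' hl' ->] := fspan_hd hsV nsV.
  have /negP := IH i'; rewrite /hd nf_pval // (negPf h3) => hin0.
  by apply: contraT; rewrite negbK => /eqP e; move: hin0; rewrite /hin /hd -e /= hl'.
rewrite /hin (hdM hne) // el /=.
by apply/idP/eqP => [h|[<-]//]; congr Some; exact: hJ hl h.
Qed.

Section Elliptic.
Variables (F : groupType) (n : nat) (a : n.-tuple F).
Hypothesis ha : free_basis a.
Hypothesis hn : (1 < n)%N.
Variable z : 'I_n.
Local Notation B := (bfac ha z).
Local Notation t := (tl a z true).
Local Notation t' := (tl a z false).
Let hB := bfac_subgroup ha z.
Let hBinf : infinite_set B := bfac_infinite hn.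
Let hB1 : B 1 := subgroup1 hB.
Let tV : t' = t^-1. Proof. exact: (tlV a z true). Qed.

Section Conj.
Variable A : 'I_2 -> set F.
Hypothesis hA : free_product A.
Local Notation H := (hin hA (pred1 ord0)).

(** Without crossed cosets, [tail] is constant on the cosets of [B] and differs from [H] at finitely
    many points, so some [x] has no wrong edge except possibly at [x]. As [tail] agrees at [k^-1]
    and [k^-1 * b], a cut point [k] between [x] and [b * x] makes [k] or [b^-1 * k] wrong for [x],
    and so is [x] or [b * x]. Thus [x^-1 * b * x] has at most one syllable. *)
Lemma elliptic_conj : (forall k, ~ crosses ha z H k) ->
  exists x j, forall b, B b -> A j (x^-1 * b * x).
Proof.
move=> hno; have hH := hin_almost_invariant hA (pred1 ord0).
have tailM k b : B b -> tail ha z H (k * b) = tail ha z H k.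
  move=> hb; apply: (tail_eq hn).
  have := almost_B_mull hb (tail_spec (hno k)).
  by apply: almost_all_sub => c _; rewrite mulgA.
have finS : finite_set [set u | tail ha z H u != H u].
  apply: (@sub_finite_set _ _ (\bigcup_(f in frontier a H)
    ((fun c => f * c) @` [set c | B c /\ ~~ (H (f * c) == tail ha z H f)]))).
    move=> u /= hu.
    have [b hb /eqP e] := almost_all_ex hBinf (tail_spec (hno u)).
    have [c hc hf] : exists2 c, B c & frontier a H (u * c).
      by apply: (coset_frontier hb hB1); rewrite mulg1 e.
    exists (u * c) => //; exists c^-1; last by gsimp.
    split; first exact: (subgroupV hB).
    by rewrite mulgK tailM // eq_sym.
  by apply: bigcup_finite => [|f _]; [exact: frontier_finite|exact/finite_image/tail_spec].
pose E (k : F) (J : pred 'I_2) := J = pred1 ord0.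
have wrongE x k : wrong hA E B x k <-> tail ha z H k^-1 != H (k^-1 * x).
  split=> [[_ -> h]|h].
    rewrite (tail_eq hn (v := ~~ H (k^-1 * x))); first by case: H.
    by apply: almost_all_sub h => q _; case: H; case: H.
  exists (pred1 ord0) => //; apply: almost_all_sub (tail_spec (hno k^-1)) => q _ /eqP ->.
  by [].
have fin1 : finite_set (wrong hA E B 1).
  apply: sub_finite_set (finite_image (fun u => u^-1) finS) => k /wrongE h.
  by exists k^-1; [rewrite /= mulg1 in h *|gsimp].
have [x [m _]] := move_point hBinf fin1; exists x.
have hsize b : B b -> size (nf hA (x^-1 * b * x)) <= 1.
  move=> hb; rewrite leqNgt; apply/negP.
  have := nf_alt hA (x^-1 * b * x); have := nfK hA (x^-1 * b * x).
  case: (nf hA _) => [|[i1 s1] [|[i2 s2] w]] //= e hw _.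
  have hw2 : alternating A ((i2, s2) :: w) by move/alternating_cons: hw => [].
  move/alternating_cons: hw => [/= h1 h2 h3 _].
  pose k := x * s1.
  have e1 : H (k^-1 * x) = (i1 == ord0).
    rewrite /k; gsimp; rewrite /hin (hd_syl hA (i := i1)) //.
      exact: (subgroupV (proj1 hA i1)).
    by move/eqP; rewrite invg_eq1 => /eqP.
  have e2' : k^-1 * (b * x) = pval ((i2, s2) :: w).
    rewrite (_ : b * x = x * (x^-1 * b * x)); last by gsimp.
    by rewrite -e (pval_cons (i1, s1)) /k /=; gsimp.
  have e2 : H (k^-1 * (b * x)) = (i2 == ord0).
    by rewrite e2' /hin /hd nf_pval.
  have ne : (i1 == ord0) != (i2 == ord0).
    have : i2 != i1 by apply: contra_neq h3 => ->.
    rewrite -!val_eqE /=; move: (ltn_ord i1) (ltn_ord i2).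
    by case: (nat_of_ord i1) => [|[|?]] //; case: (nat_of_ord i2) => [|[|?]].
  have [et|nt] := eqVneq (tail ha z H k^-1) (H (k^-1 * x)).
    have hwr : wrong hA E B x (b^-1 * k).
      apply/wrongE; rewrite invgM invgK tailM // et e1.
      by rewrite -mulgA e2.
    have ek : k = b * x by rewrite -(m _ hwr); gsimp.
    move: e2'; rewrite ek mulVg => /esym e0.
    by have := nf_pval hA hw2; rewrite e0 nf1.
  have /wrongE /m /= : tail ha z H k^-1 != H (k^-1 * x) by [].
  by rewrite /k -{2}[x]mulg1 => /mulgI.
have hor b : B b -> A ord0 (x^-1 * b * x) \/ A (lift ord0 ord0) (x^-1 * b * x).
  move=> /hsize; have := nf_alt hA (x^-1 * b * x); rewrite -{3 4}(nfK hA (x^-1 * b * x)).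
  case: (nf hA _) => [|[i s] [|? ?]] // => [_ _|/alternating_cons[/= h _ _ _] _].
    by left; rewrite pval_nil; exact: (subgroup1 (proj1 hA _)).
  rewrite pval_cons pval_nil mulg1.
  have [e|ne] := eqVneq i ord0; [by left; rewrite -e|right].
  have <- // : i = lift ord0 ord0.
  by apply: val_inj; case: i ne {h} => [[|[|?]] ?].
(* If some element is outside the first factor, it is in the second; its product with a nontrivial
   element of the first would have two syllables. *)
have [h0|h0] := pselect (forall b, B b -> A ord0 (x^-1 * b * x)).
  by exists ord0.
exists (lift ord0 ord0) => b hb.
have [c hc nc] : exists2 c, B c & ~ A ord0 (x^-1 * c * x).
  by apply: contrapT => hne; apply: h0 => c hc; apply: contrapT => h; apply: hne; exists c.
have c1 : A (lift ord0 ord0) (x^-1 * c * x) by case: (hor c hc).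
case: (hor b hb) => // b0.
have [e|/eqP bne] := eqVneq (x^-1 * b * x) 1.
  by rewrite e; exact: (subgroup1 (proj1 hA _)).
have cne : x^-1 * c * x <> 1.
  by move=> e; apply: nc; rewrite e; exact: (subgroup1 (proj1 hA _)).
have := hsize (b * c) (subgroupM hB hb hc).
have -> : x^-1 * (b * c) * x = (x^-1 * b * x) * (x^-1 * c * x) by gsimp.
rewrite nfM; first by rewrite (nf_syl hA b0) // (nf_syl hA c1).
rewrite (hd_syl hA c1) // (hd_syl hA (i := ord0)) //.
  exact: (subgroupV (proj1 hA _)).
by move/eqP; rewrite invg_eq1 => /eqP.
Qed.
End Conj.

Section Axis.
Variables (I : eqType) (A : I -> set F).
Hypothesis hA : free_product A.
Local Notation hd := (hd hA).

Let hAs i : subgroup (A i) := proj1 hA i.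

Lemma strip_hd j g : exists2 u, A j u & hd (u^-1 * g) != Some j.
Proof.
have := nf_alt hA g; have := nfK hA g; case e : (nf hA g) => [|[i s] w] eg hw.
  by exists 1; [exact: subgroup1 (hAs j)|rewrite invg1 mul1g /(hd _) e].
have [ij|ne] := eqVneq i j; last first.
  exists 1; [exact: subgroup1 (hAs j)|rewrite invg1 mul1g /(hd _) e /=].
  by apply: contra_neq ne => -[].
move/alternating_cons: hw => [/= h1 _ h3 h4]; rewrite ij in h1 h3; exists s => //.
by rewrite -eg pval_cons mulKg /(hd _) nf_pval.
Qed.

Lemma hd_factor j u : A j u -> hd u = if u == 1 then None else Some j.
Proof. by move=> h; case: eqP => [->|ne]; [rewrite hd1|exact: hd_syl]. Qed.

(* If the syllable [alpha] were outside the conjugate of [B], there would be no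
   cancellation in the words over [B] and [t], none of which could then equal [alpha]. *)
Lemma elliptic_axis j x y : ~ A j y -> (forall b, B b -> A j (x^-1 * b * x)) ->
  exists g0 beta, let tau := g0^-1 * (t * beta) * g0 in
    [/\ B beta, forall b, B b -> A j (g0^-1 * b * g0), tau != 1,
        hd tau != Some j & hd tau^-1 != Some j].
Proof.
move=> hy hx; pose tau0 := x^-1 * t * x.
have tau0A : ~ A j tau0.
  move=> h; apply: hy.
  have hall g : A j (x^-1 * g * x).
    rewrite -(rwK ha g); elim: (rw ha g) => [|l w IH].
      by rewrite word_eval_nil mulg1 mulVg; exact: subgroup1 (hAs j).
    have hl : A j (x^-1 * letter a l * x).
      have [e|ne] := eqVneq l.1 z; last by apply/hx/bspan_letter.
      have -> : letter a l = tl a z l.2 by rewrite /tl -e -surjective_pairing.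
      case: l.2 => //; rewrite tV.
      by have := subgroupV (hAs j) h; rewrite /tau0; gsimp.
    by have := subgroupM (hAs j) hl IH; rewrite word_eval_cons; gsimp.
  by have := hall (x * y * x^-1); gsimp.
(* After stripping the syllables in [A j] at both ends and conjugating by [g0 = x * u], only [alpha]
   in [A j] remains to be absorbed by [beta]. *)
have [u hu hu'] := strip_hd j tau0.
have [v hv hv'] := strip_hd j (u^-1 * tau0)^-1.
pose tau := u^-1 * tau0 * v.
have hvV : hd tau^-1 != Some j by move: hv'; rewrite /tau !invgM.
have tau1 : tau != 1.
  apply/eqP => e; apply: tau0A; have -> : tau0 = u * v^-1.
    by rewrite -[u]mulg1 -e /tau; gsimp.
  by apply: (subgroupM (hAs j)) => //; exact: (subgroupV (hAs j)).
have hut : hd tau != Some j.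
  have [v1|vn] := eqVneq v 1; first by rewrite /tau v1 mulg1.
  move: hu'; have -> : u^-1 * tau0 = tau * v^-1 by rewrite /tau; gsimp.
  rewrite hdM // (hd_factor (subgroupV (hAs j) hv)) invg_eq1 (negPf vn).
  exact: hvV.
pose g0 := x * u; pose alpha := v^-1 * u.
have hg0 b : B b -> A j (g0^-1 * b * g0).
  move=> /hx h; have := subgroupM (hAs j) (subgroupM (hAs j) (subgroupV (hAs j) hu) h) hu.
  by rewrite /g0; gsimp.
have halpha : A j alpha by apply: (subgroupM (hAs j)) => //; exact: (subgroupV (hAs j)).
have et : g0^-1 * t * g0 = tau * alpha by rewrite /g0 /tau /alpha /tau0; gsimp.
have [hbeta|hbeta] := pselect (B (g0 * alpha^-1 * g0^-1)).
  exists g0, (g0 * alpha^-1 * g0^-1).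
  have e : g0^-1 * (t * (g0 * alpha^-1 * g0^-1)) * g0 = tau.
    have : g0^-1 * t * g0 * alpha^-1 = tau by rewrite et mulgK.
    by gsimp.
  by rewrite e; split.
exfalso.
pose e g := g0^-1 * g * g0.
have eM g h : e (g * h) = e g * e h by rewrite /e; gsimp.
have eA b : B b -> A j (e b) by exact: hg0.
have einj b : e b = 1 -> b = 1.
  move=> h; have : g0 * e b * g0^-1 = 1 by rewrite h; gsimp.
  by rewrite /e; gsimp.
have ealpha c : B c -> alpha * e c <> 1.
  move=> hc h; apply: hbeta; suff -> : g0 * alpha^-1 * g0^-1 = c by [].
  by rewrite (mulg1_eq h) /e; gsimp.
have ealphaV c : B c -> e c * alpha^-1 <> 1.
  by move=> hc /divg1_eq h; apply: hbeta; rewrite -h -[X in B X]invgK /e; gsimp;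
    exact: (subgroupV hB).
have etV : e t' = alpha^-1 * tau^-1 by rewrite tV -invgM -et /e; gsimp.
(* The word [w] is trivial or ends in [A j], so nothing cancels when [tau] or its inverse
   follows. *)
pose endj w := hd w^-1 \in [:: None; Some j].
have endjA w sigma gamma : endj w -> sigma \in [:: tau; tau^-1] -> A j gamma ->
    hd (w * sigma * gamma)^-1 = (if gamma == 1 then hd sigma^-1 else Some j) /\
    hd sigma^-1 \notin [:: None; Some j].
  move=> hw hs hg.
  have [s1 s2 s3] : [/\ sigma != 1, hd sigma != Some j & hd sigma^-1 != Some j].
    by move: hs; rewrite !inE => /orP[] /eqP ->; rewrite ?invgK ?invg_eq1.
  have s3' : hd sigma^-1 \notin [:: None; Some j].
    by rewrite !inE negb_or hd_None invg_eq1 s1.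
  have hws : hd (w * sigma)^-1 = hd sigma^-1.
    rewrite invgM hdM ?invg_eq1 // invgK; apply/eqP => es.
    by move: hw; rewrite /endj -es !inE hd_None (negPf s1) (negPf s2).
  split=> //; rewrite invgM; have [->|gn] := eqVneq gamma 1; first by rewrite invg1 mul1g.
  have hgV := subgroupV (hAs j) hg.
  rewrite hdM ?invg_eq1 // ?(hd_factor hgV) ?invg_eq1 ?(negPf gn) //.
  rewrite invgK (hd_factor hg) (negPf gn) hws.
  by move: s3'; rewrite !inE negb_or eq_sym => /andP[_]; rewrite eq_sym.
(* By induction on the length of [k]. The elements of [A j] between consecutive occurrences of [tau]
   or its inverse are [alpha * e c], [e c * alpha^-1], [e c] and [alpha * e c * alpha^-1]. The first
   two are nontrivial because [alpha] is not in the conjugate of [B], the last two because the word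
   is reduced. *)
have NC m k s : size (rw ha k) <= m -> red (rcons (rw ha k) (z, s)) ->
    exists2 w, endj w & e (k * tl a z s) = w * (if s then tau * alpha else tau^-1).
  elim: m k s => [|m IH] k s hm hr.
    have k1 : k = 1.
      by apply: (rw_inj (ha := ha)); rewrite rw1; move: hm; case: (rw ha k).
    rewrite k1 mul1g; case: s {hr}; first by exists 1; rewrite /endj ?invg1 ?hd1 ?mul1g ?et.
    exists alpha^-1; last by rewrite etV.
    by rewrite /endj invgK (hd_factor halpha); case: ifP; rewrite !inE eqxx ?orbT.
  have endjF u0 : A j u0 -> endj u0.
    by move=> h0; rewrite /endj (hd_factor (subgroupV (hAs j) h0)); case: ifP; rewrite !inE eqxx ?orbT.
  have [kB|[k' [s' [c [hc ek hr']]]]] := zsplit ha z k.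
    case: s hr => hr; [exists (e k)|exists (e k * alpha^-1)].
    - exact/endjF/eA.
    - by rewrite eM {2}/e et.
    - apply: endjF; apply: (subgroupM (hAs j)); [exact: eA|exact: (subgroupV (hAs j))].
    - by rewrite eM etV mulgA.
  have er := rw_tlM hr' hc; rewrite -ek in er.
  have [w hw ew] : exists2 w, endj w &
      e (k' * tl a z s') = w * (if s' then tau * alpha else tau^-1).
    by apply: IH => //; move: hm; rewrite er size_cat /= addnS ltnS; exact/leq_trans/leq_addr.
  have c1 : s' != s -> e c <> 1.
    move=> hne /einj hc1; move: hr; rewrite er hc1 rw1 -cats1 -catA => /red_catr.
    rewrite red_cons /= => /andP[/eqP[]]; rewrite /linv /=; congr (Some (_, _)).
    by move: (s) (s') hne => [] [].
  have fin sigma gamma : sigma \in [:: tau; tau^-1] -> A j gamma -> gamma <> 1 ->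
      endj (w * sigma * gamma).
    move=> h1 h2 /eqP h3; rewrite /endj; have [-> _] := endjA w sigma gamma hw h1 h2.
    by rewrite (negPf h3) !inE eqxx orbT.
  have -> : e (k * tl a z s) = e (k' * tl a z s') * e c * e (tl a z s).
    by rewrite -!eM ek.
  have eAc := eA c hc.
  have aV := subgroupV (hAs j) halpha.
  have SM := subgroupM (hAs j).
  rewrite ew; clear ek er hr' ew hr; case: s s' c1 => [] [] c1.
  - exists (w * tau * (alpha * e c)); last by rewrite {2}/e et; gsimp.
    by apply: fin; [rewrite mem_head|exact: SM|exact: ealpha].
  - exists (w * tau^-1 * e c); last by rewrite {2}/e et; gsimp.
    by apply: fin => //; [rewrite !inE eqxx orbT|exact: c1].
  - exists (w * tau * (alpha * e c * alpha^-1)); last by rewrite etV; gsimp.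
    apply: fin; [by rewrite mem_head|by apply: (SM) => //; exact: SM|].
    move=> /divg1_eq h; apply: c1 => //; apply: (mulgI alpha).
    by rewrite mulg1.
  - exists (w * tau^-1 * (e c * alpha^-1)); last by rewrite etV; gsimp.
    by apply: fin; [rewrite !inE eqxx orbT|exact: SM|exact: ealphaV].
have [hal|[k [s [c [hc ek hr]]]]] := zsplit ha z (g0 * alpha * g0^-1).
  by apply: hbeta; have := subgroupV hB hal; gsimp.
have [w hw ew] := NC _ k s (leqnn _) hr.
have : A j (e (k * tl a z s)).
  have -> : e (k * tl a z s) = alpha * (e c)^-1.
    apply: (mulIg (e c)); rewrite -eM -ek /e; gsimp.
    by [].
  by apply: (subgroupM (hAs j)) => //; apply: (subgroupV (hAs j)); exact: eA.
rewrite ew => hAw.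
have [sigma hs hAs'] : exists2 sigma, sigma \in [:: tau; tau^-1] & A j (w * sigma).
  case: s {hr ek ew} hAw => hAw; last by exists tau^-1; rewrite // !inE eqxx orbT.
  exists tau; first exact: mem_head.
  by have := subgroupM (hAs j) hAw (subgroupV (hAs j) halpha); gsimp.
have [] := endjA w sigma 1 hw hs (subgroup1 (hAs j)).
rewrite mulg1 eqxx (hd_factor (subgroupV (hAs j) hAs')) => <-.
by case: ifP; rewrite !inE eqxx ?orbT.
Qed.
End Axis.

Section EllipticCompat.
Variables (I : eqType) (X : I -> set F).
Hypothesis hX : free_product X.
Local Notation hin := (hin hX).

(** Here [g0] is the point [x] of [compatI]. If [v^-1 * g0^-1 * B] is crossed, then [v] is a cut
    point between two elements of the conjugate of [B] by [g0], hence in [fspan hX J]. As [tau]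
    starts and ends outside [J], nothing cancels around it, and the neighbouring coset, translated
    by [g0], lies entirely on one side. For the same reason [beta * g0] is the point of the orbit of
    [g0] under [B] nearest to [t^-1 * g0]. *)
Lemma elliptic_compat (J J' : pred I) k g0 beta :
  let tau := g0^-1 * (t * beta) * g0 in
  B beta -> (forall b, B b -> fspan hX J (g0^-1 * b * g0)) -> tau != 1 ->
  ~~ hin J tau -> ~~ hin J tau^-1 ->
  good ha z (hin J') k -> compat ha z (hin J') k beta.
Proof.
move=> tau hbeta hg0 tau1 htau htauV hg.
have hH := hin_almost_invariant hX J'.
have Fs := fspan_subgroup hX J.
have noJ g u : ~~ hin J g^-1 -> fspan hX J u -> u != 1 -> hd hX g^-1 != hd hX u.
  move=> h1 h2 h3; have [i hi ->] := fspan_hd h2 h3.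
  by apply: contraNneq h1; rewrite !/(hin _ _) => ->.
have noJ' g u : ~~ hin J g -> g != 1 -> fspan hX J u -> hd hX u^-1 != hd hX g.
  move=> h1 h2 h3; have [->|u1] := eqVneq u 1.
    by rewrite invg1 hd1 eq_sym hd_None.
  have nu : u^-1 != 1 by rewrite invg_eq1.
  have [i hi ->] := fspan_hd (subgroupV Fs h3) nu.
  by apply: contraNneq h1; rewrite !/(hin _ _) => <-.
have tauM u : fspan hX J u -> hd hX (tau * u) = hd hX tau.
  move=> hu; have [->|u1] := eqVneq u 1; first by rewrite mulg1.
  by rewrite hdM //; exact: noJ.
have tauVM u : fspan hX J u -> hd hX (tau^-1 * u) = hd hX tau^-1.
  move=> hu; have [->|u1] := eqVneq u 1; first by rewrite mulg1.
  by rewrite hdM ?invg_eq1 //; apply: noJ => //; rewrite invgK.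
have base v : crosses ha z (hin J') (v^-1 * g0^-1) -> fspan hX J v.
  move=> hc.
  have hall : almost_all B xpredT by apply: (@sub_finite_set _ _ set0) => // b [].
  have [b1 [hb1 /eqP e1 _]] := infinite_almost_all (crosses_val hH (g := g0) (v := true) hc) hall.
  have [b2 [hb2 /eqP e2 _]] := infinite_almost_all (crosses_val hH (g := g0) (v := false) hc) hall.
  have hne : hin J' (v^-1 * (g0^-1 * b1 * g0)) != hin J' (v^-1 * (g0^-1 * b2 * g0)).
    by rewrite !mulgA e1 e2.
  have := sep_nf hne.
  have := hg0 b1 hb1; have := hg0 b2 hb2.
  set u1 := g0^-1 * b1 * g0; set u2 := g0^-1 * b2 * g0 => h2 h1 enf.
  have : fspan hX J (u1^-1 * u2) by apply: (subgroupM Fs) => //; exact: (subgroupV Fs).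
  rewrite /fspan /= enf all_cat => /andP[h3 _].
  by have := subgroupM Fs h1 (h3 : fspan hX J (u1^-1 * v)); gsimp.
have tailE k' v : (forall b, B b -> hin J' (k' * (beta * b) * g0) = v) ->
    almost_all B (fun b => hin J' (k' * b) == v).
  move=> h; apply: (almost_B_mulr hH (g := g0)).
  apply: (@sub_finite_set _ _ set0) => // b [hb] /negP[]; apply/eqP.
  rewrite -(h (beta^-1 * b)); first by rewrite mulVKg.
  by apply: (subgroupM hB) => //; exact: (subgroupV hB).
have kP b : B b -> crosses ha z (hin J') (k * b) by move=> hb; apply: crosses_mull => //; case: hg.
have tauE : t * beta = g0 * tau * g0^-1 by rewrite /tau; gsimp.
apply: (compatI (x := g0)) => //.
(* The exception is [v = 1], when the first syllable comes from [tau] and not from [v^-1]. *)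
- have [l hl hs] : atmost 1 [set b | B b /\ (k * b)^-1 = g0].
    by apply: atmost1 => b b' [_ e] [_ e']; move: e; rewrite -e' => /invg_inj /mulgI.
  exists l; [exact: leq_trans hl _|apply: subset_trans hs].
  move=> b [hb hc hne]; split => //; apply: contrapT => hk.
  pose v := g0^-1 * (k * b)^-1.
  have ev : v^-1 = k * b * g0 by rewrite /v; gsimp.
  have v1 : v != 1 by apply/eqP => h; apply: hk; rewrite -[RHS]mulg1 -h /v; gsimp.
  have hv : fspan hX J v by apply: base; rewrite ev mulgK; exact: kP.
  move/negP: hne; apply; apply/eqP; apply: (tail_eq hn); apply: tailE => b' hb'.
  have -> : k * b * t * (beta * b') * g0 = v^-1 * (tau * (g0^-1 * b' * g0)).
    rewrite ev (mulgA _ beta) -(mulgA _ t) tauE; gsimp; by [].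
  rewrite -ev !/(hin _ _) hdM ?invg_eq1 // invgK (tauM _ (hg0 b' hb')).
  by rewrite -[v]invgK; apply: noJ' => //; exact: (subgroupV Fs).
- exists [::] => // b [hb hc /negP]; case; apply/eqP; apply: (tail_eq hn).
  pose v := tau^-1 * g0^-1 * (k * b * t')^-1.
  have ev : v^-1 * tau^-1 = k * b * t' * g0 by rewrite /v; gsimp.
  have hv : fspan hX J v.
    apply: base; have -> : v^-1 * g0^-1 = k * b * beta; last first.
      by rewrite -mulgA; apply: kP; exact: (subgroupM hB).
    have -> : v^-1 * g0^-1 = k * b * t' * (g0 * tau * g0^-1) by rewrite /v; gsimp.
    by rewrite -tauE tV; gsimp.
  have key u : fspan hX J u -> hin J' (v^-1 * tau^-1 * u) = hin J' (v^-1 * tau^-1).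
    move=> hu; rewrite -mulgA !/(hin _ _).
    have nv : hd hX v^-1^-1 != hd hX tau^-1.
      apply: noJ' => //; first by rewrite invg_eq1.
      exact: (subgroupV Fs).
    have [v1|v1] := eqVneq v 1; first by rewrite v1 invg1 !mul1g tauVM.
    rewrite [in LHS]hdM ?tauVM ?invg_eq1 //; by rewrite [in RHS]hdM ?invg_eq1.
  rewrite -ev; apply: (almost_B_mulr hH (g := g0)).
  apply: (@sub_finite_set _ _ set0) => // b' [hb'] /negP[]; apply/eqP.
  rewrite -(key _ (hg0 b' hb')) ev; gsimp; by [].
apply: atmost1 => b b' [hb h] [hb' h']; apply: invg_inj.
apply: (@orbit_sep_once _ _ _ hX B g0 (t' * g0) beta k^-1 J') => //.
- move=> b2 hb2.
  have -> : dist hX (beta * g0) (t' * g0) = len hX tau^-1.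
    by rewrite /dist /tau tV; gsimp.
  have -> : dist hX (b2 * g0) (t' * g0) = len hX ((g0^-1 * (b2^-1 * beta) * g0) * tau^-1).
    by rewrite /dist /tau tV; gsimp.
  rewrite lenM ?leq_addl //; apply: noJ' => //; first by rewrite invg_eq1.
  by apply: hg0; apply: (subgroupM hB) => //; exact: (subgroupV hB).
- exact: (subgroupV hB).
- exact: (subgroupV hB).
- by move: h; gsimp.
by move: h'; gsimp.
Qed.
End EllipticCompat.
End Elliptic.

(** * Conjugation of factorizations *)

Section ConjFactors.
Variable F : groupType.
Implicit Types (P : set (set F)) (g h : F).

Definition cj I (X : I -> set F) g i : set F := [set x ^ g | x in X i].

Lemma subgroup_cj (A : set F) g : subgroup A -> subgroup [set x ^ g | x in A].
Proof.
move=> hA; split; first by exists 1; [exact: subgroup1 hA|rewrite conj1g].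
move=> _ _ [x hx <-] [y hy <-]; exists (x * y^-1); last by rewrite conjMg conjVg.
exact: (proj2 hA).
Qed.

Lemma generated_cj (S : set F) g :
  generated [set x ^ g | x in S] = [set x ^ g | x in generated S].
Proof.
apply/seteqP; split.
  apply: generated_min; first exact/subgroup_cj/generated_subgroup.
  by move=> _ [x hx <-]; exists x => //; exact: sub_generated.
move=> _ [x hx <-].
have : generated S `<=` [set y | generated [set x ^ g | x in S] (y ^ g)].
  have hs := generated_subgroup [set x ^ g | x in S].
  apply: generated_min.
    split=> /= [|u v hu hv]; first by rewrite conj1g; exact: subgroup1 hs.
    by rewrite conjMg conjVg; exact: (proj2 hs).
  by move=> u hu; apply: sub_generated; exists u.
exact.
Qed.

Lemma free_product_cj (I : eqType) (X : I -> set F) g :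
  free_product X -> free_product (cj X g).
Proof.
move=> hX; split=> [i|h]; first exact/subgroup_cj/(proj1 hX).
have alt (Y : I -> set F) h0 w : alternating Y w -> alternating (cj Y h0) [seq (l.1, l.2 ^ h0) | l <- w].
  move=> [h1 h2]; split=> [_ /mapP[l hl ->]|]; last by rewrite sorted_map.
  have [h3 h4] := h1 l hl; split=> /=; first by exists l.2.
  by move/eqP; rewrite conjg_eq1 => /eqP.
have pv h0 (w : seq (I * F)) : pval [seq (l.1, l.2 ^ h0) | l <- w] = pval w ^ h0.
  by rewrite /pval big_map conjg_prod.
exists [seq (l.1, l.2 ^ g) | l <- nf hX (h ^ g^-1)]; split.
  have [h1 h2] := alt X g _ (nf_alt hX (h ^ g^-1)); split => //.
  by have := pv g (nf hX (h ^ g^-1)); rewrite nfK conjgKV.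
move=> w [h1 h2 h3].
have hw : alternating X [seq (l.1, l.2 ^ g^-1) | l <- w].
  have [h4 h5] := alt (cj X g) g^-1 w (conj h1 h2); split => // l hl.
  have [[y [x hx e1] e2] h6] := h4 l hl; split => //.
  by rewrite -e2 -e1 conjgK.
have <- : pval [seq (l.1, l.2 ^ g^-1) | l <- w] = h ^ g^-1 by rewrite pv -h3.
rewrite nf_pval // -map_comp -[RHS]map_id; apply: eq_map => -[i s] /=.
by rewrite conjgKV.
Qed.

Lemma free_factorization_cj k (X : 'I_k -> set F) g :
  free_factorization X -> free_factorization (cj X g).
Proof.
move=> [hX hne]; split; first exact: free_product_cj.
move=> i e; apply: (hne i); apply/seteqP; split=> x /=.
  move=> hx; have : cj X g i (x ^ g) by exists x.
  by rewrite e /= => /eqP; rewrite conjg_eq1 => /eqP.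
by move=> ->; exact: subgroup1 (proj1 hX i).
Qed.

Lemma conj_factorsM P g h : conj_factors P (g * h) = conj_factors (conj_factors P g) h.
Proof.
have e (A : set F) : [set x ^ (g * h) | x in A] = [set x ^ h | x in [set x ^ g | x in A]].
  apply/seteqP; split=> _ [x hx <-]; first by exists (x ^ g); [exists x|rewrite conjgM].
  by case: hx => y hy <-; exists y => //; rewrite conjgM.
apply/seteqP; split=> _ [A hA <-].
  by exists [set x ^ g | x in A]; [exists A|rewrite e].
by case: hA => A' hA' <-; exists A' => //; rewrite e.
Qed.

Lemma conj_factors1 P : conj_factors P 1 = P.
Proof.
have e (A : set F) : [set x ^ 1 | x in A] = A.
  apply/seteqP; split=> [_ [x hx <-]|x hx]; first by rewrite conjg1.
  by exists x => //; rewrite conjg1.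
by apply/seteqP; split=> [_ [A hA <-]|A hA]; [rewrite e|exists A].
Qed.

Lemma conj_classM P g : conj_class (conj_factors P g) = conj_class P.
Proof.
apply/seteqP; split=> _ [h _ <-]; first by exists (g * h) => //; rewrite conj_factorsM.
by exists (g^-1 * h) => //; rewrite -conj_factorsM mulVKg.
Qed.

Lemma conj_class_refl P : conj_class P P.
Proof. by exists 1 => //; rewrite conj_factors1. Qed.

Lemma range_cj k (A : 'I_k -> set F) g : conj_factors (range A) g = range (cj A g).
Proof.
apply/seteqP; split=> [_ [_ [i _ <-] <-]|_ [i _ <-]]; first by exists i.
by exists (A i) => //; exists i.
Qed.

Lemma splitting_cj P g : splitting P -> splitting (conj_factors P g).
Proof.
move=> [A hA ->]; exists (cj A g); first exact: free_factorization_cj.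
exact: range_cj.
Qed.

Lemma refines_cj k (X : 'I_k -> set F) P g :
  refines X P -> refines (cj X g) (conj_factors P g).
Proof.
move=> [T ->]; exists T.
have e (S : set 'I_k) : generated (\bigcup_(i in S) cj X g i) =
    [set x ^ g | x in generated (\bigcup_(i in S) X i)].
  by rewrite -generated_cj image_bigcup.
rewrite !e; apply/seteqP; split=> [_ [A [->|->] <-]|A [->|->]]; [by left|by right| |].
  by exists (generated (\bigcup_(i in [set i | i \in T]) X i)) => //; left.
by exists (generated (\bigcup_(i in [set i | i \notin T]) X i)) => //; right.
Qed.

Lemma vertex_class (u : ES_vertex F) P : val u P -> val u = conj_class P.
Proof.
have [P0 _ e] := set_valP u; rewrite e => -[g _ <-].
by rewrite conj_classM.
Qed.

Lemma vertex_splitting (u : ES_vertex F) P : val u P -> splitting P.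
Proof.
have [P0 hP0 e] := set_valP u; rewrite e => -[g _ <-].
exact: splitting_cj.
Qed.

(** Conjugating the refinement makes it refine a prescribed representative of [u], so that a path of
    vertices can be followed by actual factorizations. *)
Lemma ES_adj_step (u v : ES_vertex F) P : val u P -> ES_adj u v ->
  exists Q (X : 'I_3 -> set F),
    [/\ val v Q, free_factorization X, refines X P & refines X Q].
Proof.
move=> hP [_ [P' [Q [hP' hQ [X [hX h1 h2]]]]]].
move: hP; rewrite (vertex_class hP') => -[g _ <-].
exists (conj_factors Q g), (cj X g); split.
- by rewrite (vertex_class hQ); exists g.
- exact: free_factorization_cj.
- exact: refines_cj.
exact: refines_cj.
Qed.

Lemma ES_adj_sym (u v : ES_vertex F) : ES_adj u v -> ES_adj v u.
Proof.
move=> [h [P [Q [hP hQ [X [hX h1 h2]]]]]]; split; first by move/esym.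
by exists Q, P; split => //; exists X.
Qed.

Lemma factor_neq k (A : 'I_k -> set F) i j :
  free_factorization A -> A i = A j -> i = j.
Proof.
move=> [hA hne] e.
have [s hs ns] : exists2 s, A i s & s <> 1.
  apply: contrapT => hno; apply: (hne i); apply/seteqP; split=> x /= hx.
    by apply: contrapT => nx; apply: hno; exists x.
  by rewrite hx; exact: subgroup1 (proj1 hA i).
have := hd_syl hA hs ns; rewrite e in hs.
by rewrite (hd_syl hA hs ns) => -[].
Qed.

Lemma ord2_cases (i : 'I_2) : i = ord0 \/ i = lift ord0 ord0.
Proof. by case: i => [[|[|?]] hi] //; [left|right]; exact: val_inj. Qed.

Lemma fspan_pred0 (I : eqType) (X : I -> set F) (hX : free_product X) (J : pred I) :
  (forall l, ~~ J l) -> fspan hX J = [set 1].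
Proof.
move=> hJ; apply/seteqP; split=> g /=.
  rewrite /fspan /=; have := nfK hX g; case: (nf hX g) => [|l w] /=.
    by rewrite pval_nil.
  by rewrite (negPf (hJ _)).
by move=> ->; exact: subgroup1 (fspan_subgroup hX J).
Qed.

(** The set [range A] does not tell which factor is which, hence two symmetric cases. The last
    clause holds for each [i], so that either factor may serve as reference. *)
Lemma refines_fspan (X : 'I_3 -> set F) (hX : free_product X) (A : 'I_2 -> set F) :
  free_factorization A -> refines X (range A) ->
  exists J : 'I_2 -> pred 'I_3,
    [/\ forall i, A i = fspan hX (J i), forall i i' l, J i l -> J i' l -> i = i',
        forall i, exists l, ~~ J i l
      & forall i, range A = [set fspan hX (J i); fspan hX (fun l => ~~ J i l)]].
Proof.
move=> hA [T eT].
pose G0 := generated (\bigcup_(i in [set i | i \in T]) X i).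
pose G1 := generated (\bigcup_(i in [set i | i \notin T]) X i).
have e0 : G0 = fspan hX (mem T) by rewrite -generated_fspan.
have e1 : G1 = fspan hX (fun l => l \notin T) by rewrite -generated_fspan.
have hr i : A i = G0 \/ A i = G1.
  by have : range A (A i) by [exists i]; rewrite eT.
have ne i : A i <> [set 1] by case: hA => _; exact.
have hneq : A ord0 <> A (lift ord0 ord0) by move/(factor_neq hA)/(congr1 val).
have pCK (p : pred 'I_3) : (fun l => ~~ ~~ p l) = p by apply: funext => l /=; rewrite negbK.
have key (J : pred 'I_3) : A ord0 = fspan hX J -> A (lift ord0 ord0) = fspan hX (fun l => ~~ J l) ->
    exists J : 'I_2 -> pred 'I_3,
    [/\ forall i, A i = fspan hX (J i), forall i i' l, J i l -> J i' l -> i = i',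
        forall i, exists l, ~~ J i l
      & forall i, range A = [set fspan hX (J i); fspan hX (fun l => ~~ J i l)]].
  move=> h0 h1; exists (fun i => if i == ord0 then J else fun l => ~~ J l); split.
  - by move=> i; case: (ord2_cases i) => ->.
  - move=> i i' l; case: (ord2_cases i) (ord2_cases i') => -> [] -> //=.
      by move=> ->.
    by move=> /negPf ->.
  - move=> i; apply: contrapT => hno.
    case: (ord2_cases i) hno => -> /= hno.
      apply: (ne (lift ord0 ord0)); rewrite h1 fspan_pred0 // => l /=.
      by rewrite negbK; apply: contrapT => /negP hl; apply: hno; exists l.
    apply: (ne ord0); rewrite h0 fspan_pred0 // => l; apply/negP => hl; apply: hno.
    by exists l; rewrite negbK.
  have -> : range A = [set fspan hX J; fspan hX (fun l => ~~ J l)].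
    rewrite -h0 -h1; apply/seteqP; split=> [_ [i _ <-]|_ [->|->]].
    - by case: (ord2_cases i) => ->; [left|right].
    - by exists ord0.
    - by exists (lift ord0 ord0).
  by move=> i; case: (ord2_cases i) => -> //=; rewrite pCK setUC.
case: (hr ord0) (hr (lift ord0 ord0)) => a0 [] a1; try by case: hneq; rewrite a0 a1.
  by apply: (key (mem T)); rewrite ?a0 ?a1.
by apply: (key (fun l => l \notin T)); rewrite ?a0 ?a1 ?pCK.
Qed.

Lemma adjacent_distinct (u v : ES_vertex F) (X : 'I_3 -> set F) (hX : free_product X)
    (A A' : 'I_2 -> set F) (J J' : pred 'I_3) :
  range A = [set fspan hX J; fspan hX (fun l => ~~ J l)] ->
  range A' = [set fspan hX J'; fspan hX (fun l => ~~ J' l)] ->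
  val u (range A) -> val v (range A') -> u <> v -> exists l, J l != J' l.
Proof.
move=> hA hA' hu hv hne; apply: contrapT => hno; apply: hne; apply: val_inj.
have e : J = J'.
  by apply: funext => l; apply/eqP; apply: contrapT => /negP h; apply: hno; exists l.
by rewrite (vertex_class hu) (vertex_class hv) hA hA' e.
Qed.

End ConjFactors.

(** * Retractions that kill some of the factors *)

Section Kill.
Variables (F : groupType) (I : eqType) (X : I -> set F).
Hypothesis hX : free_product X.
Implicit Types (E J : pred I).

Definition kill E : F -> F := phom hX (fun i s => if E i then 1 else s).

Let fM E i (s t : F) : X i s -> X i t ->
  (if E i then 1 else s * t) = (if E i then 1 else s) * (if E i then 1 else t).
Proof. by case: (E i); rewrite ?mulg1. Qed.

Lemma killM E : {morph kill E : g h / g * h}.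
Proof. exact: (phomM hX (@fM E)). Qed.

Lemma kill1 E : kill E 1 = 1. Proof. exact: phom1. Qed.

Lemma killV E g : kill E g^-1 = (kill E g)^-1.
Proof. exact: (phomV hX (@fM E)). Qed.

Lemma kill_syl E i s : X i s -> kill E s = if E i then 1 else s.
Proof. by move=> hs; rewrite /kill (phom_syl hX (@fM E) hs). Qed.

Lemma kill_span E J g : fspan hX J g -> fspan hX (predD J E) (kill E g).
Proof.
rewrite /kill /phom {1}/fspan /=; move: (nf_alt hX g).
elim: (nf hX g) => [|l w IH].
  by move=> _ _; rewrite big_nil; exact: subgroup1 (fspan_subgroup hX _).
move=> /alternating_cons[h1 h2 _ /IH h4] /= /andP[h5 /h4 h6].
rewrite big_cons; apply: (subgroupM (fspan_subgroup hX _)) => //.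
case: ifP => [_|h7]; first exact: subgroup1 (fspan_subgroup hX _).
by rewrite /fspan /= (nf_syl hX h1 h2) /= h7 h5.
Qed.

Lemma kill_id E g : fspan hX (fun l => ~~ E l) g -> kill E g = g.
Proof.
rewrite /kill /phom /fspan /= -{3}(nfK hX g) /pval.
elim: (nf hX g) => [|l w IH] /=; first by rewrite !big_nil.
by move=> /andP[/negPf h /IH e]; rewrite !big_cons h e.
Qed.

Lemma kill_all E g : fspan hX E g -> kill E g = 1.
Proof.
rewrite /kill /phom /fspan /=.
elim: (nf hX g) => [|l w IH] /=; first by rewrite big_nil.
by move=> /andP[h /IH e]; rewrite big_cons h e mulg1.
Qed.

End Kill.

Section TwoElliptic.
Variables (F : groupType) (n : nat) (a : n.-tuple F).
Hypothesis ha : free_basis a.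
Variable z : 'I_n.
Local Notation B := (bfac ha z).

(* Modulo the normal closure of [B] the group is cyclic. *)
Lemma two_elliptic_false (X : 'I_3 -> set F) (J J' : pred 'I_3) x x' :
  free_factorization X -> (exists l, ~~ J l) -> (exists l, ~~ J' l) ->
  (exists l, J l != J' l) ->
  forall hX : free_product X,
  (forall b, B b -> fspan hX J (x^-1 * b * x)) ->
  (forall b, B b -> fspan hX J' (x'^-1 * b * x')) -> False.
Proof.
move=> [_ hne] [l0 hl0] [l1 hl1] [l2 hl2] hX hx hx'.
pose D := predI J J'.
(* Since [J] and [J'] are proper and distinct, at least two factors survive when those in [D] are
   killed. *)
have [i [i' [hi hi' ii]]] : exists i i', [/\ ~~ D i, ~~ D i' & i != i'].
  have [e|ne] := eqVneq l0 l1; last first.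
    by exists l0, l1; rewrite /D /= !negb_and hl0 hl1 orbT.
  exists l0, l2; rewrite /D /= !negb_and hl0; split => //.
    by move: hl2; case: (J l2); case: (J' l2).
  by apply: contraNneq hl2 => <-; rewrite (negPf hl0) e (negPf hl1).
pose rho := kill hX D.
have rhoM g h : rho (g * h) = rho g * rho h by exact: killM.
have rhoV g : rho g^-1 = (rho g)^-1 by exact: killV.
(* [rho b] is conjugate to [rho u] in the span of [J] minus [D], hence dies when [J] is killed. So
   does its conjugate [rho u'], which lies in the span of [J'] minus [D] and is fixed by killing
   [J]. *)
have rhoB b : B b -> rho b = 1.
  move=> hb; pose u := x^-1 * b * x; pose u' := x'^-1 * b * x'.
  have e1 : rho b = rho x * rho u * (rho x)^-1.
    by rewrite -rhoV -!rhoM; congr rho; rewrite /u; gsimp.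
  have e2 : rho u' = (rho x')^-1 * rho b * rho x' by rewrite -rhoV -!rhoM.
  have h1 : kill hX J (rho b) = 1.
    rewrite e1 !killM killV (@kill_all _ _ _ hX J (rho u)) ?mulg1 ?mulgV //.
    have := kill_span D (hx b hb); apply: sub_all => l /=.
    by move=> /andP[].
  have h2 : kill hX J (rho u') = 1.
    by rewrite e2 !killM killV h1 mulg1 mulVg.
  have h3 : rho u' = 1.
    rewrite -(@kill_id _ _ _ hX J (rho u')) //.
    have := kill_span D (hx' b hb); apply: sub_all => l /=.
    by rewrite /D /=; case: (J l.1); case: (J' l.1).
  have : rho x' * rho u' * (rho x')^-1 = rho b by rewrite e2; gsimp.
  by rewrite h3 mulg1 mulgV.
have comm_ind h : (commute (rho (tl a z true)) h) -> forall g, commute (rho g) h.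
  move=> hc g; rewrite -(rwK ha g); elim: (rw ha g) => [|l w IH].
    rewrite word_eval_nil /rho kill1; apply: commute_sym; exact: commute1.
  rewrite word_eval_cons rhoM; apply: commute_sym.
  apply: commuteM; last exact: commute_sym.
  have [e|ne] := eqVneq l.1 z; last first.
    rewrite rhoB; first exact: commute1.
    by apply/bspan_letter.
  have -> : letter a l = tl a z l.2 by rewrite /tl -e -surjective_pairing.
  case: l.2; first exact: commute_sym.
  rewrite (tlV a z true) rhoV; apply: commuteV; exact: commute_sym.
have hcomm g h : commute (rho g) (rho h).
  by apply: (comm_ind _ _); apply: commute_sym; apply: (comm_ind _ _); exact: commute_refl.
have ex j : exists2 s, X j s & s <> 1.
  apply: contrapT => hno; apply: (hne j); apply/seteqP; split=> y /= hy.
    by apply: contrapT => nx; apply: hno; exists y.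
  by rewrite hy; exact: subgroup1 (proj1 hX j).
have [s hs ns] := ex i; have [s' hs' ns'] := ex i'.
have := hcomm s s'; rewrite /rho !(kill_syl hX D hs) !(kill_syl hX D hs') (negPf hi) (negPf hi').
have hd1' j y : X j y -> y <> 1 -> hd hX y^-1 = Some j.
  move=> h1 h2; apply: hd_syl; first exact: (subgroupV (proj1 hX j)).
  by move/eqP; rewrite invg_eq1 => /eqP.
move/(congr1 (nf hX)); rewrite !nfM.
- by rewrite (nf_syl hX hs ns) (nf_syl hX hs' ns') => -[e _]; rewrite e eqxx in ii.
- by rewrite (hd1' i') // (hd_syl hX hs ns); apply: contraNneq ii => -[->].
by rewrite (hd1' i) // (hd_syl hX hs' ns'); apply: contraNneq ii => -[->].
Qed.

End TwoElliptic.

(** * Paths of splittings *)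

Section PathBound.
Variables (F : groupType) (n : nat) (a : n.-tuple F).
Hypothesis ha : free_basis a.
Hypothesis hn : (1 < n)%N.
Variable z : 'I_n.
Local Notation B := (bfac ha z).
Local Notation t := (tl a z true).

Definition elliptic_data (A : 'I_2 -> set F) (hA : free_product A) j g0 beta : Prop :=
  let tau := g0^-1 * (t * beta) * g0 in
  [/\ B beta, forall b, B b -> A j (g0^-1 * b * g0), tau != 1,
      hd hA tau != Some j & hd hA tau^-1 != Some j].

(* The twisting elements attached to a splitting: a single one when [B] is
   elliptic, those of bounded discrepancy otherwise. *)
Definition twisting (A : 'I_2 -> set F) (hA : free_product A) (R : set F) : Prop :=
  (exists j g0 beta, elliptic_data hA j g0 beta /\ R = [set beta]) \/
  (exists k, good ha z (hin hA (pred1 ord0)) k /\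
             R = [set beta | compat ha z (hin hA (pred1 ord0)) k beta]).

Lemma twisting_exists (A : 'I_2 -> set F) (hA : free_factorization A) :
  exists R, twisting (proj1 hA) R.
Proof.
have hH := hin_almost_invariant (proj1 hA) (pred1 ord0).
have [[k hk]|hno] := pselect (exists k, crosses ha z (hin (proj1 hA) (pred1 ord0)) k).
  have [k' hk'] := good_exists hH hk.
  by eexists; right; exists k'; split; [exact: hk'|reflexivity].
have [x [j hx]] := elliptic_conj hn (hA := proj1 hA) (fun k hk => hno (ex_intro _ k hk)).
have [y hy] : exists y, ~ A j y.
  pose j' := if j == ord0 then lift ord0 ord0 else ord0 : 'I_2.
  have jj : j' != j by rewrite /j'; case: (ord2_cases j) => ->.
  apply: contrapT => hno'; apply: (proj2 hA j'); apply/seteqP; split=> y /= hy.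
    apply: contrapT => ny; have hyj : A j y.
      by apply: contrapT => h; apply: hno'; exists y.
    have := hd_syl (proj1 hA) hy ny; rewrite (hd_syl (proj1 hA) hyj ny) => -[e].
    by rewrite e eqxx in jj.
  by rewrite hy; exact: subgroup1 (proj1 (proj1 hA) j').
have [g0 [beta h]] := elliptic_axis (proj1 hA) hy hx.
by exists [set beta]; left; exists j, g0, beta.
Qed.

(** In the tree of [X]: [B] is not elliptic in both splittings, as they are distinct. If it is
    elliptic in one, the [beta] of that one is compatible with the other; if in none, a common
    [beta] exists. *)
Lemma twisting_edge (A A' : 'I_2 -> set F) (hA : free_factorization A)
    (hA' : free_factorization A') (X : 'I_3 -> set F) (u v : ES_vertex F) R R' :
  free_factorization X -> refines X (range A) -> refines X (range A') ->
  val u (range A) -> val v (range A') -> u <> v ->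
  twisting (proj1 hA) R -> twisting (proj1 hA') R' ->
  exists2 beta, B beta & R beta /\ R' beta.
Proof.
move=> hX rA rA' hu hv huv hR hR'.
have hXp := proj1 hX.
have [J [eA dA pA sA]] := refines_fspan hXp hA rA.
have [J' [eA' dA' pA' sA']] := refines_fspan hXp hA' rA'.
have cA := coarsen_hd (proj1 hA) eA dA.
have cA' := coarsen_hd (proj1 hA') eA' dA'.
have HA : hin (proj1 hA) (pred1 ord0) = hin hXp (J ord0).
  by apply: funext => g; rewrite cA /hin; case: (hd _ g).
have HA' : hin (proj1 hA') (pred1 ord0) = hin hXp (J' ord0).
  by apply: funext => g; rewrite cA' /hin; case: (hd _ g).
case: hR => [[j [g0 [beta [[h1 h2 h3 h4 h5] ->]]]]|[k [hk ->]]];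
  case: hR' => [[j' [g0' [beta' [[h1' h2' h3' h4' h5'] ->]]]]|[k' [hk' ->]]].
- exfalso; have [l hl] := adjacent_distinct (sA j) (sA' j') hu hv huv.
  apply: (@two_elliptic_false _ _ _ ha z X (J j) (J' j') g0 g0' hX) => //.
  + by exists l.
  + by move=> b hb; rewrite -eA; exact: h2.
  by move=> b hb; rewrite -eA'; exact: h2'.
- exists beta => //; split => //; rewrite HA' in hk' *.
  apply: (elliptic_compat hn (J := J j) (g0 := g0)) => //; rewrite ?cA //.
  by move=> b hb; rewrite -eA; exact: h2.
- exists beta' => //; split => //; rewrite HA in hk *.
  apply: (elliptic_compat hn (J := J' j') (g0 := g0')) => //; rewrite ?cA' //.
  by move=> b hb; rewrite -eA'; exact: h2'.
rewrite HA in hk *; rewrite HA' in hk' *.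
have [|beta hb hc] := @common_compat _ _ _ ha hn z _ _ hXp
  (fun i => if i then J ord0 else J' ord0) (fun i => if i then k else k').
  by case.
by exists beta => //; split; [exact: (hc true)|exact: (hc false)].
Qed.

Definition hnn_splitting (w : F) : set (set F) := [set generated [set t * w]; B].

(** Up to conjugation [B] is itself a factor and [t * w] lies in the other one, so it already starts
    and ends outside [B]. *)
Lemma hnn_twisting w (A : 'I_2 -> set F) (hA : free_factorization A) g : B w ->
  range A = conj_factors (hnn_splitting w) g -> twisting (proj1 hA) [set w].
Proof.
move=> hw eA; left.
have hj (S : set F) : hnn_splitting w S -> exists j, A j = [set x ^ g | x in S].
  move=> hS; have : range A [set x ^ g | x in S] by rewrite eA; exists S.
  by move=> [j _ e]; exists j.
have [j ej] := hj B (or_intror erefl).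
have [j' ej'] := hj (generated [set t * w]) (or_introl erefl).
have tw : A j' ((t * w) ^ g) by rewrite ej'; exists (t * w) => //; exact: sub_generated.
have ntw : ~ B (t * w).
  rewrite bfacMr // => /bspan_letter /=; by rewrite eqxx.
have ntw1 : (t * w) ^ g <> 1.
  move/eqP; rewrite conjg_eq1 => /eqP e; apply: ntw; rewrite e.
  exact: subgroup1 (bfac_subgroup ha z).
have jj : j' != j.
  apply/eqP => e; apply: ntw; move: tw; rewrite e ej => -[x hx /conjg_inj <-].
  by [].
have econj x : g^-1 * x * g = x ^ g by rewrite conjgE mulgA.
exists j, g, w; split => //; split => //.
- by move=> b hb; rewrite econj ej; exists b.
- by rewrite econj; apply/eqP.
- by rewrite econj (hd_syl (proj1 hA) tw ntw1); apply: contraNneq jj => -[->].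
rewrite econj (hd_syl (proj1 hA) (i := j')); first by apply: contraNneq jj => -[->].
  exact: (subgroupV (proj1 (proj1 hA) _)).
by move/eqP; rewrite invg_eq1 => /eqP.
Qed.

Section Lipschitz.
Variables (h : F -> int) (D : nat).
Hypothesis hD : forall H : pred F, (forall g, finite_set [set u | H u != H (u * g)]) ->
  forall k beta beta', good ha z H k -> B beta -> B beta' ->
  compat ha z H k beta -> compat ha z H k beta' -> `|h beta - h beta'|%N <= D.

Let dZ (p q r : int) m m' : `|p - q|%N <= m -> `|q - r|%N <= m' -> `|p - r|%N <= m + m'.
Proof. lia. Qed.

Lemma twisting_close (A : 'I_2 -> set F) (hA : free_product A) R beta beta' :
  twisting hA R -> B beta -> B beta' -> R beta -> R beta' -> `|h beta - h beta'|%N <= D.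
Proof.
case=> [[j [g0 [b0 [_ ->]]]] _ _ -> ->|[k [hk ->]] hb hb' hc hc'].
  by rewrite subrr.
exact: (hD (hin_almost_invariant hA (pred1 ord0))) hk hb hb' hc hc'.
Qed.

(** A vertex may have several twisting sets, so [main] is proved for all of them; at the two ends
    [hnn_twisting] selects a singleton. The first edge is free and each further one costs [D]. The
    walk has at least one edge, since two words describing one vertex are not compared directly. *)
Lemma path_lower_bound (u v : ES_vertex F) w w' k (p : nat -> ES_vertex F) :
  B w -> B w' -> val u = conj_class (hnn_splitting w) ->
  val v = conj_class (hnn_splitting w') ->
  p 0%N = u -> p k.+1 = v -> (forall i, i < k.+1 -> ES_adj (p i) (p i.+1)) ->
  `|h w - h w'|%N <= D * k.+1.
Proof.
move=> hw hw' eu ev p0 pk hp.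
have main m : m <= k -> exists A (hA : free_factorization A), val (p m.+1) (range A) /\
    forall R, twisting (proj1 hA) R ->
      exists2 beta, B beta & R beta /\ `|h w - h beta|%N <= D * m.
  elim: m => [|m IH] hm.
    have hP : val u (hnn_splitting w) by rewrite eu; exact: conj_class_refl.
    have [A hA eA] := vertex_splitting hP.
    have hadj := hp 0%N (ltn0Sn _); rewrite p0 in hadj.
    rewrite eA in hP; have [Q [X [hQ hX r1 r2]]] := ES_adj_step hP hadj.
    have [A' hA' eA'] := vertex_splitting hQ; rewrite eA' in hQ r2.
    exists A', hA'; split => // R hR.
    have hT : twisting (proj1 hA) [set w].
      by apply: (@hnn_twisting w A hA 1) => //; rewrite conj_factors1.
    have [beta hb [/= -> hRb]] := twisting_edge hX r1 r2 hP hQ (proj1 hadj) hT hR.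
    by exists w => //; split=> //; rewrite subrr.
  have [A [hA [hv hR]]] := IH (ltnW hm).
  have hadj := hp m.+1 (hm : m.+1 < k.+1).
  have [Q [X [hQ hX r1 r2]]] := ES_adj_step hv hadj.
  have [A' hA' eA'] := vertex_splitting hQ; rewrite eA' in hQ r2.
  exists A', hA'; split => // R' hR'.
  have [R hRt] := twisting_exists hA.
  have [beta hb [hRb hbd]] := hR R hRt.
  have [beta' hb' [hRb' hRb'']] := twisting_edge hX r1 r2 hv hQ (proj1 hadj) hRt hR'.
  exists beta' => //; split => //.
  by rewrite mulnS addnC; apply: dZ hbd _; exact: (twisting_close hRt hb hb' hRb hRb').
have [A [hA [hv hR]]] := main k (leqnn k).
rewrite pk ev in hv; case: hv => g _ eA.
have [beta hb [/= -> hbd]] := hR _ (hnn_twisting hA hw' (esym eA)).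
by rewrite mulnS; apply: leq_trans hbd (leq_addl _ _).
Qed.

End Lipschitz.
End PathBound.

(** * Brooks quasimorphisms *)

#[local] Arguments prefix : simpl never.

Section Occurrences.
Variable T : eqType.
Implicit Types p u v w : seq T.

(** Overlapping occurrences all count. *)
Fixpoint occ p w : nat := if w is _ :: w' then prefix p w + occ p w' else 0.

Lemma occ_count p w :
  occ p w = count (fun j => prefix p (drop j w)) (iota 0 (size w)).
Proof.
elim: w => [|l w IH] //; rewrite [LHS]/= [size _]/= [iota _ _]/= [RHS]/=; congr addn.
by rewrite -[1%N]/(1 + 0)%N iotaDl count_map IH.
Qed.

Lemma prefix_catl p u v : prefix p u -> prefix p (u ++ v).
Proof. by move=> /prefixP[s ->]; rewrite -catA prefix_prefix. Qed.

Lemma prefix_cat_long p u v : size p <= size u -> prefix p (u ++ v) = prefix p u.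
Proof.
move=> h; rewrite !prefixE take_cat; case: ltnP => // h'.
have -> : size p = size u by lia.
by rewrite subnn take0 cats0 take_size.
Qed.

Lemma occ_cat_ge p u v : occ p u + occ p v <= occ p (u ++ v).
Proof.
elim: u => [|l u IH] //=; rewrite -addnA; apply: leq_add => //.
by have := @prefix_catl p (l :: u) v; case: (prefix p (l :: u)) => //= ->.
Qed.

Lemma occ_cat_le p u v : occ p (u ++ v) <= occ p u + occ p v + minn (size u) (size p).
Proof.
elim: u => [|l u IH] /=; first by rewrite leq_addr.
have [h|h] := leqP (size p) (size (l :: u)).
  rewrite -cat_cons (prefix_cat_long v h); move: IH h => /=; lia.
have := leq_b1 (prefix p (l :: u ++ v)); move: IH h => /=; lia.
Qed.

End Occurrences.

Section Brooks.
Variables (F : groupType) (n : nat) (a : n.-tuple F).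
Hypothesis ha : free_basis a.
Local Notation rw := (rw ha).
Variable p : seq ('I_n * bool).
Implicit Types w : seq ('I_n * bool).

Definition brooks_word w : int := (Posz (occ p w) - Posz (occ p (winv w)))%R.
Definition brooks (g : F) : int := brooks_word (rw g).

(** Only occurrences across the junction are new, at most [size p] of them for each of the two
    counts. *)
Lemma brooks_word_cat u v :
  `|(brooks_word (u ++ v) - brooks_word u - brooks_word v)%R|%N <= size p.
Proof.
rewrite /brooks_word winv_cat.
have := occ_cat_ge p u v; have := occ_cat_le p u v.
have := occ_cat_ge p (winv v) (winv u); have := occ_cat_le p (winv v) (winv u).
have := geq_minr (size u) (size p); have := geq_minr (size (winv v)) (size p).
move: (minn (size u) _) (minn (size (winv v)) _) => m1 m2.
move: (occ p (u ++ v)) (occ p (winv v ++ winv u)) => o1 o2.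
move: (occ p u) (occ p v) (occ p (winv u)) (occ p (winv v)) (size p) => *.
lia.
Qed.

Lemma brooks_word_winv w : brooks_word (winv w) = (- brooks_word w)%R.
Proof. by rewrite /brooks_word winvK opprB. Qed.

Lemma brooksV g : brooks g^-1 = (- brooks g)%R.
Proof. by rewrite /brooks rwV brooks_word_winv. Qed.

(** There are three concatenations around the cancelled word [c]: [u c], [winv c v] and [u v], each
    with error at most [size p]. *)
Lemma brooksM g h : `|(brooks (g * h)%g - brooks g - brooks h)%R|%N <= 3 * size p.
Proof.
rewrite /brooks; have [u [c [v [-> -> -> _]]]] := rwM_cancel ha g h.
have := brooks_word_cat u v; have := brooks_word_cat u c.
have := brooks_word_cat (winv c) v; rewrite brooks_word_winv; lia.
Qed.

Lemma brooks1 : brooks 1 = 0%R.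
Proof. by rewrite /brooks rw1. Qed.

Lemma brooksX g k : `|(brooks (g ^+ k)%g - brooks g * Posz k)%R|%N <= 3 * size p * k.
Proof.
elim: k => [|k IH]; first by rewrite expg0 brooks1 mulr0 subr0.
have e : (brooks g * Posz k.+1 = brooks g + brooks g * Posz k)%R.
  by rewrite intS mulrDr mulr1.
rewrite expgSr e mulnS; have := brooksM (g ^+ k) g; move: IH.
move: (brooks (g ^+ k * g)) (brooks (g ^+ k)) (brooks g * Posz k)%R (brooks g) => q1 q2 q3 q4.
by move: (3 * size p * k)%N (3 * size p)%N => m1 m2; lia.
Qed.

Variable z : 'I_n.
Hypothesis hn : (1 < n)%N.
Local Notation B := (bfac ha z).
Let hB := bfac_subgroup ha z.
Local Notation zfree := (zfree z).

(* The Whitehead graph of [p] stays connected when a vertex [d0] is removed. *)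
Definition full : Prop := forall (tau : 'I_n * bool -> bool) d0,
  (exists d d', [/\ zfree d, zfree d', d != d0, d' != d0 & tau d != tau d']) ->
  exists u x y v, [/\ p = u ++ x :: y :: v, linv x != d0, y != d0 & tau (linv x) != tau y].

Section Cylinders.
Variable P : pred F.
Hypothesis Pinv : forall i, i != z -> finite_set [set b | B b /\ P b != P (b * tnth a i)].
Hypothesis Pinf : forall v, infinite_set [set b | B b /\ P b == v].

Let pure w := exists v, finite_set [set b | [/\ B b, prefix w (rw b) & P b != v]].

(** Beyond the longest word in the finite coboundary of [P], lengthening a word by a letter no
    longer changes [P]. *)
Let long_pure : exists L, forall w, L < size w -> pure w.
Proof.
pose S := \bigcup_(i in [set i | i != z]) [set b | B b /\ P b != P (b * tnth a i)].
have : finite_set S.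
  by apply: bigcup_finite => [|i hi]; [exact: finite_finset|exact: Pinv].
move=> /finite_seqP[l hl].
exists (\max_(g <- l) size (rw g)) => w hw.
have hS g : size w <= size (rw g) -> ~ S g.
  rewrite hl /= => h1 h2; have : size (rw g) < size w.
    by apply: leq_ltn_trans hw; apply: leq_bigmax_seq.
  by rewrite ltnNge h1.
exists (P (word_eval a w)).
apply: (@sub_finite_set _ _ set0) => // b [hb /prefixP[u e] /negP []]; apply/eqP.
rewrite -(rwK ha b) e; have := rw_red ha b; move: hb; rewrite bfacE e.
elim/last_ind: u {e} => [|u l0 IH]; first by rewrite cats0.
rewrite -rcons_cat all_rcons => /andP[hl0 hz] hr.
have hr' : red (w ++ u) by move: hr; rewrite -cats1 => /red_catl.
rewrite -(IH hz hr') -cats1 word_eval_cat word_eval1.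
set x := word_eval a (w ++ u).
have hx : B x by rewrite bfacE rw_eval.
have hxl : B (x * letter a l0).
  by apply: (subgroupM hB) => //; apply/bspan_letter.
apply/eqP; apply: contrapT => /negP hne.
case el : l0.2 hne; rewrite /letter el => hne.
  apply: (hS x); first by rewrite rw_eval // size_cat leq_addr.
  by exists l0.1 => //; split => //; rewrite eq_sym.
apply: (hS (x * (tnth a l0.1)^-1)).
  have -> : x * (tnth a l0.1)^-1 = word_eval a (rcons (w ++ u) l0).
    by rewrite -cats1 word_eval_cat word_eval1 /letter el.
  by rewrite rw_eval // size_rcons size_cat -addnS leq_addr.
exists l0.1 => //; split; last by rewrite mulgVK.
by move: hxl; rewrite /letter el.
Qed.

(** Take a longest impure word [w], of value [v]; the empty word is impure because [P] takes both
    values infinitely often. The extensions of [w] by a letter [d] are pure with value [tau d], and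
    [tau] is not constant, as otherwise [w] would be pure. *)
Let leaf : exists v d0 tau, [/\ B v,
  (exists d d', [/\ zfree d, zfree d', d != d0, d' != d0 & tau d != tau d']) &
  forall d, zfree d -> d != d0 ->
    finite_set [set b | [/\ B b, ohead (rw (v^-1 * b)) = Some d & P b != tau d]]].
Proof.
have [L hL] := long_pure.
pose Q m := `[< exists w, [/\ red w, all zfree w, ~ pure w & size w = m] >].
have hQ0 : exists m, Q m.
  exists 0; apply/asboolP; exists [::]; split => // -[v hv].
  apply: (Pinf (v := ~~ v)); apply: sub_finite_set hv => b /= [hb hP]; split => //.
    exact: prefix0s.
  by move: hP; case: (P b); case: v.
have hub m : Q m -> m <= L.
  by move=> /asboolP[w [_ _ hw <-]]; rewrite leqNgt; apply/negP => /hL.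
have [m /asboolP[w [wr wz wnp ws]] hmax] := ex_maxnP hQ0 hub.
(* [d0] is the letter that cancels against [w]. For the empty word it is a dummy: [(z, true)] is not
   [zfree]. *)
pose d0 := if w is l :: w' then linv (last l w') else (z, true).
have redw d : zfree d -> d != d0 -> red (rcons w d).
  move=> hd hne; rewrite -cats1 red_cat wr /=.
  by move: hne; rewrite /d0; case: (w) => //= l w'; apply: contra_neq => -[].
have hpure d : zfree d -> d != d0 -> pure (rcons w d).
  move=> hd hne; apply: contrapT => hnp.
  have : m.+1 <= m.
    apply: hmax; apply/asboolP; exists (rcons w d); split => //.
    - exact: redw.
    - by rewrite all_rcons hd.
    - by rewrite size_rcons ws.
  by rewrite ltnn.
pose tau d : bool := if pselect (pure (rcons w d)) is left h then projT1 (cid h) else true.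
have htau d : zfree d -> d != d0 ->
    finite_set [set b | [/\ B b, prefix (rcons w d) (rw b) & P b != tau d]].
  move=> h1 h2; rewrite /tau; case: pselect => [h|h]; last by case: h; exact: hpure.
  by case: (cid h).
exists (word_eval a w), d0, tau; split; first by rewrite bfacE rw_eval.
  apply: contrapT => hno; apply: wnp.
  have [v0 hv0] : exists v0, forall d, zfree d -> d != d0 -> tau d = v0.
    have [[d [h1 h2]]|hnone] := pselect (exists d, zfree d /\ d != d0).
      exists (tau d) => d' h1' h2'; apply/eqP; apply: contrapT => /negP hne.
      by apply: hno; exists d', d.
    by exists true => d h1 h2; case: hnone; exists d.
  exists v0.
  apply: (@sub_finite_set _ _ ([set word_eval a w] `|`
    \bigcup_(d in [set d | zfree d /\ d != d0])
      [set b | [/\ B b, prefix (rcons w d) (rw b) & P b != tau d]])).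
    move=> b [hb /prefixP[u e] hP]; case: u e => [|d u] e.
      by left; rewrite /= -(rwK ha b) e cats0.
    right; have hd : zfree d.
      by move: hb; rewrite bfacE e all_cat => /andP[_] /= /andP[].
    have hdd : d != d0.
      have := rw_red ha b; rewrite e -cat_rcons => /red_catl; rewrite -cats1 red_cat.
      rewrite /d0; case: (w) => [|l w'] /=.
        by move=> _; apply: contraTneq hd => ->; rewrite /(zfree _) eqxx.
      by move=> /andP[_]; apply: contra_neq => ->.
    exists d => //=; split => //; first by rewrite e -cat_rcons prefix_prefix.
    by rewrite (hv0 d).
  rewrite finite_setU; split; first exact: finite_set1.
  by apply: bigcup_finite => [|d [h1 h2]]; [exact: finite_finset|exact: htau].
move=> d hd hdd; apply: sub_finite_set (htau d hd hdd) => b /= [hb e hP]; split => //.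
case e' : (rw _) e => [|d' u] //= [ed]; subst d'.
have hr : red (w ++ d :: u).
  have := rw_red ha ((word_eval a w)^-1 * b); rewrite e' red_cat => ->.
  by move: (redw d hd hdd); rewrite -cats1 red_cat => /and3P[-> _].
have -> : b = word_eval a (w ++ d :: u).
  by rewrite word_eval_cat -e' rwK mulVKg.
by rewrite rw_eval // -cat_rcons prefix_prefix.
Qed.

(** By [full], [p] contains a turn [x y] with [tau (linv x) != tau y]. For each occurrence, [g] is
    translated so that this turn sits at [v]: the path from [b_ j] to [b_ j * g] comes from the
    branch [linv x] and leaves by the branch [y], so [P] separates its ends. The exceptions form the
    finite sets of [leaf], once for each end, whence [2 * M] with [M] independent of [g]. *)
Lemma occ_separation : full -> exists M, forall g N, B g ->
  atmost N [set b | B b /\ P b != P (b * g)] -> occ p (rw g) <= N + 2 * M.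
Proof.
move=> hfull; have [v [d0 [tau [hv hdd hfin]]]] := leaf.
have [u [x [y [s [ep hx hy hxy]]]]] := hfull tau d0 hdd.
pose E d := [set b | [/\ B b, ohead (rw (v^-1 * b)) = Some d & P b != tau d]].
have : finite_set (\bigcup_(d in [set d | zfree d /\ d != d0]) E d).
  by apply: bigcup_finite => [|d [h1 h2]]; [exact: finite_finset|exact: hfin].
move=> /finite_seqP[e he]; exists (size e) => g N hg [l hl hsub].
pose pos := [seq j <- iota 0 (size (rw g)) | prefix p (drop j (rw g))].
have -> : occ p (rw g) = size pos by rewrite occ_count size_filter.
pose i := size u.
(* The prefix of [rw g] that ends with the letter [x] of the occurrence at [j]. *)
pose pt j := word_eval a (take (j + i.+1) (rw g)).
pose b_ j := v * (pt j)^-1.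
have hpos j : j \in pos -> exists s', drop j (rw g) = u ++ x :: y :: s'.
  by rewrite mem_filter => /andP[/prefixP[s' ->] _]; exists (s ++ s'); rewrite ep -catA.
have split_rw j : j \in pos -> exists u' s', rw g = u' ++ x :: y :: s' /\
    take (j + i.+1) (rw g) = rcons u' x.
  move=> /[dup] hj /hpos[s' es]; exists (take j (rw g) ++ u), s'; split.
    by rewrite -catA -es cat_take_drop.
  have hjs : size (take j (rw g)) = j.
    by rewrite size_takel //; move: hj; rewrite mem_filter mem_iota => /andP[_]; lia.
  rewrite -{1}(cat_take_drop j (rw g)) es take_cat hjs ltnNge leq_addr /= addKn.
  by rewrite -cat_rcons take_size_cat ?size_rcons // rcons_cat.
have binj j j' : j \in pos -> j' \in pos -> b_ j = b_ j' -> j = j'.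
  move=> hj hj' /mulgI /invg_inj.
  have hr m : red (take m (rw g)) by apply: (@red_catl _ _ (drop m (rw g))); rewrite cat_take_drop rw_red.
  move/(congr1 rw); rewrite !rw_eval // => /(congr1 size).
  have sz m : m \in pos -> size (take (m + i.+1) (rw g)) = m + i.+1.
    move=> /[dup] hm /hpos[s' /(congr1 size)]; rewrite size_drop size_cat /= => h.
    by rewrite size_takel //; move: h; rewrite /i; lia.
  by rewrite !sz // => /eqP; rewrite eqn_add2r => /eqP.
have hall j : j \in pos -> b_ j \in l ++ (e ++ [seq c * g^-1 | c <- e]).
  move=> hj; have [u' [s' [eg et]]] := split_rw j hj.
  have hr := rw_red ha g.
  have hpt : pt j = word_eval a (rcons u' x) by rewrite /pt et.
  have hru : red (rcons u' x) by move: hr; rewrite eg -cat_rcons => /red_catl.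
  have hrs : red (y :: s') by move: hr; rewrite eg -cat_rcons => /red_catr.
  have /andP[hzu hzs] : all zfree (rcons u' x) && all zfree (y :: s').
    by rewrite -all_cat cat_rcons -eg.
  have hzx : zfree (linv x) by move: hzu; rewrite all_rcons => /andP[].
  have hzy : zfree y by case/andP: hzs.
  have hBpt : B (pt j) by rewrite bfacE hpt rw_eval.
  have hb : B (b_ j) by apply: (subgroupM hB) => //; exact: (subgroupV hB).
  have hbg : B (b_ j * g) by exact: (subgroupM hB).
  have e1 : ohead (rw (v^-1 * b_ j)) = Some (linv x).
    rewrite mulKg rwV hpt rw_eval // /winv map_rcons rev_rcons //.
  have e2 : ohead (rw (v^-1 * (b_ j * g))) = Some y.
    have -> : v^-1 * (b_ j * g) = word_eval a (y :: s').
      rewrite /b_ hpt -{1}(rwK ha g) eg -cat_rcons word_eval_cat; gsimp.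
      by [].
    by rewrite rw_eval.
  rewrite !mem_cat.
  have [e3|ne3] := eqVneq (P (b_ j)) (tau (linv x)); last first.
    have : (\bigcup_(d in [set d | zfree d /\ d != d0]) E d) (b_ j) by exists (linv x).
    by rewrite he /= => ->; rewrite orbT.
  have [e4|ne4] := eqVneq (P (b_ j * g)) (tau y); last first.
    have : (\bigcup_(d in [set d | zfree d /\ d != d0]) E d) (b_ j * g) by exists y.
    rewrite he /= => hin; apply/orP; right; apply/orP; right.
    by apply/mapP; exists (b_ j * g) => //; rewrite mulgK.
  have -> // : b_ j \in l.
  by apply: hsub; split => //; rewrite e3 e4.
have -> : size pos = size (map b_ pos) by rewrite size_map.
apply: (@leq_trans (size (l ++ (e ++ [seq c * g^-1 | c <- e])))).
  apply: uniq_leq_size.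
    rewrite map_inj_in_uniq; first by rewrite filter_uniq // iota_uniq.
    exact: binj.
  by move=> _ /mapP[j hj ->]; exact: hall.
by rewrite !size_cat size_map addnn -mul2n leq_add2r.
Qed.

(** The constant [M] of [occ_separation] depends on [P]. For the power [(2 * M).+1] of [g] it
    contributes less than 1 after division by the exponent, and integrality removes it. The inverse
    of [g] gives the other inequality. *)
Lemma brooks_separation g N : full -> B g ->
  atmost N [set b | B b /\ P b != P (b * g)] -> `|brooks g|%N <= N + 3 * size p.
Proof.
move=> hfull hg hN; have [M hM] := occ_separation hfull.
have shift (h : F) k S : B h -> atmost k S -> atmost k [set b | S (b * h)].
  move=> _; apply: (atmost_image (f := fun c => c * h^-1)) => b hb.
  by exists (b * h) => //; gsimp.
have hV : atmost N [set b | B b /\ P b != P (b * g^-1)].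
  have hgV := subgroupV hB hg.
  apply: atmost_sub (shift g^-1 _ _ hgV hN) => b /= [hb hne].
  by split; [exact: (subgroupM hB)|rewrite mulgVK eq_sym].
have upper h : B h -> atmost N [set b | B b /\ P b != P (b * h)] ->
    (brooks h <= Posz (N + 3 * size p))%R.
  move=> hh hhN.
  have hX k : atmost (N * k) [set b | B b /\ P b != P (b * h ^+ k)] /\ B (h ^+ k).
    elim: k => [|k [IH1 IH2]].
      split; last exact: subgroup1 hB.
      by exists [::] => // b [_ /=]; rewrite expg0 mulg1 eqxx.
    split; last by rewrite expgSr; exact: (subgroupM hB).
    rewrite mulnS addnC; apply: atmost_sub (atmostU IH1 (shift _ _ _ IH2 hhN)).
    move=> b /= [hb hne].
    have [e|ne] := eqVneq (P b) (P (b * h ^+ k)); last by left.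
    by right; split; [exact: (subgroupM hB)|rewrite -e -mulgA -expgSr].
  have [h1 h2] := hX (2 * M).+1.
  have := hM _ _ h2 h1; have := brooksX h (2 * M).+1.
  rewrite {1}/brooks /brooks_word; set o := occ p _; set o' := occ p _.
  move: (brooks h) => q.
  have [|hq] := lerP q (Posz (N + 3 * size p)); first by [].
  nia.
have u1 := upper g hg hN.
have := upper g^-1 (subgroupV hB hg) hV; rewrite brooksV; lia.
Qed.

End Cylinders.

(** The 12 is that of [compat2]; one term [3 * size p] comes from [brooks_separation], the other
    from the defect in [brooksM]. *)
Lemma brooks_compat_close (H : pred F) k beta beta' : full ->
  (forall g, finite_set [set u | H u != H (u * g)]) ->
  good ha z H k -> B beta -> B beta' ->
  compat ha z H k beta -> compat ha z H k beta' ->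
  `|brooks beta - brooks beta'|%N <= 12 + 6 * size p.
Proof.
move=> hfull hH hk hb hb' hc hc'.
have hg : B (beta^-1 * beta') by apply: (subgroupM hB) => //; exact: (subgroupV hB).
have := @brooks_separation (Pplus ha z H k) (fun i => @Pplus_almost_invariant _ _ _ ha hn z H hH k i hk)
  (fun v => @Pplus_infinite _ _ _ ha hn z H hH k v hk) _ 12 hfull hg (compat2 hb hc hc').
have := brooksM beta (beta^-1 * beta'); rewrite mulVKg; lia.
Qed.

End Brooks.

(** * The twisting words *)


Section TwistWords.
Variables (n : nat).
Hypothesis hn : (2 < n)%N.
Variable z : 'I_n.
Hypothesis hz : nat_of_ord z = n.-1.

Definition oidx (i : nat) : 'I_n := insubd z i.

Lemma oidxE i : i < n -> nat_of_ord (oidx i) = i.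
Proof. by move=> h; rewrite /oidx insubdK. Qed.

Lemma oidx_eq i j : i < n -> j < n -> (oidx i == oidx j) = (i == j).
Proof. by move=> hi hj; rewrite -val_eqE /= !oidxE. Qed.

Definition pidx : seq nat := iota 0 n.-1 ++ [:: 0; 1; 0]%N.

Lemma pidx_lt i : i \in pidx -> i < n.-1.
Proof. by rewrite mem_cat mem_iota !inE; lia. Qed.

Lemma pidxE : pidx = [:: 0; 1]%N ++ iota 2 (n - 3) ++ [:: 0; 1; 0]%N.
Proof.
by rewrite /pidx catA; congr cat; have -> : n.-1 = (n - 3).+2 by lia.
Qed.

Definition blocks (t : nat) (r : seq nat) : seq ('I_n * bool) :=
  flatten [seq nseq t.+1 (oidx i, true) | i <- r].

Lemma blocks_cat t r r' : blocks t (r ++ r') = blocks t r ++ blocks t r'.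
Proof. by rewrite /blocks map_cat flatten_cat. Qed.

Lemma blocks1 t i : blocks t [:: i] = nseq t.+1 (oidx i, true).
Proof. by rewrite /blocks /= cats0. Qed.

Definition positive (w : seq ('I_n * bool)) := all (fun l => l.2) w.

Lemma blocks_positive t r : positive (blocks t r).
Proof.
elim: r => [|i r IH] //; rewrite /blocks /= -/(blocks t r) /positive /= all_cat.
by rewrite all_nseq orbT.
Qed.

Lemma positive_red w : positive w -> red w.
Proof.
elim: w => [|l w IH] // /andP[hl hw]; rewrite red_cons IH // andbT.
case: w hw {IH} => [|l' w] //= /andP[hl' _].
by apply/eqP => -[e]; move: hl'; rewrite e /= hl.
Qed.

Definition pw t := blocks t pidx.

Lemma size_pw_gt0 t : 0 < size (pw t).
Proof. by rewrite /pw pidxE /blocks /= size_cat. Qed.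

Lemma pw_zfree t : all (zfree z) (pw t).
Proof.
apply/allP => l /flattenP[_ /mapP[i /pidx_lt hi ->]] /nseqP[-> _].
rewrite /zfree /=; apply/eqP => /(congr1 val) /=; rewrite oidxE; lia.
Qed.

Lemma infix_blocks_same t r i r' : (1 <= t)%N -> exists u v,
  blocks t (r ++ i :: r') = u ++ (oidx i, true) :: (oidx i, true) :: v.
Proof.
case: t => // t _; exists (blocks t.+1 r), (nseq t (oidx i, true) ++ blocks t.+1 r').
by rewrite blocks_cat /blocks /=.
Qed.

Lemma infix_blocks_next t r i j r' : exists u v,
  blocks t (r ++ i :: j :: r') = u ++ (oidx i, true) :: (oidx j, true) :: v.
Proof.
exists (blocks t r ++ nseq t (oidx i, true)), (nseq t (oidx j, true) ++ blocks t r').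
rewrite blocks_cat -catA; congr cat; rewrite /blocks /= -cat_cons.
have -> : (oidx i, true) :: nseq t (oidx i, true) = rcons (nseq t (oidx i, true)) (oidx i, true).
  by elim: t => //= t ->.
by rewrite cat_rcons.
Qed.

(* The Whitehead graph of [p_t] contains the cycle
   a_0, a_0^-1, a_1, a_1^-1, ..., a_(n-2)^-1, a_0. *)
Definition cyc (k : nat) : 'I_n * bool :=
  let r := k %% (n.-1).*2 in (oidx r./2, ~~ odd r).

Lemma cycD k : cyc (k + (n.-1).*2) = cyc k.
Proof. by rewrite /cyc modnDr. Qed.

Lemma cyc_inj k k' : k < (n.-1).*2 -> k' < (n.-1).*2 -> cyc k = cyc k' -> k = k'.
Proof.
move=> hk hk'; rewrite /cyc !modn_small // => -[/eqP e] /negb_inj h2; move: e.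
rewrite oidx_eq => [/eqP h1||]; [|lia|lia].
by rewrite -(odd_double_half k) -(odd_double_half k') h1 h2.
Qed.

Lemma cyc_surj d : zfree z d -> exists2 k, k < (n.-1).*2 & cyc k = d.
Proof.
case: d => i b; rewrite /zfree /= -val_eqE /= hz => hi; have hin := ltn_ord i.
exists (i.*2 + ~~ b); first by case: b; lia.
rewrite /cyc modn_small; last by case: b; lia.
have -> : (i.*2 + ~~ b)./2 = i by case: b; lia.
have -> : odd (i.*2 + ~~ b) = ~~ b by case: b; rewrite /= ?addn0 ?addn1 /= ?odd_double.
rewrite negbK; congr pair; apply: val_inj; rewrite /= oidxE //; lia.
Qed.

(** An even position of the cycle joins a letter to its inverse, by a turn inside a block, which has
    length at least 2. An odd one corresponds to the passage from a block to the next. The first [0]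
    that follows [iota 0 n.-1] in [pidx] closes the cycle. *)
Lemma pw_turn t k : (1 <= t)%N -> exists u x y v, pw t = u ++ x :: y :: v /\
  ((linv x = cyc k /\ y = cyc k.+1) \/ (linv x = cyc k.+1 /\ y = cyc k)).
Proof.
move=> ht; set m := (n.-1).*2.
have hm : 0 < m by rewrite /m; lia.
have hr := ltn_pmod k hm.
have hk1 : k.+1 %% m = (k %% m).+1 %% m by rewrite -addn1 -modnDml addn1.
set r := k %% m in hr hk1.
have hi : r./2 \in iota 0 n.-1 by rewrite mem_iota; move: hr; rewrite /m; lia.
have [odr|evr] := boolP (odd r); last first.
  have e1 : k.+1 %% m = r.+1 by rewrite hk1 modn_small //; move: hr evr; rewrite /m; lia.
  have [s1 [s2 es]] : exists s1 s2, pidx = s1 ++ r./2 :: s2.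
    have : r./2 \in pidx by rewrite mem_cat hi.
    by move=> /splitPr[s1 s2]; exists s1, s2.
  have [u [v e]] := infix_blocks_same s1 (r./2) s2 ht.
  exists u, (oidx r./2, true), (oidx r./2, true), v; split; first by rewrite /pw es.
  right; rewrite /cyc -/m e1 -/r /linv /= evr; split => //; congr pair.
  by congr oidx; move: evr; lia.
have [hl|hl] := ltnP r.+1 m.
  have e1 : k.+1 %% m = r.+1 by rewrite hk1 modn_small.
  have [s1 [s2 es]] : exists s1 s2, pidx = s1 ++ r./2 :: (r./2).+1 :: s2.
    exists (iota 0 r./2), (iota (r./2).+2 (n.-1 - (r./2).+2) ++ [:: 0; 1; 0]%N).
    rewrite /pidx -cat_cons -cat_cons catA; congr cat.
    have {1}-> : n.-1 = (r./2 + (n.-1 - (r./2).+2).+2)%N by move: hl odr; rewrite /m; lia.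
    by rewrite iotaD add0n.
  have [u [v e]] := infix_blocks_next t s1 (r./2) (r./2).+1 s2.
  exists u, (oidx r./2, true), (oidx (r./2).+1, true), v; split; first by rewrite /pw es.
  left; rewrite /cyc -/m e1 -/r /linv /= odr; split => //; congr pair.
  by congr oidx; move: odr; lia.
have er : r.+1 = m by apply/eqP; rewrite eqn_leq hr.
have e1 : k.+1 %% m = 0 by rewrite hk1 er modnn.
have es : pidx = iota 0 n.-2 ++ r./2 :: 0 :: [:: 1; 0]%N.
  rewrite /pidx; have {1}-> : n.-1 = (n.-2 + 1)%N by lia.
  rewrite iotaD -catA add0n /=; congr (_ ++ _ :: _); move: er; rewrite /m; lia.
have [u [v e]] := infix_blocks_next t (iota 0 n.-2) (r./2) 0 [:: 1; 0]%N.
exists u, (oidx r./2, true), (oidx 0, true), v; split; first by rewrite /pw es.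
by left; rewrite /cyc -/m e1 -/r /linv /= odr.
Qed.

(** A cycle stays connected when a vertex is removed: one of the two arcs between the remaining
    vertices avoids [d0]. *)
Lemma pw_full t : (1 <= t)%N -> full (pw t) z.
Proof.
move=> ht tau d0 [d [d' [hd hd' nd nd' hne]]]; apply: contrapT => hno.
have step k : cyc k != d0 -> cyc k.+1 != d0 -> tau (cyc k) = tau (cyc k.+1).
  move=> h1 h2; apply/eqP; apply: contrapT => /negP h3; apply: hno.
  have [u [x [y [v [e [[ex ey]|[ex ey]]]]]]] := pw_turn k ht;
    exists u, x, y, v; rewrite e ex ey; split => //.
  by rewrite eq_sym.
have arc k j : (forall i, i <= j -> cyc (k + i) != d0) -> tau (cyc k) = tau (cyc (k + j)).
  elim: j => [|j IH] h; first by rewrite addn0.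
  rewrite IH; last by move=> i hi; apply: h; exact: leqW.
  rewrite addnS step //; first by apply: h.
  by rewrite -addnS; apply: h.
have main k k' : k < k' -> k' < (n.-1).*2 -> cyc k != d0 -> cyc k' != d0 ->
    tau (cyc k) = tau (cyc k').
  move=> hkk hk' h1 h2.
  have [hall|hex] := pselect (forall i, i <= k' - k -> cyc (k + i) != d0).
    by rewrite (arc _ _ hall); congr (tau (cyc _)); lia.
  have [i hi /eqP ei] : exists2 i, i <= k' - k & cyc (k + i) == d0.
    apply: contrapT => hno'; apply: hex => i hi; apply/negP => e; apply: hno'.
    by exists i.
  have hall : forall j, j <= (n.-1).*2 - k' + k -> cyc (k' + j) != d0.
    move=> j hj; apply/eqP => ej; have e : cyc (k' + j) = cyc (k + i) by rewrite ej ei.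
    have [hl|hl] := ltnP (k' + j) (n.-1).*2.
      have e2 := cyc_inj hl (_ : k + i < _) e.
      have e3 : k' + j = k + i by apply: e2; lia.
      have e4 : k + i = k' by lia.
      by move: h2; rewrite -ei e4 eqxx.
    have e0 : cyc (k' + j - (n.-1).*2) = cyc (k + i) by rewrite -e -cycD subnK.
    have e3 : k' + j - (n.-1).*2 = k + i by apply: cyc_inj e0; lia.
    have e4 : k + i = k by lia.
    by move: h1; rewrite -ei e4 eqxx.
  rewrite (arc _ _ hall) -cycD; congr (tau (cyc _)); lia.
have [k hk ek] := cyc_surj hd; have [k' hk' ek'] := cyc_surj hd'.
move/eqP: hne; apply; rewrite -ek -ek' in nd nd' *.
have [hlt|hgt|->//] := ltngtP k k'; first exact: main.
by apply/esym; exact: main.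
Qed.

Lemma prefix_mem_drop (T : eqType) (p w : seq T) : 0 < occ p w ->
  exists u v, w = u ++ p ++ v.
Proof.
elim: w => [|l w IH] //=; have [/prefixP[v ->] _|_] := boolP (prefix p (l :: w)).
  by exists [::], v.
by rewrite add0n => /IH[u [v ->]]; exists (l :: u), v.
Qed.

(* [runs t y c w]: every maximal run of [y] in [w] that is followed by another letter
   has length [t.+1], when [w] is preceded by a run of length [c]. *)
Fixpoint runs (t : nat) (y : 'I_n * bool) (c : nat) w : bool :=
  if w is l :: w' then
    if l == y then runs t y c.+1 w' else ((c == 0) || (c == t.+1)) && runs t y 0 w'
  else true.

Lemma runs_nseq t y c k w : runs t y c (nseq k y ++ w) = runs t y (c + k) w.
Proof. by elim: k c => [|k IH] c /=; rewrite ?addn0 // eqxx IH addSnnS. Qed.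

Lemma runs_infix t y c k u x x' v : x != y -> x' != y ->
  runs t y c (u ++ x :: nseq k y ++ x' :: v) -> (k == 0) || (k == t.+1).
Proof.
move=> hx hx'; elim: u c => [|l u IH] c /=.
  rewrite (negPf hx) => /andP[_]; rewrite runs_nseq add0n /= (negPf hx').
  by move=> /andP[].
by case: (l == y) => [/IH|/andP[_ /IH]].
Qed.

Lemma runs_nseq_neq t y c k x w : x != y -> (c == 0) || (c == t.+1) ->
  runs t y c (nseq k.+1 x ++ w) = runs t y 0 w.
Proof.
move=> /negPf hx hc; rewrite /= hx hc /=; elim: k {hc} => [|k IH] //=.
by rewrite hx.
Qed.

Local Notation Y := (oidx 1, true).

Lemma runs_blocks1 t r w : runs t Y 0 (blocks t (1%N :: r) ++ w) =
  runs t Y t.+1 (blocks t r ++ w).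
Proof. by rewrite -cat1s blocks_cat -catA blocks1 runs_nseq. Qed.

Lemma runs_blocks_neq t c i r w : i < n -> i != 1%N -> (c == 0) || (c == t.+1) ->
  runs t Y c (blocks t (i :: r) ++ w) = runs t Y 0 (blocks t r ++ w).
Proof.
move=> hi hi1 hc; rewrite -cat1s blocks_cat -catA blocks1 runs_nseq_neq //.
by rewrite xpair_eqE oidx_eq ?andbT //; lia.
Qed.

Lemma runs_blocks_cat t c s r w : all (fun i => (i < n) && (i != 1%N)) s ->
  (c == 0) || (c == t.+1) ->
  runs t Y c (blocks t (s ++ 0 :: r) ++ w) = runs t Y 0 (blocks t r ++ w).
Proof.
elim: s c => [|i s IH] c hs hc; first by rewrite cat0s runs_blocks_neq //; lia.
move: hs => /andP[/andP[h1 h2] h3].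
by rewrite cat_cons runs_blocks_neq // IH.
Qed.

(** The letter of index 1 is chosen because its blocks never touch one another, even where copies of
    [pw t] meet, whereas there two blocks of index 0 merge. *)
Lemma runs_pw t w : runs t Y 0 (pw t ++ w) = runs t Y 0 w.
Proof.
rewrite /pw pidxE cat_cons runs_blocks_neq //; last by lia.
rewrite cat_cons runs_blocks1 cat0s runs_blocks_cat ?eqxx ?orbT //; last first.
  by apply/allP => i; rewrite mem_iota; lia.
by rewrite runs_blocks1 runs_blocks_neq ?eqxx ?orbT //; lia.
Qed.

Definition pwX t k := flatten (nseq k (pw t)).

(** [pw s] contains a run of exactly [s.+1] letters of index 1 enclosed by other letters; in the
    powers of [pw t] such runs have length [t.+1]. *)
Lemma occ_pw_neq s t k : s != t -> occ (pw s) (pwX t k) = 0.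
Proof.
move=> hst; apply/eqP; rewrite -leqn0 leqNgt; apply/negP => /prefix_mem_drop[u [v e]].
have hr : runs t Y 0 (pwX t k) by elim: k {e} => [|k IH] //; rewrite /pwX /= runs_pw.
(* The index that follows the first [1] is 2, or 0 when [n = 3]. *)
have [i [r [er hi hi1]]] : exists i r,
    [/\ iota 2 (n - 3) ++ [:: 0; 1; 0]%N = i :: r, i < n & i != 1%N].
  case en : (n - 3) => [|j]; first by exists 0, [:: 1; 0]%N; split => //; lia.
  by exists 2, (iota 3 j ++ [:: 0; 1; 0]%N); split => //; lia.
have [p1 [p2 [q [eq ep]]]] : exists p1 p2 q, q = nseq s.+1 Y /\
    pw s = p1 ++ (oidx 0, true) :: q ++ (oidx i, true) :: p2.
  exists (nseq s (oidx 0, true)), (nseq s (oidx i, true) ++ blocks s r), (nseq s.+1 Y).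
  split => //.
  rewrite /pw pidxE er (_ : [:: 0; 1]%N ++ i :: r = [:: 0]%N ++ [:: 1]%N ++ [:: i] ++ r) //.
  rewrite !blocks_cat !blocks1.
  have nS (x : 'I_n * bool) m w : nseq m.+1 x ++ w = nseq m x ++ x :: w.
    by elim: m => //= m <-.
  by rewrite nS; congr (_ ++ _ :: _).
rewrite e ep -catA cat_cons -catA cat_cons catA eq in hr.
have := runs_infix (x := (oidx 0, true)) (x' := (oidx i, true)) _ _ hr.
rewrite !xpair_eqE !oidx_eq /= ?andbT ?hi1 //; try lia.
Qed.

Lemma occ_pw_self t k j : occ (pw t) (pwX t k) + j <= occ (pw t) (pwX t (k + j)).
Proof.
elim: j => [|j IH]; first by rewrite !addn0.
rewrite !addnS /pwX /=; apply: leq_trans (occ_cat_ge _ _ _).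
have : 0 < occ (pw t) (pw t).
  have := size_pw_gt0 t; case e : (pw t) => [|l w] //= _.
  by rewrite prefix_refl.
move: IH; rewrite /pwX; lia.
Qed.

Lemma positive_pwX t k : positive (pwX t k).
Proof.
elim: k => [|k IH] //; rewrite /pwX /= /positive all_cat -/(pwX t k).
by rewrite [all _ (pwX t k)]IH andbT; exact: blocks_positive.
Qed.

Lemma occ_pw_winv s w : positive w -> occ (pw s) (winv w) = 0.
Proof.
move=> hw; apply/eqP; rewrite -leqn0 leqNgt; apply/negP => /prefix_mem_drop[u [v e]].
have := size_pw_gt0 s; have := blocks_positive s pidx; rewrite -/(pw s).
case: (pw s) e => [|l p] // e /andP[hl _] _.
have : l \in winv w by rewrite e mem_cat mem_head orbT.
by rewrite mem_rev => /mapP[l' /(allP hw) h el]; move: hl; rewrite el /= h.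
Qed.

Variables (F : groupType) (a : n.-tuple F).
Hypothesis ha : free_basis a.

Lemma pword_eval t : pword a t = word_eval a (pw t).
Proof.
rewrite /pword -/pidx /pw; have : all (fun i => i < n) pidx.
  by apply/allP => i /pidx_lt; lia.
elim: pidx => [|i r IH] /=; first by rewrite big_nil word_eval_nil.
move=> /andP[hi /IH e]; rewrite big_cons e /blocks /= -cat_cons word_eval_cat; congr (_ * _).
have -> : nth 1 a i = tnth a (oidx i) by rewrite (tnth_nth 1) oidxE.
have -> : (oidx i, true) :: nseq t (oidx i, true) = nseq t.+1 (oidx i, true) by [].
by elim: t.+1 => [|j IHj]; rewrite ?expg0 ?word_eval_nil // expgS IHj [nseq _ _]/= word_eval_cons.
Qed.

Lemma rw_pwordX t k : rw ha (pword a t ^+ k) = pwX t k.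
Proof.
rewrite -[RHS](rw_eval ha); last exact/positive_red/positive_pwX.
congr rw; rewrite pword_eval; elim: k => [|k IH]; first by rewrite expg0 word_eval_nil.
by rewrite expgS IH /pwX /= word_eval_cat.
Qed.

Local Notation brooks_pw s := (brooks ha (pw s)).

Lemma brooks_pwordX s t k : brooks_pw s (pword a t ^+ k) = Posz (occ (pw s) (pwX t k)).
Proof.
by rewrite /brooks /brooks_word rw_pwordX (occ_pw_winv _ (positive_pwX t k)) subr0.
Qed.

Lemma brooks_expgz_neq s t (k : int) : s != t -> brooks_pw s (expgz (pword a t) k) = 0%R.
Proof.
by move=> h; case: k => k; rewrite /expgz ?brooksV brooks_pwordX occ_pw_neq ?oppr0.
Qed.

Lemma brooks_expgz_self t (k k' : int) :
  `|k - k'|%N <= `|brooks_pw t (expgz (pword a t) k) - brooks_pw t (expgz (pword a t) k')|%N.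
Proof.
have h j i : j <= i -> (Posz j - Posz i = - Posz (i - j))%R by lia.
have mono j i : j <= i ->
    occ (pw t) (pwX t j) + (i - j) <= occ (pw t) (pwX t i).
  by move=> ji; have := occ_pw_self t j (i - j); rewrite subnKC.
have e0 : occ (pw t) (pwX t 0) = 0 by [].
case: k k' => k [] k'; rewrite /expgz ?brooksV !brooks_pwordX.
- have [hk|hk] := leqP k k'; first by have := mono _ _ hk; lia.
  by have := mono _ _ (ltnW hk); lia.
- by have := mono 0 k (leq0n _); have := mono 0 k'.+1 (leq0n _); rewrite NegzE; lia.
- by have := mono 0 k.+1 (leq0n _); have := mono 0 k' (leq0n _); rewrite NegzE; lia.
have [hk|hk] := leqP k k'; first by have := mono k.+1 k'.+1 hk; rewrite !NegzE; lia.
by have := mono k'.+1 k.+1 (ltnW hk); rewrite !NegzE; lia.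
Qed.

Lemma brooks_prod (p : seq ('I_n * bool)) (I : Type) (r : seq I) (g : I -> F) :
  `|(brooks ha p (\prod_(j <- r) g j)%g - \sum_(j <- r) brooks ha p (g j))%R|%N
    <= 3 * size p * size r.
Proof.
elim: r => [|j r IH]; first by rewrite !big_nil brooks1 subr0.
rewrite !big_cons.
have -> : (3 * size p * size (j :: r) = 3 * size p + 3 * size p * size r)%N by rewrite /= mulnS.
have := brooksM ha p (g j) (\prod_(j <- r) g j).
move: IH; move: (3 * size p * size r)%N (3 * size p)%N => m1 m2.
move: (brooks _ _ _) (brooks _ _ _) (brooks _ _ _) => q1 q2 q3.
move: (\sum_(_ <- _) _)%R => q4; lia.
Qed.

Definition twist m (k : 'rV[int]_m) : F := \prod_(j < m) expgz (pword a j.+1) (k 0%R j).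

(** Each of the two products has [m] factors, and each factor costs the defect
    [3 * size (pw i.+1)]. *)
Lemma brooks_twist m (k k' : 'rV[int]_m) (i : 'I_m) :
  `|k 0%R i - k' 0%R i|%N <=
  `|brooks_pw i.+1 (twist k) - brooks_pw i.+1 (twist k')|%N + 6 * size (pw i.+1) * m.
Proof.
have e (l : 'rV[int]_m) : (\sum_(j <- index_enum 'I_m)
    brooks_pw i.+1 (expgz (pword a j.+1) (l 0 j)))%R = brooks_pw i.+1 (expgz (pword a i.+1) (l 0%R i)).
  rewrite (bigD1 i) //= big1 ?addr0 // => j hj.
  by apply: brooks_expgz_neq; rewrite eqSS eq_sym; exact: hj.
have sz : size (index_enum 'I_m) = m.
  rewrite -(card_uniqP (index_enum_uniq 'I_m)) -[RHS]card_ord.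
  by apply: eq_card => j; rewrite mem_index_enum.
have := @brooks_prod (pw i.+1) _ (index_enum 'I_m) (fun j => expgz (pword a j.+1) (k 0%R j)).
have := @brooks_prod (pw i.+1) _ (index_enum 'I_m) (fun j => expgz (pword a j.+1) (k' 0%R j)).
rewrite !e !sz -/(twist k) -/(twist k').
have := brooks_expgz_self i.+1 (k 0%R i) (k' 0%R i).
move: (brooks _ _ _) (brooks _ _ _) (brooks _ _ _) (brooks _ _ _) => q1 q2 q3 q4.
have -> : (6 * size (pw i.+1) * m = 2 * (3 * size (pw i.+1) * m))%N by lia.
by move: (3 * _ * m)%N => M; lia.
Qed.

Lemma twist_bfac m (k : 'rV[int]_m) : bfac ha z (twist k).
Proof.
have hB := bfac_subgroup ha z.
have hp t j : bfac ha z (pword a t ^+ j).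
  elim: j => [|j IH]; first exact: subgroup1 hB.
  rewrite expgS; apply: (subgroupM hB) => //.
  by rewrite pword_eval; apply: bspan_eval; exact: pw_zfree.
rewrite /twist; elim/big_ind: _ => [|x y hx hy|j _]; first exact: subgroup1 hB.
  exact: (subgroupM hB).
by case: (k 0%R j) => i; rewrite /expgz; [|apply: (subgroupV hB)]; exact: hp.
Qed.

End TwistWords.

(** * Subsets of a basis *)

Section BasisPartition.
Variables (F : groupType) (n : nat) (x : n.-tuple F).
Hypothesis hx : free_basis x.
Local Notation rw := (rw hx).

Section Coloring.
Variables (I : eqType) (c : 'I_n -> I).

Definition block i : set F := bspan hx (fun j => c j == i).

Fixpoint syllables (w : seq ('I_n * bool)) : seq (I * F) :=
  if w is l :: w' then
    if syllables w' is (i, s) :: v then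
      if c l.1 == i then (i, letter x l * s) :: v
      else (c l.1, letter x l) :: (i, s) :: v
    else [:: (c l.1, letter x l)]
  else [::].

Let colored i := all (fun l : 'I_n * bool => c l.1 == i).

Lemma syllables_cat i r w : colored i r -> r != [::] -> hidx (syllables w) != Some i ->
  syllables (r ++ w) = (i, word_eval x r) :: syllables w.
Proof.
elim: r => [|l r IH] // /andP[/eqP hl hr] _ hw.
have [->|rn] := eqVneq r [::].
  rewrite word_eval1 /=; case: (syllables w) hw => [|[i' s] v]; rewrite ?hl //.
  by rewrite /hidx /= => hne; case: eqP => // e; rewrite e eqxx in hne.
by rewrite cat_cons /= IH // hl eqxx word_eval_cons.
Qed.

Definition unsyllables (w : seq (I * F)) := flatten [seq rw l.2 | l <- w].

Lemma unsyllables_cons l w : unsyllables (l :: w) = rw l.2 ++ unsyllables w.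
Proof. by []. Qed.

Lemma rw_neq_nil s : s <> 1 -> rw s != [::].
Proof. by move=> hs; apply/eqP => e; apply: hs; rewrite -(rwK hx s) e word_eval_nil. Qed.

Lemma syllablesK w : alternating block w -> syllables (unsyllables w) = w.
Proof.
elim: w => [|[i s] w IH] // /alternating_cons[/= h1 h2 h3 /IH h4].
rewrite unsyllables_cons (@syllables_cat i) ?h4 ?rwK //; exact: rw_neq_nil.
Qed.

Lemma ohead_unsyllables w l : alternating block w -> ohead (unsyllables w) = Some l ->
  hidx w = Some (c l.1).
Proof.
case: w => [|[i s] w] // /alternating_cons[/= h1 h2 _ _]; rewrite unsyllables_cons /hidx /=.
have := rw_neq_nil h2; move: h1; rewrite /block /bspan /=.
by case: (rw s) => [|l' r] //= /andP[/eqP h _] _ [<-]; rewrite h.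
Qed.

Lemma unsyllables_red w : alternating block w -> red (unsyllables w).
Proof.
elim: w => [|[i s] w IH] // /alternating_cons[/= h1 h2 h3 h4].
rewrite unsyllables_cons red_cat rw_red (IH h4) /=.
move: h1; rewrite /block /bspan /=.
case: (rw s) => [|l r] //= h1.
have hl : c (last l r).1 == i by move/allP: (h1 : all (fun l => c l.1 == i) (l :: r)); apply; rewrite mem_last.
apply: contraNneq h3 => e; rewrite (ohead_unsyllables h4 e) /=; apply/eqP; congr Some.
exact/eqP.
Qed.

Lemma unsyllables_eval w : word_eval x (unsyllables w) = pval w.
Proof.
elim: w => [|l w IH]; first by rewrite word_eval_nil pval_nil.
by rewrite unsyllables_cons word_eval_cat rwK IH pval_cons.
Qed.

Lemma syllables_alt w : red w ->
  alternating block (syllables w) /\ unsyllables (syllables w) = w.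
Proof.
elim: w => [|l w IH] // hr.
have hw : red w by move: hr; rewrite red_cons => /andP[].
have hl1 : letter x l <> 1.
  by move/(congr1 rw); rewrite rw_letter rw1.
have hbl : block (c l.1) (letter x l) by apply/bspan_letter.
have {IH} := IH hw; rewrite /=; case: (syllables w) => [|[i s] v] [h1 h2].
  split; first by apply/alternating_cons; split.
  by rewrite unsyllables_cons rw_letter -h2.
case: eqP => [e|ne].
  move/alternating_cons: (h1) => [/= h3 h4 h5 h6].
  have er : rw (letter x l * s) = l :: rw s.
    rewrite rwM_red rw_letter //.
    by move: hr; rewrite -h2 unsyllables_cons -cat_cons => /red_catl.
  split; last by rewrite unsyllables_cons /= er -h2 unsyllables_cons.
  apply/alternating_cons; split => //=.
    by apply: bspanM => //; rewrite -e.
  by move/(congr1 rw); rewrite er rw1.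
split; last by rewrite unsyllables_cons rw_letter h2.
by apply/alternating_cons; split => //; apply/eqP => -[/esym].
Qed.

(** [syllables] and [unsyllables] are inverse bijections between reduced words and alternating
    words. *)
Lemma basis_partition : free_product block.
Proof.
split=> [i|g]; first exact: bspan_subgroup.
have [h1 h2] := syllables_alt (rw_red hx g).
exists (syllables (rw g)); split.
  by case: (h1) => h3 h4; split => //; rewrite -[LHS]unsyllables_eval h2 rwK.
move=> w [h3 h4 h5]; have hw : alternating block w by split.
by rewrite -(syllablesK hw) -(rw_eval hx (unsyllables_red hw)) unsyllables_eval -h5.
Qed.

End Coloring.

Lemma basis_factorization k (c : 'I_n -> 'I_k) : (forall i, exists j, c j = i) ->
  free_factorization (block c).
Proof.
move=> hc; split; first exact: basis_partition.
move=> i e; have [j hj] := hc i.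
have : block c i (tnth x j) by apply/bspan_basis; rewrite hj.
rewrite e /= => /(congr1 rw); rewrite (rw_letter hx (j, true)) rw1.
by [].
Qed.

Lemma block_join k (c : 'I_n -> 'I_k) (T : pred 'I_k) :
  generated (\bigcup_(i in [set i | T i]) block c i) = bspan hx (fun j => T (c j)).
Proof.
apply/seteqP; split.
  apply: generated_min; first exact: bspan_subgroup.
  move=> g [i /= hi]; rewrite /block /bspan /=; apply: sub_all => l /eqP ->.
  by [].
rewrite -generated_bspan; apply: generated_min; first exact: generated_subgroup.
move=> _ [j /= hj <-]; apply: sub_generated; exists (c j) => //.
by apply/bspan_basis.
Qed.

Definition basis_splitting (S : {set 'I_n}) : set (set F) :=
  [set bspan hx (fun j => j \in S); bspan hx (fun j => j \notin S)].

Lemma representsE S v : represents x S v <-> val v = conj_class (basis_splitting S).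
Proof.
have e : [set generated [set tnth x j | j in [set j | j \in S]];
          generated [set tnth x j | j in [set j | j \notin S]]] = basis_splitting S.
  by rewrite /basis_splitting -!generated_bspan.
by rewrite /represents e; split=> [[]|].
Qed.

Lemma basis_splitting_refined k (c : 'I_n -> 'I_k) (T : {set 'I_k}) (S : {set 'I_n}) :
  (forall j, (j \in S) = (c j \in T)) -> refines (block c) (basis_splitting S).
Proof.
move=> h; exists T.
rewrite (block_join c (fun i => i \in T)) (block_join c (fun i => i \notin T)).
by rewrite /basis_splitting; congr [set bspan hx _; bspan hx _]; apply: funext => j; rewrite h.
Qed.

Lemma basis_splitting_splitting S : S != finset.set0 -> S != [set: 'I_n]%SET ->
  splitting (basis_splitting S).
Proof.
move=> /finset.set0Pn[j hj] hS.
have [j' hj'] : exists j', j' \notin S.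
  apply: contrapT => hno; move/eqP: hS; apply; apply/setP => i; rewrite finset.in_setT.
  by apply: contrapT => /negP h; apply: hno; exists i.
pose c (i : 'I_n) : 'I_2 := if i \in S then ord0 else lift ord0 ord0.
exists (block c).
  apply: basis_factorization => i; case: (ord2_cases i) => ->.
    by exists j; rewrite /c hj.
  by exists j'; rewrite /c (negPf hj').
have e0 : block c ord0 = bspan hx (fun j => j \in S).
  by rewrite /block; congr bspan; apply: funext => i; rewrite /c; case: (i \in S).
have e1 : block c (lift ord0 ord0) = bspan hx (fun j => j \notin S).
  by rewrite /block; congr bspan; apply: funext => i; rewrite /c; case: (i \in S).
apply/seteqP; split=> [A [->|->]|_ [i _ <-]].
- by exists ord0.
- by exists (lift ord0 ord0).
by case: (ord2_cases i) => ->; [left|right].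
Qed.

Lemma represents_exists S : S != finset.set0 -> S != [set: 'I_n]%SET ->
  exists v, represents x S v.
Proof.
move=> h1 h2; have hm : conj_class (basis_splitting S) \in
    [set u | exists2 P : set (set F), splitting P & u = conj_class P].
  by apply/mem_set; exists (basis_splitting S) => //; exact: basis_splitting_splitting.
by exists (SigSub hm : ES_vertex F); apply/representsE.
Qed.

Lemma represents_compl S v : represents x S v -> represents x (~: S)%SET v.
Proof.
move=> /representsE e; apply/representsE; rewrite e; congr conj_class.
rewrite /basis_splitting setUC; congr [set bspan hx _; bspan hx _]; apply: funext => j.
  by rewrite finset.in_setC.
by rewrite finset.in_setC negbK.
Qed.

(** If the vertices differ, then [S], the difference of [S'] and [S], and the complement of [S'] are
    three nonempty blocks giving a common refinement. *)
Lemma represents_nested S S' u v : S != finset.set0 -> S' != [set: 'I_n]%SET ->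
  S \subset S' -> represents x S u -> represents x S' v -> u = v \/ ES_adj u v.
Proof.
move=> hS hS' sub hu hv.
have [e|uv] := pselect (u = v); [by left|right; split => //].
have nSS : S != S'.
  apply/eqP => e; apply: uv; apply: val_inj.
  by move/representsE: hu => ->; move/representsE: hv => ->; rewrite e.
have /finset.set0Pn[j0 hj0] := hS.
have [j1 h1 h1'] : exists2 j, j \in S' & j \notin S.
  apply: contrapT => hno; move/eqP: nSS; apply; apply/eqP; rewrite finset.eqEsubset sub /=.
  by apply/fintype.subsetP => j hj; apply: contrapT => /negP h; apply: hno; exists j.
have [j2 h2] : exists j, j \notin S'.
  apply: contrapT => hno; move/eqP: hS'; apply; apply/setP => i; rewrite finset.in_setT.
  by apply: contrapT => /negP h; apply: hno; exists i.
have hsub j : j \in S -> j \in S' by move/fintype.subsetP: sub; exact.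
pose c (j : 'I_n) : 'I_3 := if j \in S then inord 0 else if j \in S' then inord 1 else inord 2.
exists (basis_splitting S), (basis_splitting S'); split.
- by move/representsE: hu => ->; exact: conj_class_refl.
- by move/representsE: hv => ->; exact: conj_class_refl.
exists (block c); split.
- apply: basis_factorization => i.
  have : i = inord 0 \/ i = inord 1 \/ i = inord 2 :> 'I_3.
    case: i => [[|[|[|?]]] hi] //; [left|right; left|right; right];
    by apply: val_inj; rewrite /= inordK.
  move=> [|[|]] ->.
  + by exists j0; rewrite /c hj0.
  + by exists j1; rewrite /c (negPf h1') h1.
  exists j2; rewrite /c (negPf h2) ifN //; apply: contra h2; exact: hsub.
- apply: (@basis_splitting_refined _ _ [set inord 0]%SET) => j; rewrite finset.in_set1 /c.
  by case: (j \in S); [rewrite eqxx|case: (j \in S'); rewrite -val_eqE /= !inordK].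
apply: (@basis_splitting_refined _ _ [set inord 0; inord 1]%SET) => j.
rewrite !inE /c; case hj : (j \in S); first by rewrite (hsub j hj) eqxx.
by case: (j \in S'); rewrite -!val_eqE /= !inordK.
Qed.

(** The homomorphism to Z/2 with values [h] on the basis. *)
Definition parity (h : pred 'I_n) (g : F) : bool := odd (count (fun l => h l.1) (rw g)).

Lemma parityM h g g' : parity h (g * g') = parity h g (+) parity h g'.
Proof.
rewrite /parity; have [u [c [v [-> -> -> _]]]] := rwM_cancel hx g g'.
have e : count (fun l => h l.1) (winv c) = count (fun l => h l.1) c.
  by rewrite /winv count_rev count_map.
by rewrite !count_cat !oddD e; case: (odd _); case: (odd _); case: (odd _).
Qed.

Lemma parity1 h : parity h 1 = false.
Proof. by rewrite /parity rw1. Qed.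

Lemma parityV h g : parity h g^-1 = parity h g.
Proof.
have := parityM h g g^-1; rewrite mulgV parity1.
by case: (parity h g); case: (parity h g^-1).
Qed.

Lemma parityJ h g c : parity h (g ^ c) = parity h g.
Proof. by rewrite conjgE !parityM parityV; case: parity; case: parity. Qed.

Lemma parity_basis h i : parity h (tnth x i) = h i.
Proof. by rewrite /parity (rw_letter hx (i, true)) /= addn0; case: (h i). Qed.

Lemma parity_bspan (S : pred 'I_n) j g : bspan hx S g -> ~~ S j -> parity (pred1 j) g = false.
Proof.
rewrite /bspan /= /parity => hg hj.
have -> // : count (fun l => pred1 j l.1) (rw g) = 0.
apply/eqP; rewrite -leqn0 leqNgt -has_count; apply/hasPn => l hl /=.
by apply: contraNneq hj => <-; exact: (allP hg).
Qed.

(** Parities are invariant under conjugation and detect which basis elements generate a factor. *)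
Lemma represents_inj S S' v : represents x S v -> represents x S' v ->
  S' = S \/ S' = (~: S)%SET.
Proof.
move=> /representsE e /representsE e'.
have : val v (basis_splitting S') by rewrite e'; exact: conj_class_refl.
rewrite e => -[g _ eg].
have : conj_factors (basis_splitting S) g (bspan hx (fun j => j \in S')) by rewrite eg; left.
have key (U U' : pred 'I_n) : [set y ^ g | y in bspan hx U] = bspan hx U' -> U =1 U'.
  move=> h j; apply/idP/idP => hj.
    have : bspan hx U' (tnth x j ^ g) by rewrite -h; exists (tnth x j) => //; apply/bspan_basis.
    move=> hb; apply: contrapT => /negP nj; have := parity_bspan hb nj.
    by rewrite parityJ parity_basis /= eqxx.
  have : bspan hx U' (tnth x j) by apply/bspan_basis.
  rewrite -h => -[y hy ey]; apply: contrapT => /negP nj; have := parity_bspan hy nj.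
  by rewrite -(parityJ (pred1 j) y g) ey parity_basis /= eqxx.
move=> [A [->|->] /key h]; [left|right]; apply/setP => j; rewrite ?finset.in_setC.
  by rewrite -(h j).
by rewrite -(h j).
Qed.

End BasisPartition.

(** * Walks of bounded length *)

Section Reach.
Variables (V : Type) (adj : V -> V -> Prop).
Hypothesis adj_sym : forall u v, adj u v -> adj v u.

Definition walk k u v : Prop := exists w : nat -> V,
  [/\ w 0%N = u, w k = v & forall i, (i < k)%N -> adj (w i) (w i.+1)].

Lemma walk_trans j k u v w : walk j u v -> walk k v w -> walk (j + k) u w.
Proof.
move=> [p [p0 pj hp]] [q [q0 qk hq]].
exists (fun i => if i <= j then p i else q (i - j)%N); split => //.
  case: leqP => h; last by rewrite addKn.
  have k0 : k = 0 by lia.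
  by move: qk h; rewrite k0 addn0 q0 pj.
move=> i hi; have [h|h] := leqP i.+1 j.
  by rewrite (ltnW h); exact: hp.
have [h'|h'] := leqP i j.
  have -> : i = j by lia.
  by rewrite pj -q0 subSnn; apply: hq; lia.
by rewrite subSn; [apply: hq; lia|lia].
Qed.

Lemma walk_sym k u v : walk k u v -> walk k v u.
Proof.
move=> [p [p0 pk hp]]; exists (fun i => p (k - i)); split.
- by rewrite subn0.
- by rewrite subnn.
move=> i hi; apply: adj_sym; have := hp (k - i.+1)%N.
have -> : (k - i.+1).+1 = (k - i)%N by lia.
by apply; lia.
Qed.

Lemma walk1 u v : adj u v -> walk 1 u v.
Proof. by move=> h; exists (fun i => if i is 0 then u else v); split => // -[]. Qed.

Lemma walk0 u : walk 0 u u.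
Proof. by exists (fun=> u). Qed.

Definition reach N u v := exists2 k, k <= N & walk k u v.

Lemma reach_trans M N u v w : reach M u v -> reach N v w -> reach (M + N) u w.
Proof.
by move=> [j hj h] [k hk h']; exists (j + k); [exact: leq_add|exact: walk_trans h h'].
Qed.

Lemma reach_sym N u v : reach N u v -> reach N v u.
Proof. by move=> [k hk /walk_sym h]; exists k. Qed.

Lemma reach0 u : reach 0 u u.
Proof. by exists 0 => //; exact: walk0. Qed.

Lemma reach_le M N u v : M <= N -> reach M u v -> reach N u v.
Proof. by move=> h [k hk hw]; exists k => //; exact: leq_trans hk h. Qed.

Lemma reach1 u v : u = v \/ adj u v -> reach 1 u v.
Proof.
by case=> [->|h]; [apply: reach_le (reach0 v)|exists 1%N => //; exact: walk1].
Qed.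

End Reach.

(** * The upper bound *)

(** The path goes through the intersection of the two subsets; if it is empty, [S] is contained in
    the complement of [S'], which represents the same vertex as [S']. *)
Lemma represents_reach (F : groupType) (n : nat) (x : n.-tuple F) (hx : free_basis x)
    (S S' : {set 'I_n}) u v :
  S != finset.set0 -> S != [set: 'I_n]%SET -> S' != finset.set0 -> S' != [set: 'I_n]%SET ->
  represents x S u -> represents x S' v -> reach (@ES_adj F) 2 u v.
Proof.
move=> hS0 hS1 hS0' hS1' hu hv.
have sym := @ES_adj_sym F.
have [h0|h0] := eqVneq (S :&: S')%SET finset.set0.
  have sub : S \subset (~: S')%SET by rewrite -finset.disjoints_subset -finset.setI_eq0 h0.
  have hv' := represents_compl hx hv.
  have hC : (~: S')%SET != [set: 'I_n]%SET.
    by apply: contra_neq hS0' => h; rewrite -[S']finset.setCK h finset.setCT.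
  by apply: (@reach_le _ _ 1) => //; apply: reach1; exact: (represents_nested hx hS0 hC sub hu hv').
have hI1 : (S :&: S')%SET != [set: 'I_n]%SET.
  apply: contra_neq hS1 => h; apply/eqP; rewrite finset.eqEsubset finset.subsetT -h.
  exact: finset.subsetIl.
have [w hw] := represents_exists hx h0 hI1.
apply: (@reach_trans _ _ 1 1 _ w).
  apply: (reach_sym sym); apply: reach1.
  exact: (represents_nested hx h0 hS1 (finset.subsetIl _ _) hw hu).
apply: reach1; exact: (represents_nested hx h0 hS1' (finset.subsetIr _ _) hw hv).
Qed.

(** [theta] carries a word in [y] to the same word in [a], where a reduced word is determined by its
    value. *)
Lemma free_basis_criterion (F : groupType) n (a y : n.-tuple F) (ha : free_basis a)
    (theta : F -> F) : {morph theta : g h / g * h} ->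
  (forall i, theta (tnth y i) = tnth a i) -> (forall g, exists w, word_eval y w = g) ->
  free_basis y.
Proof.
move=> hM hy hgen g.
have h1 : theta 1 = 1.
  by have := hM 1 1; rewrite mulg1 => /(congr1 (fun h => (theta 1)^-1 * h)); rewrite mulKg mulVg.
have hV h : theta h^-1 = (theta h)^-1.
  by have := hM h h^-1; rewrite mulgV h1 => /esym /mulg1_eq ->.
have hE w : theta (word_eval y w) = word_eval a w.
  elim: w => [|l w IH]; first by rewrite !word_eval_nil.
  by rewrite !word_eval_cons hM IH /letter; case: l.2; rewrite ?hV hy.
have [w hw] := hgen g; exists (wred w); split.
  by split; [rewrite reducedE wred_red|rewrite word_eval_wred].
move=> w' []; rewrite reducedE => hr' hw'.
by rewrite -(rw_eval ha hr') -hE hw' -hw hE rw_word.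
Qed.

Section ExpInt.
Variable F : groupType.

Lemma expgz_diff (x : F) (i j : nat) : expgz x (Posz i - Posz j)%R = x ^+ i * x ^- j.
Proof.
have [h|h] := leqP j i.
  have -> : (Posz i - Posz j)%R = Posz (i - j)%N by lia.
  by rewrite /= expgnFr.
have -> : (Posz i - Posz j)%R = Negz (j - i).-1 by lia.
rewrite /expgz; have -> : (j - i).-1.+1 = (j - i)%N by lia.
by rewrite expgnFr ?invgF // ltnW.
Qed.

Lemma expgzB (x : F) (k k' : int) : expgz x (k - k')%R = expgz x k * (expgz x k')^-1.
Proof.
have [i [j ->]] : exists i j, k = (Posz i - Posz j)%R.
  by case: k => k; [exists k, 0|exists 0, k.+1]; lia.
have [i' [j' ->]] : exists i j, k' = (Posz i - Posz j)%R.
  by case: k' => k'; [exists k', 0|exists 0, k'.+1]; lia.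
have -> : (Posz i - Posz j - (Posz i' - Posz j') = Posz (i + j')%N - Posz (i' + j)%N)%R by lia.
rewrite !expgz_diff invgM invgK expgnDr expgnDr !invgM.
have c m m' : commute (x ^- m) (x ^+ m').
  by apply: commute_sym; apply: commuteV; apply: commuteX2; exact: commute_refl.
have c' : commute (x ^- j) (x ^- i').
  by apply: commuteV; exact: c.
by rewrite -!mulgA (mulgA (x ^- j) (x ^+ j')) (c j j') -!mulgA.
Qed.

End ExpInt.

Section UpperBound.
Variables (F : groupType) (n : nat) (a : n.-tuple F).
Hypothesis ha : free_basis a.
Hypothesis hn : (2 < n)%N.
Variable z : 'I_n.
Local Notation B := (bfac ha z).
Local Notation t := (tl a z true).
Let hB := bfac_subgroup ha z.
Let hB1 : B 1 := subgroup1 hB.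
Local Notation reach := (reach (@ES_adj F)).
Let sym := @ES_adj_sym F.

Definition twisted u v : n.-tuple F :=
  [tuple if i == z then u * t * v else tnth a i | i < n].

Lemma twistedE u v i : tnth (twisted u v) i = if i == z then u * t * v else tnth a i.
Proof. by rewrite tnth_mktuple. Qed.

Lemma twisted_eval u v w : all (zfree z) w -> word_eval (twisted u v) w = word_eval a w.
Proof.
elim: w => [|l w IH] /=; first by rewrite !word_eval_nil.
by move=> /andP[/negPf h /IH e]; rewrite !word_eval_cons e /letter !twistedE h.
Qed.

Lemma twisted_free u v : B u -> B v -> free_basis (twisted u v).
Proof.
move=> hu hv; pose theta := bhom ha (twisted u^-1 v^-1).
have thB b : B b -> theta b = b by move=> hb; rewrite /theta /bhom twisted_eval // rwK.
apply: (@free_basis_criterion _ _ a _ ha theta).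
- exact: bhomM.
- move=> i; rewrite twistedE; case: eqP => [->|/eqP ne].
    have thM : {morph theta : g h / g * h} by exact: bhomM.
    have tht : theta t = u^-1 * t * v^-1.
      by rewrite /theta [LHS](bhom_basis ha) twistedE eqxx.
    by rewrite !thM tht (thB u) // (thB v) //; gsimp.
  by rewrite thB //; exact: bfac_basis.
pose S g := exists w, word_eval (twisted u v) w = g.
have SM g h : S g -> S h -> S (g * h).
  by move=> [w <-] [w' <-]; exists (w ++ w'); rewrite word_eval_cat.
have SV g : S g -> S g^-1.
  by move=> [w <-]; exists (winv w); rewrite word_eval_winv.
have SB b : B b -> S b.
  by move=> hb; exists (rw ha b); rewrite twisted_eval ?rwK.
have St : S t.
  have -> : t = u^-1 * (u * t * v) * v^-1 by gsimp.
  apply: (SM _ _); last exact/SV/SB.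
  apply: (SM _ _); first exact/SV/SB.
  by exists [:: (z, true)]; rewrite word_eval1 /letter /= twistedE eqxx.
move=> g; rewrite -/(S g) -(rwK ha g); elim: (rw ha g) => [|l w IH].
  by rewrite word_eval_nil; exact: SB.
rewrite word_eval_cons; apply: (SM _ _) => //.
have [e|ne] := eqVneq l.1 z; last by apply: SB; apply/bspan_letter.
have -> : letter a l = tl a z l.2 by rewrite /tl -e -surjective_pairing.
by case: l.2 => //; rewrite (tlV a z true); exact: SV.
Qed.

Lemma set1_proper : [set z]%SET != [set: 'I_n]%SET.
Proof.
by apply/eqP => /(congr1 (fun S : {set 'I_n} => #|S|)); rewrite finset.cards1 finset.cardsT card_ord; lia.
Qed.

Lemma set1_nonempty : [set z]%SET != finset.set0.
Proof. by apply/finset.set0Pn; exists z; rewrite finset.in_set1. Qed.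

(** Conjugation by [u] turns [u * t * v] into [t * (v * u)] and preserves [B]. The twisting word can
    therefore be cut anywhere, and an insertion in its middle becomes one at the end of
    [u * t * v]. *)
Lemma represents_hnn u v p : B u -> B v -> represents (twisted u v) [set z]%SET p <->
  val p = conj_class (hnn_splitting ha z (v * u)).
Proof.
move=> hu hv.
have e1 : [set tnth (twisted u v) j | j in [set j | j \in [set z]%SET]] = [set u * t * v].
  apply/seteqP; split=> [_ [j /= hj <-]|y /= ->].
    by move: hj; rewrite finset.in_set1 twistedE => ->.
  by exists z; rewrite /= ?finset.in_set1 ?twistedE ?eqxx.
have e2 : [set tnth (twisted u v) j | j in [set j | j \notin [set z]%SET]] =
    [set tnth a j | j in [set j | predC1 z j]].
  apply/seteqP; split=> _ [j /= hj <-]; exists j => /=.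
  - by move: hj; rewrite finset.in_set1.
  - by move: hj; rewrite finset.in_set1 twistedE => /negPf ->.
  - by rewrite finset.in_set1.
  by rewrite twistedE (negPf hj).
have e : conj_factors [set generated [set u * t * v]; B] u = hnn_splitting ha z (v * u).
  have h1 : [set x ^ u | x in generated [set u * t * v]] = generated [set t * (v * u)].
    rewrite -generated_cj; congr generated; apply/seteqP; split=> [_ [y /= -> <-]|y /= ->].
      by rewrite /= conjgE; gsimp.
    by exists (u * t * v) => //; rewrite conjgE; gsimp.
  have h2 : [set x ^ u | x in B] = B.
    apply/seteqP; split=> [_ [b hb <-]|b hb].
      rewrite conjgE; apply: (subgroupM hB); first exact: (subgroupV hB).
      exact: (subgroupM hB).
    exists (b ^ u^-1); last by rewrite conjgKV.
    rewrite conjgE invgK; apply: (subgroupM hB) => //.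
    by apply: (subgroupM hB) => //; exact: (subgroupV hB).
  apply/seteqP; split=> [_ [A [->|->] <-]|A [->|->]].
  - by left; rewrite h1.
  - by right; rewrite h2.
  - by exists (generated [set u * t * v]); [left|rewrite h1].
  by exists B; [right|rewrite h2].
rewrite /represents e1 e2 generated_bspan -/(bfac ha z) -e conj_classM.
by split=> [[]//|h]; split=> //; exact: twisted_free.
Qed.

(** As [S] contains both [i] and [z], the factor generated by [S] is the same for the two bases. *)
Lemma represents_absorb u v c i (S : {set 'I_n}) p : B u -> B v ->
  i != z -> i \in S -> z \in S -> generated [set tnth a i] c ->
  represents (twisted u v) S p -> represents (twisted u (v * c)) S p.
Proof.
move=> hu hv hi hiS hzS hc.
have hBc d : generated [set tnth a i] d -> B d.
  by apply: generated_min => // _ ->; exact: bfac_basis.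
have sub v' d : generated [set tnth a i] d ->
    generated [set tnth (twisted u (v' * d)) j | j in [set j | j \in S]] `<=`
    generated [set tnth (twisted u v') j | j in [set j | j \in S]].
  move=> hd; apply: generated_min; first exact: generated_subgroup.
  have hs := generated_subgroup [set tnth (twisted u v') j | j in [set j | j \in S]].
  move=> _ [j /= hj <-]; rewrite twistedE; case: eqP => [e|/eqP ne]; last first.
    by apply: sub_generated; exists j => //; rewrite twistedE (negPf ne).
  rewrite mulgA; apply: (subgroupM hs).
    by apply: sub_generated; exists z => //; rewrite twistedE eqxx.
  move: hd; apply: generated_min => // _ ->.
  by apply: sub_generated; exists i => //; rewrite twistedE (negPf hi).
have e1 : generated [set tnth (twisted u v) j | j in [set j | j \in S]] =
    generated [set tnth (twisted u (v * c)) j | j in [set j | j \in S]].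
  apply/seteqP; split; last exact: sub.
  by rewrite -{1}(mulgK c v); apply: sub; exact: (subgroupV (generated_subgroup _)).
have e2 : [set tnth (twisted u v) j | j in [set j | j \notin S]] =
    [set tnth (twisted u (v * c)) j | j in [set j | j \notin S]].
  have ne j : j \notin S -> (j == z) = false by move=> h; apply: contraNF h => /eqP ->.
  by apply/seteqP; split=> _ [j /= hj <-]; exists j => //; rewrite !twistedE ne.
rewrite /represents e1 e2 => -[_ h]; split => //.
by apply: twisted_free => //; apply: (subgroupM hB) => //; exact: hBc.
Qed.

Lemma hnn_vertex w : B w -> exists p : ES_vertex F, val p = conj_class (hnn_splitting ha z w).
Proof.
move=> hw; have [p hp] := represents_exists (twisted_free hB1 hw) set1_nonempty set1_proper.
by exists p; move: hp => /(represents_hnn _ hB1 hw); rewrite mulg1.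
Qed.

(** The place of insertion is arbitrary because the exponents to be changed stand in the middle of
    the twisting word. *)
Definition insertable N c : Prop := B c /\ forall u v p q, B u -> B v ->
  val p = conj_class (hnn_splitting ha z (v * u)) ->
  val q = conj_class (hnn_splitting ha z (v * c * u)) -> reach N p q.

Lemma insertable1 : insertable 0 1.
Proof.
split=> // u v p q hu hv ep; rewrite mulg1 -ep => /val_inj ->.
exact: reach0.
Qed.

Lemma insertableM M N c d : insertable M c -> insertable N d -> insertable (M + N) (c * d).
Proof.
move=> [hc h] [hd h']; split; first exact: (subgroupM hB).
move=> u v p q hu hv ep eq.
have [r er] := hnn_vertex (subgroupM hB (subgroupM hB hv hc) hu).
apply: (reach_trans (v := r)); first exact: (h u v).
by apply: (h' u (v * c)) => //; [exact: (subgroupM hB)|rewrite eq !mulgA].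
Qed.

Lemma insertableV N c : insertable N c -> insertable N c^-1.
Proof.
move=> [hc h]; split; first exact: (subgroupV hB).
move=> u v p q hu hv ep eq; apply: (reach_sym sym).
apply: (h u (v * c^-1)) => //; last by rewrite ep mulgVK.
by apply: (subgroupM hB) => //; exact: (subgroupV hB).
Qed.

(** The vertex of the subset formed by [i] and [z], proper because [n > 2], is not affected by the
    insertion, and it is equal or adjacent to the vertex of [z] alone both before and after. *)
Lemma insertable_syllable i c : i != z -> generated [set tnth a i] c -> insertable 2 c.
Proof.
move=> hi hc.
have hBc : B c by move: hc; apply: generated_min => // _ ->; exact: bfac_basis.
split=> // u v p q hu hv ep eq.
have hvc : B (v * c) by exact: (subgroupM hB).
pose S := [set i; z]%SET.
have hS0 : S != finset.set0 by apply/finset.set0Pn; exists z; rewrite !inE eqxx orbT.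
have hS1 : S != [set: 'I_n]%SET.
  apply/eqP => /(congr1 (fun S : {set 'I_n} => #|S|)).
  by rewrite finset.cards2 finset.cardsT card_ord hi; lia.
have hsub : [set z]%SET \subset S by rewrite finset.sub1set !inE eqxx orbT.
have [r hr] := represents_exists (twisted_free hu hv) hS0 hS1.
have hr' : represents (twisted u (v * c)) S r.
  by apply: (represents_absorb hu hv hi _ _ hc hr); rewrite !inE eqxx ?orbT.
apply: (@reach_trans _ _ 1 1 _ r).
  apply: reach1; apply: (represents_nested (twisted_free hu hv) set1_nonempty hS1 hsub) => //.
  by apply/represents_hnn.
apply: (reach_sym sym); apply: reach1.
apply: (represents_nested (twisted_free hu hvc) set1_nonempty hS1 hsub) => //.
by apply/represents_hnn.
Qed.

Hypothesis hz : nat_of_ord z = n.-1.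

(** The word has [n + 2] syllables, each of cost 2 whatever its exponent. *)
Lemma insertable_pword s : insertable (2 * (n + 2)) (pword a s).
Proof.
have -> : (n + 2)%N = size (pidx n) by rewrite /pidx size_cat size_iota /=; lia.
rewrite /pword -/(pidx n); have : all (fun i => i < n.-1) (pidx n).
  by apply/allP => i /(pidx_lt hn hz).
elim: (pidx n) => [_|i r IH /andP[hi /IH h]]; first by rewrite big_nil [size _]/= muln0; exact: insertable1.
rewrite big_cons [size _]/= mulnS; apply: insertableM => //.
apply: (@insertable_syllable (oidx z i)).
  by apply/eqP => /(congr1 val) /=; rewrite oidxE; lia.
have -> : nth 1 a i = tnth a (oidx z i) by rewrite (tnth_nth 1) oidxE; last lia.
have hs := generated_subgroup [set tnth a (oidx z i)].
elim: s.+1 => [|k IHk]; first exact: subgroup1 hs.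
by rewrite expgS; apply: (subgroupM hs) => //; exact: sub_generated.
Qed.

Lemma insertable_pwordX s (k : int) : insertable (2 * (n + 2) * `|k|%N) (expgz (pword a s) k).
Proof.
have h j : insertable (2 * (n + 2) * j) (pword a s ^+ j).
  elim: j => [|j IH]; first by rewrite muln0; exact: insertable1.
  by rewrite mulnS expgS; apply: insertableM => //; exact: insertable_pword.
by case: k => j; rewrite /expgz; [exact: h|apply: insertableV; exact: (h j.+1)].
Qed.

Lemma twist_reach m (k k' : 'rV[int]_m) p q :
  val p = conj_class (hnn_splitting ha z (twist a k)) ->
  val q = conj_class (hnn_splitting ha z (twist a k')) ->
  reach (2 * (n + 2) * \sum_(i < m) `|k 0%R i - k' 0%R i|%N) p q.
Proof.
rewrite /twist; set c := (2 * (n + 2))%N.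
have hE j (i : int) : B (expgz (pword a j) i) by case: (insertable_pwordX j i).
(* [A] is the part that already carries the new exponents. The next exponent is changed by inserting
   the power given by the difference. *)
have key : forall (r : seq 'I_m) A p q, B A ->
    val p = conj_class (hnn_splitting ha z (A * \prod_(j <- r) expgz (pword a j.+1) (k 0%R j))) ->
    val q = conj_class (hnn_splitting ha z (A * \prod_(j <- r) expgz (pword a j.+1) (k' 0%R j))) ->
    reach (c * (\sum_(i <- r) `|k 0%R i - k' 0%R i|)%N) p q.
  elim=> [|j r IH] A {}p {}q hA.
    by rewrite !big_nil => <- /val_inj ->; exact: reach_le (reach0 _ _).
  rewrite !big_cons => ep eq.
  set u := expgz (pword a j.+1) (k 0%R j); set u' := expgz (pword a j.+1) (k' 0%R j).
  pose rest := \prod_(j <- r) expgz (pword a j.+1) (k 0%R j).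
  have hrest : B rest.
    by rewrite /rest; elim/big_ind: _ => [//|x y hx hy|i _]; [exact: (subgroupM hB)|exact: hE].
  have hAu' : B (A * u') by apply: (subgroupM hB) => //; exact: hE.
  have [s es] := hnn_vertex (subgroupM hB hAu' hrest).
  rewrite mulnDr; apply: (reach_trans (v := s)); last first.
    by apply: (IH (A * u')) => //; rewrite eq mulgA.
  have [_ hins] := insertable_pwordX j.+1 (k' 0%R j - k 0%R j)%R.
  have -> : `|k 0%R j - k' 0%R j|%N = `|(k' 0%R j - k 0%R j)%R|%N by lia.
  apply: (hins (u * rest) A) => //.
  - by apply: (subgroupM hB) => //; exact: hE.
  by rewrite es expgzB -/u -/u'; congr (conj_class (hnn_splitting _ _ _)); gsimp.
move=> ep eq; apply: (key _ 1) => //; by rewrite mul1g.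
Qed.

End UpperBound.

(** * The quasiflat in the graph *)

Section Quasiflat.
Variables (F : groupType) (n : nat) (a : n.-tuple F).
Hypothesis ha : free_basis a.
Hypothesis hn : (2 < n)%N.
Variable z : 'I_n.
Hypothesis hz : nat_of_ord z = n.-1.
Variable m : nat.
Local Notation B := (bfac ha z).
Implicit Types k : 'rV[int]_m.

Definition l1_nat k k' : nat := (\sum_(i < m) `|k 0%R i - k' 0%R i|)%N.

Lemma twisted_basisE k : twisted_basis a k = twisted a z 1 (twist a k).
Proof.
apply: eq_from_tnth => i; rewrite /twisted_basis tnth_mktuple twistedE -val_eqE /= hz.
by case: eqP => // e; rewrite mul1g; congr (tnth a _ * _); apply: val_inj; rewrite /= hz.
Qed.

Lemma twisted_basis_free k : free_basis (twisted_basis a k).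
Proof.
have h1 : B 1 := subgroup1 (bfac_subgroup ha z).
have h2 : B (twist a k) := twist_bfac hn hz ha k.
by rewrite twisted_basisE; exact: (twisted_free h1 h2).
Qed.

Lemma walk_twist_bound k k' p q N :
  val p = conj_class (hnn_splitting ha z (twist a k)) ->
  val q = conj_class (hnn_splitting ha z (twist a k')) ->
  walk (@ES_adj F) N.+1 p q ->
  forall i : 'I_m, `|k 0%R i - k' 0%R i|%N <=
    (12 + 6 * size (pw z i.+1)) * N.+1 + 6 * size (pw z i.+1) * m.
Proof.
move=> ep eq [w [w0 wN hw]] i.
apply: leq_trans (brooks_twist hn hz ha k k' i) _; rewrite leq_add2r.
have hn1 : 1 < n by exact: ltnW.
apply: (path_lower_bound hn1 (h := brooks ha (pw z i.+1)) _ _ _ ep eq w0 wN hw).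
- move=> H hH l beta beta' hl hb hb' hc hc'.
  exact: (brooks_compat_close hn1 (pw_full hn hz (ltn0Sn i)) hH hl hb hb' hc hc').
- exact: (twist_bfac hn hz).
exact: (twist_bfac hn hz).
Qed.

Variable S : {set 'I_n}.
Hypothesis S0 : S != finset.set0.
Hypothesis S1 : S != [set: 'I_n]%SET.

(** The neighbour [r] allows a detour at [q], because the lower bound is stated for nonempty
    walks. *)
Lemma twist_vertices k p : represents (twisted_basis a k) S p ->
  exists q r, [/\ val q = conj_class (hnn_splitting ha z (twist a k)),
    reach (@ES_adj F) 2 p q & ES_adj q r].
Proof.
move=> hp; have hb := twisted_basis_free k.
have [q hq] := represents_exists hb (set1_nonempty z) (set1_proper hn z).
pose i : 'I_n := oidx z 0.
have iz : i != z by rewrite -val_eqE /= oidxE; lia.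
have S2 : [set i; z]%SET != [set: 'I_n]%SET.
  apply/eqP => /(congr1 (fun S : {set 'I_n} => #|S|)).
  by rewrite finset.cards2 finset.cardsT card_ord iz; lia.
have S20 : [set i; z]%SET != finset.set0 by apply/finset.set0Pn; exists z; rewrite !inE eqxx orbT.
have [r hr] := represents_exists hb S20 S2.
have hsub : [set z]%SET \subset [set i; z]%SET by rewrite finset.sub1set !inE eqxx orbT.
exists q, r; split.
- have h1 : B 1 := subgroup1 (bfac_subgroup ha z).
  have h2 : B (twist a k) := twist_bfac hn hz ha k.
  by move: hq; rewrite twisted_basisE => /(represents_hnn _ h1 h2); rewrite mulg1.
- exact: (represents_reach hb S0 S1 (set1_nonempty z) (set1_proper hn z) hp hq).
have [e|//] := represents_nested hb (set1_nonempty z) S2 hsub hq hr.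
rewrite -e in hr; have [e2|e2] := represents_inj hb hq hr.
  have : i \in [set z]%SET by rewrite -e2 !inE eqxx.
  by rewrite finset.in_set1 (negPf iz).
have : z \in (~: [set z])%SET by rewrite -e2 !inE eqxx orbT.
by rewrite finset.in_setC finset.in_set1 eqxx.
Qed.

Lemma quasiflat : exists L C, forall k k' p q,
  represents (twisted_basis a k) S p -> represents (twisted_basis a k') S q ->
  (forall N, walk (@ES_adj F) N p q -> l1_nat k k' <= L * (N + C)) /\
  reach (@ES_adj F) (L * l1_nat k k' + C) p q.
Proof.
have sym := @ES_adj_sym F.
pose M := (\sum_(i < m) (12 + 6 * size (pw z i.+1)))%N.
(* The factor [m.+1] absorbs the additive error of [brooks_twist], and [2 * (n + 2)] is the
   Lipschitz constant of the upper bound. The 7 covers a passage of length 2 at each end and the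
   detour of length 2. *)
exists (M * m.+1 + 2 * (n + 2))%N, 7 => k k' p q hp hq.
have [p' [r [ep' rp rr]]] := twist_vertices hp.
have [q' [_ [eq' rq _]]] := twist_vertices hq.
split=> [N hw|].
  have [e he he'] : reach (@ES_adj F) (2 + (N + 2)) p' q'.
    apply: reach_trans (reach_sym sym rp) _; apply: reach_trans rq.
    by exists N.
  have hwe : walk (@ES_adj F) (e.+1).+1 p' q'.
    have h2 : walk (@ES_adj F) (1 + 1) p' p'.
      by apply: walk_trans (walk1 rr) (walk1 (sym _ _ rr)).
    exact: walk_trans h2 he'.
  have hb := walk_twist_bound ep' eq' hwe.
  apply: (@leq_trans (\sum_(i < m) ((12 + 6 * size (pw z i.+1)) * (e.+2 + m)))%N).
    apply: leq_sum => i _; apply: leq_trans (hb i) _.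
    rewrite mulnDr leq_add2l leq_mul2r; apply/orP; right; exact: leq_addl.
  rewrite -big_distrl /= -/M.
  apply: (@leq_trans (M * (m.+1 * (N + 7)))%N).
    by rewrite leq_mul2l; apply/orP; right; nia.
  by rewrite mulnA leq_mul2r leq_addr orbT.
have h := twist_reach hn hz ep' eq'.
apply: reach_le (reach_trans rp (reach_trans h (reach_sym sym rq))).
rewrite -/(l1_nat k k'); nia.
Qed.

End Quasiflat.

(** * Bounded cliques *)

Section SubgroupParity.
Variables (F : groupType) (n : nat) (a : n.-tuple F).
Hypothesis ha : free_basis a.
Local Notation rw := (rw ha).

Section Crossings.
Variables (Y : set F) (l : 'I_n * bool).
Hypothesis hY : subgroup Y.

Definition edge_in_orbit u l0 : bool :=
  (l0 == l) && `[< Y u >] || (l0 == linv l) && `[< Y (u * letter a l0) >].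

(* Parity of the number of times the path labelled [w] from [u] crosses the
   [Y]-orbit of the edge from [1] to [l]. *)
Fixpoint crossing u w : bool :=
  if w is l0 :: w' then edge_in_orbit u l0 (+) crossing (u * letter a l0) w' else false.

Lemma edge_in_orbit_linv u l0 : edge_in_orbit (u * letter a l0) (linv l0) = edge_in_orbit u l0.
Proof.
rewrite /edge_in_orbit letter_linv mulgK (inj_eq (can_inj (@linvK n))).
by rewrite -{1}[l](linvK l) (inj_eq (can_inj (@linvK n))) orbC.
Qed.

Lemma crossing_wred u w : crossing u (wred w) = crossing u w.
Proof.
elim: w u => [|l0 w IH] u //=; rewrite -IH.
case: (wred w) => [|l1 w1] //=; case: eqP => [->|//].
by rewrite edge_in_orbit_linv letter_linv mulgK addbA addbb.
Qed.

Lemma crossing_cat u w w' :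
  crossing u (w ++ w') = crossing u w (+) crossing (u * word_eval a w) w'.
Proof.
elim: w u => [|l0 w IH] u /=; first by rewrite word_eval_nil mulg1.
by rewrite IH addbA word_eval_cons mulgA.
Qed.

Lemma crossing_mull y u w : Y y -> crossing (y * u) w = crossing u w.
Proof.
move=> hy; have e v : `[< Y (y * v) >] = `[< Y v >].
  apply/asboolP/asboolP => h; last exact: (subgroupM hY).
  by rewrite -[v](mulKg y); apply: (subgroupM hY) => //; exact: (subgroupV hY).
elim: w u => [|l0 w IH] u //=.
by rewrite /edge_in_orbit -!(mulgA y) !e IH.
Qed.

Lemma crossingM y g : Y y ->
  crossing 1 (rw (y * g)) = crossing 1 (rw y) (+) crossing 1 (rw g).
Proof.
move=> hy; rewrite rwM crossing_wred crossing_cat rwK mul1g.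
by congr (_ (+) _); rewrite -(crossing_mull 1 _ hy) mulg1.
Qed.

End Crossings.

(* An element [g] of minimal length among the conjugates of [Y] traces a simple
   closed path in the quotient of the Cayley tree, so that it crosses once the orbit
   of its first edge. *)
Lemma subgroup_parity (Y : set F) : subgroup Y -> Y <> [set 1] ->
  exists chi : F -> bool, (forall y g, Y y -> chi (y * g) = chi y (+) chi g) /\
    exists2 y, Y y & chi y.
Proof.
move=> hY hne.
have [y0 hy0 ny0] : exists2 y, Y y & y <> 1.
  apply: contrapT => hno; apply: hne; apply/seteqP; split=> y /= hy.
    by apply: contrapT => nx; apply: hno; exists y.
  by rewrite hy; exact: subgroup1 hY.
pose P m := `[< exists y c, [/\ Y y, y <> 1 & size (rw (y ^ c)) = m] >].
have hP : exists m, P m by exists (size (rw (y0 ^ 1))); apply/asboolP; exists y0, 1.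
have [m /asboolP[y [c [hy ny em]]] hmin] := ex_minnP hP.
pose Y' := [set v ^ c | v in Y].
have hY' : subgroup Y' by exact: subgroup_cj.
have hmin' v d : Y' v -> v <> 1 -> m <= size (rw (v ^ d)).
  move=> [v0 hv0 <-] nv; apply: hmin; apply/asboolP; exists v0, (c * d); split => //.
    by move=> e; apply: nv; rewrite e conj1g.
  by rewrite conjgM.
pose g := y ^ c.
have hg : Y' g by exists y.
have ng : g <> 1 by move/eqP; rewrite conjg_eq1 => /eqP.
have hr := rw_red ha g.
case eg : (rw g) => [|l w]; first by case: ng; rewrite -(rwK ha g) eg word_eval_nil.
exists (fun h => crossing Y' l 1 (rw (h ^ c))); split.
  by move=> y1 h hy1; rewrite conjMg (crossingM _ hY') //; exists y1.
exists y => //; rewrite -/g eg /= mul1g {1}/edge_in_orbit eqxx /=.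
have -> : `[< Y' 1 >] by apply/asboolP; exact: subgroup1 hY'.
rewrite orTb; have em' : size (l :: w) = m by rewrite -eg em.
have noY u v : rw g = u ++ v -> u != [::] -> v != [::] -> ~ Y' (word_eval a u).
  move=> e un vn h; have hru : red u by move: hr; rewrite e => /red_catl.
  have nu : word_eval a u <> 1.
    by move/(congr1 rw); rewrite rw_eval // rw1; apply/eqP.
  have := hmin' _ 1 h nu; rewrite conjg1 rw_eval // -em e size_cat leqNgt => /negP; apply.
  by rewrite -{1}[size u]addn0 ltn_add2l lt0n size_eq0.
suff key v u : u != [::] -> rw g = u ++ v -> crossing Y' l (word_eval a u) v = false.
  by have := key w [:: l] isT eg; rewrite word_eval1 => ->.
elim: v u => [|l0 v IH] u un e //=.
have -> : edge_in_orbit Y' l (word_eval a u) l0 = false.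
  apply/negP => /orP[/andP[_ /asboolP h]|/andP[/eqP el /asboolP h]].
    exact: (noY u (l0 :: v)) h.
  have eu : word_eval a u * letter a l0 = word_eval a (rcons u l0).
    by rewrite -cats1 word_eval_cat word_eval1.
  rewrite eu in h; have [vn|vn] := eqVneq v [::]; last first.
    by apply: (noY (rcons u l0) v) h => //; rewrite ?cat_rcons // -size_eq0 size_rcons.
  rewrite vn cats1 in e.
  have [u' eu'] : exists u', u = l :: u'.
    by move: e; rewrite eg; case: (u) un => //= l1 u' _ [<- _]; exists u'.
  have eg' : g ^ letter a l = word_eval a u'.
    rewrite conjgE -{1}(rwK ha g) e eu' rcons_cons word_eval_cons -cats1 word_eval_cat.
    by rewrite word_eval1 el letter_linv; gsimp.
  have ru' : red u'.
    by move: hr; rewrite e eu' rcons_cons red_cons -cats1 => /andP[_ /red_catl].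
  have := hmin' g (letter a l) hg ng; rewrite eg' rw_eval //.
  by rewrite -em' -eg e eu' size_rcons /=; lia.
have -> : word_eval a u * letter a l0 = word_eval a (rcons u l0).
  by rewrite -cats1 word_eval_cat word_eval1.
by rewrite IH // ?cat_rcons // -size_eq0 size_rcons.
Qed.

End SubgroupParity.

Section CliqueBound.
Variables (F : groupType) (n : nat) (a : n.-tuple F).
Hypothesis ha : free_basis a.
Local Notation parity := (parity ha).

Lemma parity_hom (chi : F -> bool) : (forall g h, chi (g * h) = chi g (+) chi h) ->
  forall g, chi g = parity (fun i => chi (tnth a i)) g.
Proof.
move=> hM g; have c1 : chi 1 = false by have := hM 1 1; rewrite mulg1; case: (chi 1).
have cV h : chi h^-1 = chi h.
  by have := hM h h^-1; rewrite mulgV c1; case: (chi h); case: (chi h^-1).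
rewrite -{1}(rwK ha g) /(parity _ _); elim: (rw ha g) => [|l w IH].
  by rewrite word_eval_nil.
by rewrite word_eval_cons hM IH /= oddD /letter; case: l.2; rewrite ?cV; case: (chi _).
Qed.

(** The retraction onto [X i] that kills the other factors, followed by a nontrivial character of
    [X i]. *)
Lemma factor_parity k (X : 'I_k -> set F) (i : 'I_k) : free_factorization X ->
  exists chi : F -> bool, [/\ forall g h, chi (g * h) = chi g (+) chi h,
    exists2 s, X i s & chi s & forall j s, X j s -> j != i -> chi s = false].
Proof.
move=> [hX hne].
have [chi [hM [y hy hchi]]] := subgroup_parity ha (proj1 hX i) (hne i).
pose E := [pred j | j != i].
have hfs g : fspan hX (predD (fun _ => true) E) g -> X i g.
  rewrite /fspan /= -{2}(nfK hX g); move: (nf_alt hX g).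
  elim: (nf hX g) => [|l w IH]; first by move=> _ _; rewrite pval_nil; exact: subgroup1 (proj1 hX i).
  move=> /alternating_cons[h1 _ _ h4] /= /andP[]; rewrite andbT negbK => /eqP e hw.
  rewrite pval_cons; apply: (subgroupM (proj1 hX i)); last exact: IH.
  by rewrite -e.
have hkill g : X i (kill hX E g).
  by apply: hfs; apply: kill_span; rewrite /fspan /= all_predT.
exists (fun g => chi (kill hX E g)); split.
- by move=> g h; rewrite killM hM.
- by exists y => //; rewrite (kill_syl hX E hy) /= eqxx.
move=> j s hs hj; rewrite (kill_syl hX E hs) /= hj.
by have := hM 1 1 (subgroup1 (proj1 hX i)); rewrite mulg1; case: (chi 1).
Qed.

(** Homomorphisms to Z/2 are encoded by their values on the basis, so that annihilators and the
    invariants built from them range over finite types. *)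
Definition annihilator (A : set F) : {set {ffun 'I_n -> bool}} :=
  [set h : {ffun 'I_n -> bool} | `[< forall g, A g -> parity h g = false >]]%SET.

Definition invariant (v : ES_vertex F) : {set {set {ffun 'I_n -> bool}}} :=
  [set k : {set {ffun 'I_n -> bool}} | `[< exists P A, [/\ val v P, P A & k = annihilator A] >]]%SET.

Lemma annihilator_conj A g : annihilator [set x ^ g | x in A] = annihilator A.
Proof.
apply/setP => h; rewrite !finset.inE; apply/asboolP/asboolP => hh x hx.
  by rewrite -(parityJ ha h x g); apply: hh; exists x.
by case: hx => y hy <-; rewrite parityJ; exact: hh.
Qed.

Lemma invariantE v P : val v P ->
  invariant v = [set k : {set {ffun 'I_n -> bool}} | `[< exists2 A, P A & k = annihilator A >]]%SET.
Proof.
move=> hP; apply/setP => k; rewrite !finset.inE; apply/asboolP/asboolP.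
  move=> [Q [A [hQ hA ->]]]; move: hQ; rewrite (vertex_class hP) => -[g _ eQ].
  by move: hA; rewrite -eQ => -[A' hA' <-]; exists A' => //; rewrite annihilator_conj.
by move=> [A hA ->]; exists P, A.
Qed.

(** A factor contained in only one of the spans has a character that vanishes on all the other
    factors, hence on the other span. *)
Lemma annihilator_fspan (X : 'I_3 -> set F) (hX : free_factorization X) (J J' : pred 'I_3) :
  annihilator (fspan (proj1 hX) J) = annihilator (fspan (proj1 hX) J') -> J =1 J'.
Proof.
have half U U' : annihilator (fspan (proj1 hX) U) = annihilator (fspan (proj1 hX) U') ->
    forall l, U l -> U' l.
  move=> e l hl; apply: contrapT => /negP hl'.
  have [chi [hM [s hs hchi] h0]] := factor_parity l hX.
  pose h := [ffun i => chi (tnth a i)].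
  have eh g : parity h g = chi g.
    rewrite (parity_hom hM g) /(parity _ _); congr odd; apply: eq_count => l0.
    by rewrite /h ffunE.
  have c1 : chi 1 = false by have := hM 1 1; rewrite mulg1; case: (chi 1).
  have : h \in annihilator (fspan (proj1 hX) U').
    rewrite finset.inE; apply/asboolP => g hg; rewrite eh.
    move: hg; rewrite /fspan /= -{2}(nfK (proj1 hX) g); move: (nf_alt (proj1 hX) g).
    elim: (nf _ g) => [|l1 w IH]; first by rewrite pval_nil.
    move=> /alternating_cons[h1 _ _ h4] /= /andP[h5 h6].
    rewrite pval_cons hM (IH h4 h6) (h0 l1.1) //.
    by apply: contraNneq hl' => <-.
  rewrite -e finset.inE => /asboolP /(_ s); rewrite eh hchi.
  have ns : s <> 1 by move=> es; move: hchi; rewrite es c1.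
  by rewrite /fspan /= (nf_syl (proj1 hX) hs ns) /= hl => /(_ isT).
by move=> e l; apply/idP/idP; apply: half.
Qed.

(** Equal invariants would make the two partitions of ['I_3] agree up to exchange of their parts,
    and the vertices would coincide. *)
Lemma invariant_adj u v : ES_adj u v -> invariant u <> invariant v.
Proof.
move=> [uv [P [Q [hP hQ [X [hX rP rQ]]]]]] e.
have [A hA eA] := vertex_splitting hP; have [A' hA' eA'] := vertex_splitting hQ.
rewrite eA in hP rP; rewrite eA' in hQ rQ.
have [J [_ _ _ sJ]] := refines_fspan (proj1 hX) hA rP.
have [J' [_ _ _ sJ']] := refines_fspan (proj1 hX) hA' rQ.
have : annihilator (fspan (proj1 hX) (J ord0)) \in invariant v.
  rewrite -e (invariantE hP) finset.inE; apply/asboolP.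
  by exists (fspan (proj1 hX) (J ord0)) => //; rewrite (sJ ord0); left.
rewrite (invariantE hQ) finset.inE => /asboolP[C hC eC].
suff [l] : exists l, J ord0 l != J' ord0 l /\ J ord0 l != ~~ J' ord0 l.
  by case: (J ord0 l); case: (J' ord0 l) => -[].
have [l1 h1] := adjacent_distinct (sJ ord0) (sJ' ord0) hP hQ uv.
move: hC; rewrite (sJ' ord0) => -[eCC|eCC]; rewrite eCC in eC.
  by move: h1; rewrite (annihilator_fspan eC) eqxx.
have sJ2 : range A' = [set fspan (proj1 hX) (fun l => ~~ J' ord0 l);
                           fspan (proj1 hX) (fun l => ~~ ~~ J' ord0 l)].
  rewrite (sJ' ord0) setUC; congr [set _; fspan (proj1 hX) _].
  by apply: funext => l; rewrite negbK.
have [l2] := adjacent_distinct (sJ ord0) sJ2 hP hQ uv.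
by rewrite (annihilator_fspan eC) eqxx.
Qed.

Lemma clique_bound : exists N, forall s : set (ES_vertex F), finite_set s ->
  (forall u v, s u -> s v -> u <> v -> ES_adj u v) ->
  exists l : seq (ES_vertex F), [/\ uniq l, size l <= N & s = [set` l]].
Proof.
exists #|{set {set {ffun 'I_n -> bool}}}| => s /finite_seqP[l0 hl0] hs.
exists (undup l0); split.
- exact: undup_uniq.
- rewrite -(size_map invariant); rewrite -(card_uniqP _); first exact: max_card.
  rewrite map_inj_in_uniq ?undup_uniq // => u v; rewrite !mem_undup => hu hv e.
  apply: contrapT => uv; apply: (invariant_adj _ e); apply: hs => //.
    by rewrite hl0.
  by rewrite hl0.
by rewrite hl0; apply/seteqP; split=> v /=; rewrite mem_undup.
Qed.

End CliqueBound.

Local Open Scope ring_scope.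

(** * Distances in the graph *)

Section GraphDistance.
Local Open Scope ereal_scope.

Section Distance.
Variables (R : realType) (V : Type) (adj : V -> V -> Prop).

Lemma graph_dist_le u v (N : nat) : reach adj N u v -> graph_dist R adj u v <= N%:R%:E.
Proof.
move=> [k hk [w hw]]; apply: (@le_trans _ _ (k%:R)%:E).
  by apply: ereal_inf_lbound; exists k => //; exists w.
by rewrite lee_fin ler_nat.
Qed.

Lemma graph_dist_ge u v (x : \bar R) : (forall N, walk adj N u v -> x <= N%:R%:E) ->
  x <= graph_dist R adj u v.
Proof.
move=> h; apply: le_ereal_inf_tmp => _ [k hk <-]; apply: h.
exact: hk.
Qed.

End Distance.

Lemma ES_quasiflat (R : realType) (n : nat) (hn : (2 < n)%N) (F : groupType)
    (a : n.-tuple F) (ha : free_basis a) (m : nat) (S : {set 'I_n}) :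
  S != finset.set0 -> S != [set: 'I_n]%SET ->
  exists psi : 'rV[int]_m -> ES_vertex F,
    (forall k, represents (twisted_basis a k) S (psi k)) /\
    quasi_isometric_embedding (@l1_dist R m) (graph_dist R (@ES_adj F)) psi.
Proof.
move=> S0 S1.
have hlast : (n.-1 < n)%N by lia.
pose z := Ordinal hlast.
have hz : nat_of_ord z = n.-1 by [].
have ex (k : 'rV[int]_m) : exists v, represents (twisted_basis a k) S v.
  exact: (represents_exists (twisted_basis_free ha hn hz k) S0 S1).
pose psi k := projT1 (cid (ex k)).
have hpsi k : represents (twisted_basis a k) S (psi k) by rewrite /psi; case: cid.
exists psi; split => //.
have [L [C h]] := quasiflat ha hn hz m S0 S1.
exists (L.+1%:R), (C%:R); split => [||k k']; rewrite ?ler1n ?ler0n //.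
have [h1 h2] := h k k' _ _ (hpsi k) (hpsi k').
have el : l1_dist R k k' = (l1_nat k k')%:R%:E.
  rewrite /l1_dist; congr (_%:E); rewrite (_ : \sum_(i < m) _ = Posz (l1_nat k k'))%R.
    by rewrite -pmulrn.
  rewrite /l1_nat (big_morph Posz PoszD (erefl _)); apply: eq_bigr => i _.
  by rewrite abszE.
split.
  apply: graph_dist_ge => N /h1 hN; rewrite el -EFinM -EFinB lee_fin lerBlDr -natrD.
  rewrite mulrC ler_pdivrMr ?ltr0n // -natrM ler_nat.
  by apply: leq_trans hN _; rewrite mulnC leq_mul2l leqnSn orbT.
rewrite el -EFinM -EFinD -natrM -natrD.
apply: graph_dist_le; apply: reach_le h2.
by rewrite leq_add2r leq_mul2r leqnSn orbT.
Qed.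

End GraphDistance.

(** * The geometric realization *)

Section Realization.
Variables (R : realType) (V : choiceType) (adj : V -> V -> Prop) (K : set (set V)) (N : nat).
(** These properties are shared by the flag complex and its 1-skeleton, so that both are treated at
    once. *)
Hypothesis K1 : forall u, K [set u].
Hypothesis K2 : forall u v, adj u v -> K [set u; v].
Hypothesis Kadj : forall s, K s -> exists l : seq V, [/\ uniq l, (size l <= N)%N, s = [set` l] &
  forall u v, u \in l -> v \in l -> u <> v -> adj u v].
Local Notation walk := (walk adj).
Local Notation realization := (@realization R V K).

Lemma fsum_seq (l : seq V) (f : V -> R) : uniq l -> (forall v, v \notin l -> f v = 0) ->
  \sum_(v \in [set: V]) f v = \sum_(v <- l) f v.
Proof.
move=> ul h; rewrite (fsbigE l) //; last by move=> v _; exact: h.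
by apply: eq_bigl => v; rewrite in_setT.
Qed.

Definition indicator (u v : V) : R := (v == u)%:R.

Lemma indicator_support u : [set v | indicator u v != 0] = [set u].
Proof.
apply/seteqP; split=> v /=; rewrite /indicator; first by case: (v =P u) => [//|_] /=; rewrite eqxx.
by move=> ->; rewrite eqxx oner_neq0.
Qed.

Lemma indicator_face u : K [set v | indicator u v != 0].
Proof. by rewrite indicator_support. Qed.

Lemma indicator_sum u : \sum_(v \in [set: V]) indicator u v = 1.
Proof.
rewrite (@fsum_seq [:: u]) ?big_seq1 /indicator ?eqxx //.
by move=> v; rewrite inE => /negPf ->.
Qed.

Definition vertex_point u : realization :=
  RealizationPoint (fun v => ler0n R (v == u)) (indicator_face u) (indicator_sum u).

Lemma simplex_dist_edge u v : simplex_dist (vertex_point u) (vertex_point v) <= 1.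
Proof.
rewrite /simplex_dist -[leRHS]sqrtr1 ler_wsqrtr //=.
have [->|uv] := eqVneq u v.
  rewrite (@fsum_seq [::]) ?big_nil ?mulr0 ?ler01 // => w _.
  by rewrite subrr expr0n.
rewrite (@fsum_seq [:: u; v]) /= ?inE ?uv //; last first.
  move=> w; rewrite !inE negb_or => /andP[/negPf h /negPf h'].
  by rewrite /indicator h h' subrr expr0n.
rewrite big_cons big_seq1 /indicator !eqxx (negPf uv) eq_sym (negPf uv).
by rewrite subr0 sub0r sqrrN !expr1n; lra.
Qed.

Lemma realization_dist_walk k u v : walk k u v ->
  (realization_dist (vertex_point u) (vertex_point v) <= k%:R%:E)%E.
Proof.
move=> [w [w0 wk hw]].
apply: (@le_trans _ _
  (\sum_(i < k) simplex_dist (vertex_point (w i)) (vertex_point (w i.+1)))%:E).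
  apply: ereal_inf_lbound; exists k, (fun i => vertex_point (w i)); split; rewrite ?w0 ?wk //.
  move=> i hi; exists [set w i; w i.+1]; first exact: (K2 (hw i hi)).
  by rewrite /= !indicator_support.
rewrite lee_fin; apply: le_trans (ler_sum _ (fun i _ => simplex_dist_edge _ _)) _.
by rewrite sumr_const card_ord.
Qed.

(** The factor 2 is a crude bound for the square root of 2 that undoes the normalization of
    [simplex_dist]. *)
Lemma bary_le_simplex_dist (p q : realization) (l : seq V) v : uniq l ->
  (forall w, w \notin l -> bary p w = 0 /\ bary q w = 0) -> v \in l ->
  `|bary p v - bary q v| <= 2 * simplex_dist p q.
Proof.
move=> ul h hv; have s0 : 0 <= simplex_dist p q by exact: sqrtr_ge0.
have hw0 w : w \in l -> 0 <= (bary p w - bary q w) ^+ 2 by move=> _; exact: sqr_ge0.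
rewrite -(@ler_pXn2r _ 2) ?nnegrE ?mulr_ge0 // real_normK ?num_real // exprMn.
rewrite /simplex_dist (@fsum_seq l) //; last first.
  by move=> w /h[-> ->]; rewrite subrr expr0n.
rewrite sqr_sqrtr; last first.
  by rewrite mulr_ge0 ?invr_ge0 ?ler0n // big_seq sumr_ge0.
rewrite (big_rem v hv) /=.
have h1 : 0 <= \sum_(w <- rem v l) (bary p w - bary q w) ^+ 2.
  by apply: sumr_ge0 => w _; exact: sqr_ge0.
have h2 : 0 <= (bary p v - bary q v) ^+ 2 by exact: sqr_ge0.
by lra.
Qed.

Section Potential.
Variable f : V -> nat.
Hypothesis f1 : forall u v, adj u v -> (f v <= (f u).+1)%N.

Definition potential (p : realization) : R := \sum_(v \in [set: V]) bary p v * (f v)%:R.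

Lemma potential_vertex u : potential (vertex_point u) = (f u)%:R.
Proof.
rewrite /potential (@fsum_seq [:: u]) ?big_seq1 //=; first by rewrite /indicator eqxx mul1r.
by move=> v; rewrite inE /indicator => /negPf ->; rewrite mul0r.
Qed.

(** The barycentric coordinates of both points sum to 1, so [f] may be replaced by its difference
    with [f v0], which is at most 1 in absolute value on a clique. *)
Lemma potential_face p q : same_face p q ->
  potential q - potential p <= (2 * N)%:R * simplex_dist p q.
Proof.
move=> [s /Kadj[l [ul sl -> ladj]] hs].
have h w : w \notin l -> bary p w = 0 /\ bary q w = 0.
  move=> hw; split; apply: contrapT => /eqP hne; move/negP: hw; apply; apply: (hs w);
  by [left|right].
have sum1 (r : realization) : (forall w, w \notin l -> bary r w = 0) -> \sum_(w <- l) bary r w = 1.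
  by move=> hr; rewrite -(bary_sum r) -(fsum_seq ul hr).
have pot (r : realization) : (forall w, w \notin l -> bary r w = 0) ->
    potential r = \sum_(w <- l) bary r w * (f w)%:R.
  by move=> hr; apply: fsum_seq => // w /hr ->; rewrite mul0r.
have hp w : w \notin l -> bary p w = 0 by case/h.
have hq w : w \notin l -> bary q w = 0 by case/h.
have s0 : 0 <= simplex_dist p q by exact: sqrtr_ge0.
case el : l => [|v0 l'].
  by have := sum1 p hp; rewrite el big_nil => /esym /eqP; rewrite oner_eq0.
have -> : potential q - potential p =
    \sum_(w <- l) (bary q w - bary p w) * ((f w)%:R - (f v0)%:R).
  under eq_bigr do rewrite mulrBr; rewrite sumrB -mulr_suml sumrB !sum1 // subrr mul0r subr0.
  by under eq_bigr do rewrite mulrBl; rewrite sumrB !pot.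
have v0l : v0 \in l by rewrite el mem_head.
apply: (@le_trans _ _ (\sum_(w <- l) 2 * simplex_dist p q)).
  rewrite big_seq [leRHS]big_seq; apply: ler_sum => w hw.
  apply: le_trans (ler_norm _) _; rewrite normrM distrC.
  apply: le_trans (bary_le_simplex_dist ul h hw).
  rewrite ler_piMr //; have [->|ne] := eqVneq w v0; first by rewrite subrr normr0 ler01.
  have h1 := f1 (ladj w v0 hw v0l (elimN eqP ne)).
  have h2 := f1 (ladj v0 w v0l hw (fun e => elimN eqP ne (esym e))).
  rewrite ler_norml lerBrDl lerBlDr.
  move: h1 h2; rewrite -!(ler_nat R) -!natr1 => h1 h2; apply/andP; split; lra.
rewrite big_const_seq count_predT iter_addr_0 -mulrnAl natrM -mulr_natr.
by rewrite ler_wpM2r // ler_wpM2l // ler_nat.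
Qed.

Lemma potential_path (z : nat -> realization) k :
  (forall i, (i < k)%N -> same_face (z i) (z i.+1)) ->
  potential (z k) - potential (z 0%N) <=
    (2 * N)%:R * \sum_(i < k) simplex_dist (z i) (z i.+1).
Proof.
elim: k => [|k IH] h; first by rewrite subrr big_ord0 mulr0.
rewrite big_ord_recr /= mulrDr.
have h1 := IH (fun i hi => h i (ltnW hi)); have h2 := potential_face (h k (ltnSn k)).
move: h1 h2; set A := _ * \sum_(i < k) _; set B := _ * simplex_dist _ _; lra.
Qed.

End Potential.

(* The distance to [u] truncated at [D] extends affinely to a Lipschitz function of
   the realization, because simplices have at most [N] vertices. *)
Lemma realization_dist_ge D u v : (forall k, walk k u v -> (D <= k)%N) ->
  ((D%:R / (2 * N).+1%:R)%:E <= realization_dist (vertex_point u) (vertex_point v))%E.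
Proof.
move=> hD.
(* The alternative [j == D] truncates the distance and gives a value to the vertices of other
   components. *)
have hP w : exists j, (j == D) || `[< walk j u w >] by exists D; rewrite eqxx.
pose f w := ex_minn (hP w).
have f1 w w' : adj w w' -> (f w' <= (f w).+1)%N.
  move=> ww'; rewrite /f; case: (ex_minnP (hP w')) => j' _ hj'.
  case: (ex_minnP (hP w)) => j /orP[/eqP -> _|/asboolP hj _].
    by apply: leq_trans (leqnSn _); apply: hj'; rewrite eqxx.
  apply: hj'; apply/orP; right; apply/asboolP; rewrite -addn1.
  exact: walk_trans hj (walk1 ww').
have fu : f u = 0%N.
  rewrite /f; case: (ex_minnP (hP u)) => j _ /(_ 0%N); rewrite leqn0 => h; apply/eqP/h.
  by apply/orP; right; apply/asboolP; exact: walk0.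
have fv : f v = D.
  rewrite /f; case: (ex_minnP (hP v)) => j hj /(_ D); rewrite eqxx => /(_ isT) hle.
  by apply/eqP; rewrite eqn_leq hle /=; case/orP: hj => [/eqP -> //|/asboolP]; exact: hD.
apply: le_ereal_inf_tmp => _ [k [z [z0 zk hz ->]]]; rewrite lee_fin.
have := potential_path f1 hz; rewrite z0 zk !potential_vertex fu fv subr0 => h.
rewrite ler_pdivrMr ?ltr0n // mulrC; apply: le_trans h _.
by rewrite ler_wpM2r ?ler_nat // sumr_ge0 // => i _; exact: sqrtr_ge0.
Qed.

Section Embedding.
Variables (m L C : nat) (psi : 'rV[int]_m -> V).
Hypothesis psi_walk : forall k k', (forall j, walk j (psi k) (psi k') ->
  (l1_nat k k' <= L * (j + C))%N) /\ reach adj (L * l1_nat k k' + C) (psi k) (psi k').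

Definition floor_row (x : 'rV[R]_m) : 'rV[int]_m := \row_i Num.floor (x 0 i).

Section Floor.
Lemma floor_dist (s t : R) :
  `|(Num.floor s)%:~R - (Num.floor t)%:~R| <= `|s - t| + 1 :> R /\
  `|s - t| <= `|(Num.floor s)%:~R - (Num.floor t)%:~R| + 1 :> R.
Proof.
have := real_floor_itv (num_real s); have := real_floor_itv (num_real t).
rewrite !intrD !mulr1z; set a : R := _%:~R; set b : R := _%:~R => /andP[ha1 ha2] /andP[hb1 hb2].
have h : `|(b - a) - (s - t)| <= 1 by rewrite ler_norml; apply/andP; split; lra.
split.
  by rewrite -[b - a](subrK (s - t)) [leRHS]addrC; apply: le_trans (ler_normD _ _) _; rewrite lerD2r.
rewrite -[s - t](subrK (b - a)) [leRHS]addrC.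
by apply: le_trans (ler_normD _ _) _; rewrite lerD2r distrC.
Qed.

Variables x y : 'rV[R]_m.
Let e : R := Num.sqrt (\sum_(i < m) (x 0 i - y 0 i) ^+ 2).

Lemma coordinate_le i : `|x 0 i - y 0 i| <= e.
Proof.
rewrite -sqrtr_sqr ler_wsqrtr // (bigD1 i) //= lerDl sumr_ge0 // => j _.
exact: sqr_ge0.
Qed.

Lemma floor_row_le : (l1_nat (floor_row x) (floor_row y))%:R <= m%:R * e + m%:R.
Proof.
rewrite /l1_nat natr_sum -[m in leRHS]card_ord -!sum1_card !natr_sum mulr_suml -big_split /=.
apply: ler_sum => i _; rewrite mul1r; apply: le_trans (lerD (coordinate_le i) (lexx _)).
rewrite natr_absz intr_norm rmorphB /= !mxE.
exact: (floor_dist _ _).1.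
Qed.

(** The Euclidean distance is at most the [l1] distance, because its square is at most the product
    of the two. *)
Lemma floor_row_ge : e <= (l1_nat (floor_row x) (floor_row y))%:R + m%:R.
Proof.
have e0 : 0 <= e by exact: sqrtr_ge0.
have he : e ^+ 2 <= (\sum_(i < m) `|x 0 i - y 0 i|) * e.
  rewrite sqr_sqrtr; last by apply: sumr_ge0 => i _; exact: sqr_ge0.
  rewrite mulr_suml; apply: ler_sum => i _; rewrite -real_normK ?num_real // expr2.
  by rewrite ler_wpM2l // coordinate_le.
apply: (@le_trans _ _ (\sum_(i < m) `|x 0 i - y 0 i|)).
  move: e0; rewrite le_eqVlt => /orP[/eqP <-|e0]; first by apply: sumr_ge0 => i _.
  by rewrite -(ler_pM2r e0) -expr2.
have mE : m%:R = \sum_(i < m) 1 :> R by rewrite sumr_const card_ord.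
rewrite /l1_nat natr_sum mE -big_split /=.
apply: ler_sum => i _; rewrite natr_absz intr_norm rmorphB /= !mxE.
exact: (floor_dist _ _).2.
Qed.

End Floor.

Lemma realization_embedding :
  quasi_isometric_embedding (@euclidean_dist R m) (@realization_dist R V K)
    (fun x => vertex_point (psi (floor_row x))).
Proof.
exists ((L.+1 * (2 * N).+1 * m.+1)%:R), ((L.+1 * (C + m + 1))%:R).
split; [by rewrite ler1n; lia|exact: ler0n|move=> x y].
have [hlow hup] := psi_walk (floor_row x) (floor_row y).
have he := floor_row_le x y; have he' := floor_row_ge x y.
rewrite /euclidean_dist; move: he he'; set e := Num.sqrt _; set l := l1_nat _ _ => he he'.
have e0 : 0 <= e by exact: sqrtr_ge0.
rewrite -/l in hlow hup.
split.
  (* Dividing by [L.+1], which is never zero, turns [l <= L * (k + C)] into a lower bound for the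
     length [k] of a walk. *)
  apply: le_trans (realization_dist_ge (D := l %/ L.+1 - C) _); last first.
    move=> k /hlow hk; rewrite leq_subLR addnC -ltnS ltn_divLR //; nia.
  rewrite -EFinM -EFinB lee_fin.
  set D := (_ - C)%N.
  have hl : (l + m <= L.+1 * D + L.+1 * (C + m + 1))%N.
    have := ltn_mod l L.+1; have := divn_eq l L.+1; rewrite /D.
    move: (l %/ L.+1)%N (l %% L.+1)%N => q r; nia.
  rewrite lerBlDr ler_pdivrMl ?ltr0n ?muln_gt0 // mulrDr.
  apply: le_trans he' _; rewrite -natrD; apply: (le_trans (y := (L.+1 * D + L.+1 * (C + m + 1))%:R)).
    by rewrite ler_nat.
  have -> : (L.+1 * (2 * N).+1 * m.+1)%:R * (D%:R / (2 * N).+1%:R) = (L.+1 * m.+1 * D)%:R :> R.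
    rewrite !natrM; move: (2 * N)%N => c; field.
    by rewrite nat1r pnatr_eq0.
  by rewrite -natrM -natrD ler_nat leq_add // ?leq_pmull ?muln_gt0 // leq_mul2r leq_pmulr ?orbT.
have [k hk hw] := hup.
apply: le_trans (realization_dist_walk hw) _.
rewrite -EFinM -EFinD lee_fin; apply: (@le_trans _ _ ((L * l + C)%:R)); first by rewrite ler_nat.
rewrite natrD natrM; apply: (@le_trans _ _ (L%:R * (m%:R * e + m%:R) + C%:R)).
  by rewrite lerD2r ler_wpM2l.
rewrite mulrDr mulrA -!natrM -addrA -natrD; apply: lerD; last by rewrite ler_nat; nia.
by rewrite ler_wpM2r // ler_nat; nia.
Qed.

End Embedding.
End Realization.

(** * Vertices and edges of the flag complex *)

Section Skeleton.
Variables (V : choiceType) (adj : V -> V -> Prop).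
Hypothesis adj_sym : forall u v, adj u v -> adj v u.

Lemma flag_vertex u : flag_complex adj [set u].
Proof.
split; [exact: finite_set1|by exists u|].
by move=> v w /= -> ->.
Qed.

Lemma flag_edge u v : adj u v -> flag_complex adj [set u; v].
Proof.
move=> h; split; [|by exists u; left|].
  by rewrite finite_setU; split; exact: finite_set1.
by move=> w w' /= [->|->] [->|->] // _; exact: adj_sym.
Qed.

Lemma card_pair_le (u v : V) : ([set u; v] #<= `I_2)%card.
Proof.
have -> : [set u; v] = (fun i : nat => if i == 0%N then u else v) @` `I_2.
  apply/seteqP; split=> w /=; first by case=> ->; [exists 0%N|exists 1%N].
  by case=> -[|i] /= _ <-; [left|right].
exact: card_image_le.
Qed.

End Skeleton.

Theorem theorem5p4 (R : realType) (n : nat) (hn : (2 < n)%N)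
    (F : groupType) (a : n.-tuple F) (ha : free_basis a) :
  (forall (m : nat) (S : {set 'I_n}),
     (1 <= m)%N -> S != finset.set0 -> S != [set: 'I_n]%SET ->
     exists psi : 'rV[int]_m -> ES_vertex F,
       (forall k, represents (twisted_basis a k) S (psi k)) /\
       quasi_isometric_embedding (@l1_dist R m)
         (graph_dist R (@ES_adj F)) psi) /\
  (forall m : nat, (1 <= m)%N ->
     exists f : 'rV[R]_m ->
                realization R (one_skeleton (flag_complex (@ES_adj F))),
       quasi_isometric_embedding (@euclidean_dist R m)
         (@realization_dist R _ _) f) /\
  (forall m : nat, (1 <= m)%N ->
     exists f : 'rV[R]_m -> realization R (flag_complex (@ES_adj F)),
       quasi_isometric_embedding (@euclidean_dist R m)
         (@realization_dist R _ _) f).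
Proof.
have sym := @ES_adj_sym F.
have hlast : (n.-1 < n)%N by lia.
pose z := Ordinal hlast.
have z0 : [set z]%SET != finset.set0 by apply/finset.set0Pn; exists z; rewrite finset.inE.
have zT : [set z]%SET != [set: 'I_n]%SET.
  by apply/eqP => /(congr1 (fun A : {set 'I_n} => #|A|)); rewrite cards1 cardsT card_ord; lia.
(* The realizations need the estimates in terms of walks, taken here for the subset formed by [z]
   alone. *)
have flat m : exists L C (psi : 'rV[int]_m -> ES_vertex F), forall k k',
    (forall j, walk (@ES_adj F) j (psi k) (psi k') -> (l1_nat k k' <= L * (j + C))%N) /\
    reach (@ES_adj F) (L * l1_nat k k' + C) (psi k) (psi k').
  have [psi [hpsi _]] := ES_quasiflat R hn ha m z0 zT.
  have [L [C h]] := quasiflat ha hn (erefl : nat_of_ord z = n.-1) m z0 zT.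
  by exists L, C, psi => k k'; exact: h.
have [N hN] := clique_bound ha.
have clique s : flag_complex (@ES_adj F) s -> exists l : seq (ES_vertex F),
    [/\ uniq l, (size l <= N)%N, s = [set` l]
      & forall u v, u \in l -> v \in l -> u <> v -> ES_adj u v].
  move=> [fs _ hs]; have [l [ul sl el]] := hN s fs hs.
  by exists l; split => // u v hu hv; apply: hs; rewrite el.
split; [by move=> m S _; exact: ES_quasiflat|split=> m _; have [L [C [psi hpsi]]] := flat m].
  have K1 u : one_skeleton (flag_complex (@ES_adj F)) [set u].
    by split; [exact: flag_vertex|rewrite -(setUid [set u]); exact: card_pair_le].
  exists (fun x => vertex_point R K1 (psi (floor_row x))).
  apply: (realization_embedding _ _ (adj := @ES_adj F) (N := N)) hpsi => [u v h|s [hs _]].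
    by split; [exact: flag_edge|exact: card_pair_le].
  exact: clique.
exists (fun x => vertex_point R (@flag_vertex _ (@ES_adj F)) (psi (floor_row x))).
exact: (realization_embedding _ _ (flag_edge sym) clique hpsi).
Qed.
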